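(* Assume that $p\in(1,\infty]$, $r\in(n,\overline{\infty}]$ (i.e. $r\in(n,\infty]\cup\{\overline{\infty}\}$), $\alpha\in(2,\infty)$, $\beta\in[1,\infty)$, and $\frac{2}{\alpha}+\frac{n}{r}\leq1$. If $T\in(0,\infty]$, $f\in L^{p,\infty}(\mathbb{R}^{n})$ (with values in $\mathbb{R}^n$), and $u,v\in\mathcal{L}_{r,\infty}^{\alpha,\beta}(T_{-})$ (with values in $\mathbb{R}^n$) satisfy $S[f] =_{r}^{\mathrm{a.e.}} u+B[u,u]$ and $S[f] =_{r}^{\mathrm{a.e.}} v+B[v,v]$ on $(0,T)$, then $u =_{r}^{\mathrm{a.e.}} v$.
   Context: $n\ge1$ is the integer space dimension; $|A|$ is the Lebesgue measure of a set $A$; $|\cdot|$ is also the Euclidean norm of vectors and tensors. The summation convention over repeated indices is used. Lorentz spaces. For a measurable (scalar-, vector- or tensor-valued) function $f$ on $\mathbb{R}^{n}$ let $\lambda_f(y)=|\{x:|f(x)|>y\}|$ for $y>0$, and $f^*(t)=\sup\{y\in(0,\infty):\lambda_f(y)>t\}$ for $t>0$ ($\sup\emptyset=0$). Put $\|f\|^*_{L^{p,q}(\mathbb{R}^n)}=\left(\frac qp\int_0^\infty[t^{1/p}f^*(t)]^q\frac{dt}{t}\right)^{1/q}$ for $p,q\in[1,\infty)$, and $\|f\|^*_{L^{p,\infty}(\mathbb{R}^n)}=\sup_{t>0}t^{1/p}f^*(t)$ for $p\in[1,\infty]$. The additional symbol $\overline{\infty}$ refers to the true supremum: $\|f\|^*_{L^{\overline\infty,\infty}}=\|f\|_{L^{\overline\infty}}=\sup_{x}|f(x)|$.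 Convention: $\frac1r=0$ for $r\in\{\infty,\overline\infty\}$. $L^{p,q}(\mathbb{R}^n)$ is the set of measurable $f$ with $\|f\|^*_{L^{p,q}}<\infty$, modulo $=_p$, where $f=_pg$ means equality almost everywhere if $p\in[1,\infty]$, and equality everywhere if $p=\overline\infty$. The same definitions are used on $\mathbb{R}$. Path spaces. For $T\in(0,\infty]$, $\mathcal{L}^{\alpha,\beta}_{p,q}(T)$ is the space of measurable functions $u$ on $(0,T)\times\mathbb{R}^n$ with $\big\|t\mapsto\mathbf 1_{(0,T)}(t)\|u(t)\|^*_{L^{p,q}(\mathbb{R}^n)}\big\|^*_{L^{\alpha,\beta}(\mathbb{R})}<\infty$, modulo $=_p^{\mathrm{a.e.}}$, where $u=_p^{\mathrm{a.e.}}v$ means $u(t)=_pv(t)$ for almost every $t\in(0,T)$. $\mathcal{L}^{\alpha,\beta}_{p,q}(T_-)=\bigcap_{T'\in(0,T)}\mathcal{L}^{\alpha,\beta}_{p,q}(T')$. Operators. $\Phi(t,x)=(4\pi t)^{-n/2}e^{-|x|^2/4t}$ is the heat kernel and $\mathcal{T}_{ij}(t,x)=(2\pi)^{-n}\int_{\mathbb{R}^n}e^{\mathrm{i}x\cdot\xi-t|\xi|^2}\left(\delta_{ij}-\frac{\xi_i\xi_j}{|\xi|^2}\right)d\xi$ is the Oseen kernel, for $(t,x)\in(0,\infty)\times\mathbb{R}^n$. Whenever the integrals are defined, $S_i[f](t,x)=\int_{\mathbb{R}^n}\Phi(t,x-y)f_i(y)\,dy$ and $B_i[u,v](t,x)=\int_0^t\int_{\mathbb{R}^n}\nabla_k\mathcal{T}_{ij}(t-s,x-y)u_j(s,y)v_k(s,y)\,dy\,ds$.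 For $f\in L^{p,\infty}(\mathbb{R}^n)$ with $p\in(1,\infty]$, $S[f](t,x)$ is defined for all $(t,x)\in(0,\infty)\times\mathbb{R}^n$; for $u\in\mathcal{L}^{\alpha,\beta}_{r,\infty}(T_-)$ with $r\in(n,\infty]\cup\{\overline{\infty}\}$, $\alpha\in(2,\infty)$, $\beta\in[1,\infty)$ and $\frac{2}{\alpha}+\frac{n}{r}\leq1$, $B[u,u](t,x)$ is defined for a.e. $(t,x)\in(0,T)\times\mathbb{R}^n$ and, if $r\in\{\infty,\overline\infty\}$, for a.e. $t\in(0,T)$ it is defined for all $x$. *)

(* Defs.v *)
From HB Require Import structures.
From mathcomp Require Import all_boot all_order all_algebra.
From mathcomp Require Import all_classical all_reals all_analysis.
From mathcomp Require Import measurable_realfun complex.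

Set Implicit Arguments.
Unset Strict Implicit.
Unset Printing Implicit Defensive.

Import Order.TTheory GRing.Theory Num.Theory.
Import numFieldNormedType.Exports.

Local Open Scope classical_set_scope.
Local Open Scope ring_scope.

Definition measure_rV_display : measure_display.
Proof. exact (measure_tuple_display default_measure_display). Qed.

Section measurable_rV.
Context {R : realType} (n : nat).

Let coors : 'I_n -> 'rV[R]_n -> R := fun i x => x ord0 i.

Let rV_set0 : g_sigma_preimage coors set0.
Proof. exact: sigma_algebra0. Qed.

Let rV_setC A : g_sigma_preimage coors A -> g_sigma_preimage coors (~` A).
Proof. exact: sigma_algebraC. Qed.

Let rV_bigcup (F : (set 'rV[R]_n)^nat) :
  (forall i, g_sigma_preimage coors (F i)) ->
  g_sigma_preimage coors (\bigcup_i (F i)).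
Proof. exact: sigma_algebra_bigcup. Qed.

HB.instance Definition _ := @isMeasurable.Build measure_rV_display
  'rV[R]_n (g_sigma_preimage coors) rV_set0 rV_setC rV_bigcup.

Lemma measurable_coord (i : 'I_n) :
  measurable_fun [set: 'rV[R]_n] (fun x => x ord0 i).
Proof.
move=> _ Y mY; rewrite setTI; apply: sub_sigma_algebra => /=.
rewrite -bigcup_seq/=; exists i => /=; first by rewrite mem_index_enum.
by exists Y => //; rewrite setTI.
Qed.

Lemma measurable_fun_rV d (T : measurableType d) (f : T -> 'rV[R]_n) :
  (forall i, measurable_fun [set: T] (fun x => f x ord0 i)) ->
  measurable_fun [set: T] f.
Proof.
move=> mf _ A mA; rewrite setTI.
suff H : g_sigma_preimage coors `<=` [set B | measurable (f @^-1` B)].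
  exact: (H A mA).
apply: smallest_sub.
  split => [|B mB|F mF] /=.
  - by rewrite preimage_set0.
  - by rewrite setTD preimage_setC; exact: measurableC.
  - by rewrite preimage_bigcup; apply: bigcupT_measurable => k; exact: mF.
rewrite -bigcup_seq; apply: bigcup_sub => i _ B [C mC <-] /=.
by rewrite setTI; have := mf i measurableT C mC; rewrite setTI.
Qed.

End measurable_rV.

Section sigma_finite_prod.
Local Open Scope ereal_scope.
Context d1 d2 (T1 : measurableType d1) (T2 : measurableType d2) (R : realType).
Variable m1 : {sigma_finite_measure set T1 -> \bar R}.
Variable m2 : {sigma_finite_measure set T2 -> \bar R}.

Lemma sigma_finite_prod : sigma_finite setT (m1 \x m2).
Proof.
have /sigma_finiteP[F [TF ndF Foo]] := sigma_finiteT m1.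
have /sigma_finiteP[G [TG ndG Goo]] := sigma_finiteT m2.
exists (fun n => F n `*` G n).
  rewrite -setXTT TF TG predeqE => -[x y]; split.
    move=> [/= [n _ Fnx] [k _ Gky]]; exists (maxn n k) => //; split.
    - by move: x Fnx; exact/subsetPset/ndF/leq_maxl.
    - by move: y Gky; exact/subsetPset/ndG/leq_maxr.
  by move=> [n _ []/= ? ?]; split; exists n.
move=> k; have [? ?] := Foo k; have [? ?] := Goo k.
split; first exact: measurableX.
by rewrite product_measure1E// lte_mul_pinfty// ge0_fin_numE.
Qed.

End sigma_finite_prod.

(* Lebesgue measure on the Borel sets of 'rV[R]_n, by induction on n: the image
   of the product measure under the identification of R * R^n with R^(n+1). *)
Section lebesgue_rV.
Context {R : realType}.

Definition rVcons n (z : R * 'rV[R]_n) : 'rV[R]_n.+1 :=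
  row_mx (const_mx z.1 : 'rV_1) z.2.

Definition rVuncons n (x : 'rV[R]_n.+1) : R * 'rV[R]_n :=
  (x ord0 ord0, rsubmx (x : 'rV_(1 + n))).

Lemma rVconsK n : cancel (@rVcons n) (@rVuncons n).
Proof.
move=> [a v]; rewrite /rVuncons /rVcons row_mxKr; congr pair.
by rewrite mxE; case: splitP => // j _; rewrite mxE.
Qed.

Lemma measurable_rVcons n : measurable_fun setT (@rVcons n).
Proof.
apply: measurable_fun_rV => i.
have -> : i = fintype.unsplit (fintype.split (i : 'I_(1 + n))) by rewrite splitK.
case: (fintype.split _) => j /=.
- rewrite (_ : (fun _ => _) = fst) //.
  by apply/funext => z; rewrite [LHS]row_mxEl mxE.
- rewrite (_ : (fun _ => _) = (fun v : 'rV[R]_n => v ord0 j) \o snd).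
    by apply: measurableT_comp => //; exact: measurable_coord.
  by apply/funext => z; rewrite [LHS]row_mxEr.
Qed.

Lemma measurable_rVuncons n : measurable_fun setT (@rVuncons n).
Proof.
apply/measurable_fun_pairP; split; first exact: measurable_coord.
apply: measurable_fun_rV => i.
rewrite (_ : (fun _ => _) =
  fun x : 'rV[R]_(n.+1) => x ord0 (rshift 1 i : 'I_(1 + n))).
  exact: measurable_coord.
by apply/funext => x; rewrite mxE.
Qed.

Section lebesgue_rV_step.
Variables (n : nat) (m : {sigma_finite_measure set 'rV[R]_n -> \bar R}).

Definition lebesgue_rVS : set 'rV[R]_n.+1 -> \bar R :=
  pushforward (@lebesgue_measure R \x m)%E (@rVcons n).

Let rVS0 : lebesgue_rVS set0 = 0%E.
Proof. by rewrite /lebesgue_rVS /pushforward preimage_set0 measure0. Qed.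

Let rVS_ge0 A : (0 <= lebesgue_rVS A)%E.
Proof. exact: (measure_ge0 (@lebesgue_measure R \x m)%E). Qed.

Let rVS_sigma_additive : semi_sigma_additive lebesgue_rVS.
Proof.
have mc B : measurable B -> measurable (@rVcons n @^-1` B).
  by move=> mB; rewrite -[X in measurable X]setTI; exact: measurable_rVcons.
move=> F mF tF mUF; rewrite /lebesgue_rVS /pushforward preimage_bigcup.
apply: measure_semi_sigma_additive.
- by move=> k; exact: mc.
- apply/trivIsetP => /= i j _ _ ij; rewrite -preimage_setI.
  by move/trivIsetP : tF => /(_ _ _ _ _ ij) ->//; rewrite preimage_set0.
- by rewrite -preimage_bigcup; exact: mc.
Qed.

HB.instance Definition _ := isMeasure.Build _ _ _ lebesgue_rVS
  rVS0 rVS_ge0 rVS_sigma_additive.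

Let rVS_sigma_finite : sigma_finite setT lebesgue_rVS.
Proof.
have [F TF Foo] := sigma_finite_prod (@lebesgue_measure R) m.
exists (fun k => @rVuncons n @^-1` F k).
  by rewrite -preimage_bigcup -TF preimage_setT.
move=> k; have [mF Fk] := Foo k; split.
  by rewrite -[X in measurable X]setTI; exact: measurable_rVuncons.
rewrite /lebesgue_rVS /pushforward -comp_preimage.
by rewrite (_ : _ \o _ = id) // ; apply/funext; exact: rVconsK.
Qed.

HB.instance Definition _ := Measure_isSigmaFinite.Build _ _ _ lebesgue_rVS
  rVS_sigma_finite.

End lebesgue_rV_step.

Fixpoint lebesgue_rV n : {sigma_finite_measure set 'rV[R]_n -> \bar R} :=
  match n with
  | 0 => @dirac _ 'rV[R]_0 0 R
  | m.+1 => lebesgue_rVS (lebesgue_rV m)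
  end.

End lebesgue_rV.

(* Lebesgue (not just Borel) measurability: preimages of Borel sets lie in the
   completion of the Borel sigma-algebra. The library's integral of such
   a function with respect to [mu] is still its Lebesgue integral, and
   [\forall x \ae mu, _] does not require the exceptional set to be Borel. *)
Definition lebesgue_measurable_fun d d' (X : measurableType d)
    (Y : measurableType d') (R : realType) (mu : set X -> \bar R) (D : set X)
    (f : X -> Y) : Prop :=
  forall B : set Y, measurable B -> completed_algebra_gen mu (D `&` f @^-1` B).

Section euclidean.
Context {R : realType} {n : nat}.
Implicit Types x y : 'rV[R]_n.

Definition dotp x y : R := \sum_(k < n) x ord0 k * y ord0 k.

Definition enorm x : R := Num.sqrt (dotp x x).

End euclidean.

(* [linfty] is the exponent oo of the essential supremum, [lsup] the exponent
   \overline{oo} of the true supremum. *)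
Inductive lexp (R : realType) : Type :=
| lfin of R
| linfty
| lsup.
Arguments linfty {R}.
Arguments lsup {R}.

Section lorentz.
Context {R : realType}.
Implicit Types p q r : lexp R.

Definition lexp_inv p : R := if p is lfin a then a^-1 else 0.

Definition lexp_gt (a : R) p : bool := if p is lfin b then a < b else true.

Local Open Scope ereal_scope.

Section lorentz_norm.
Context d (X : measurableType d) (mu : set X -> \bar R).
Implicit Type g : X -> \bar R.

(* [g] stands for |f|; it has values in [0, +oo] because the time profiles
   t |-> ||u(t)|| may take the value +oo. The outer measure [mu^*] gives a
   Lebesgue measurable set its Lebesgue measure. *)
Definition distr_fun g (y : R) : \bar R := (mu^*)%mu [set x | y%:E < g x].

Definition rearrangement g (t : R) : \bar R :=
  maxe 0 (ereal_sup [set y%:E | y in [set y : R |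
    (0 < y)%R /\ t%:E < distr_fun g y]]).

(* The pairs (p, q) in use are [1,oo)^2, [1,oo] x {oo} and (\overline{oo}, oo);
   the value at other pairs is irrelevant. *)
Definition lorentz_norm p q g : \bar R :=
  match p, q with
  | lsup, _ => ereal_sup [set g x | x in setT]
  | lfin a, lfin b =>
      ((b / a)%:E * \int[@lebesgue_measure R]_(t in `]0%R, +oo[)
         (((t `^ a^-1)%:E * rearrangement g t) `^ b * (t^-1)%:E)) `^ b^-1
  | _, _ => ereal_sup [set (t `^ lexp_inv p)%:E * rearrangement g t |
                       t in [set t : R | (0 < t)%R]]
  end.

End lorentz_norm.

Context {n : nat}.
Notation V := 'rV[R]_n.
Notation mu := (@lebesgue_rV R n).

Definition Lnorm_rV p q (f : V -> V) : \bar R :=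
  lorentz_norm mu p q (fun x => (enorm (f x))%:E).

Definition lorentz_space p q (f : V -> V) : Prop :=
  lebesgue_measurable_fun mu setT f /\ Lnorm_rV p q f < +oo.

Definition eq_lexp p (f g : V -> V) : Prop :=
  match p with
  | lsup => forall x, f x = g x
  | _ => \forall x \ae mu, f x = g x
  end.

Definition time_interval (T : \bar R) : set R :=
  [set t | (0 < t)%R /\ t%:E < T].

(* Functions on (0,T) x R^n are total functions of which only the values at
   times in (0,T) are used. *)
Definition path_space (alpha beta p q : lexp R) (T : \bar R)
    (u : R -> V -> V) : Prop :=
  lebesgue_measurable_fun (@lebesgue_measure R \x mu)
    (time_interval T `*` setT) (fun z => u z.1 z.2) /\
  lorentz_norm (@lebesgue_measure R) alpha beta
    (fun t => if t \in time_interval T then Lnorm_rV p q (u t) else 0) < +oo.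

Definition path_space_minus (alpha beta p q : lexp R) (T : \bar R)
    (u : R -> V -> V) : Prop :=
  forall T' : R, time_interval T T' -> path_space alpha beta p q T'%:E u.

Definition eq_lexp_ae p (T : \bar R) (u v : R -> V -> V) : Prop :=
  \forall t \ae @lebesgue_measure R, time_interval T t -> eq_lexp p (u t) (v t).

End lorentz.

Section operators.
Context {R : realType} {n : nat}.
Notation V := 'rV[R]_n.
Notation mu := (@lebesgue_rV R n).

Definition heat_kernel (t : R) (x : V) : R :=
  (4 * pi * t) `^ (- (n%:R / 2)) * expR (- (enorm x ^+ 2 / (4 * t))).

Definition cexp (z : R[i]) : R[i] :=
  Complex (expR (complex.Re z) * cos (complex.Im z))
    (expR (complex.Re z) * sin (complex.Im z)).

Definition cintegral (F : V -> R[i]) : R[i] :=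
  Complex (\int[mu]_x complex.Re (F x))
    (\int[mu]_x complex.Im (F x)).

Definition oseen_integral (i j : 'I_n) (t : R) (x : V) : R[i] :=
  real_complex R ((2 * pi) ^- n) *
  cintegral (fun xi =>
    cexp (Complex (- (t * enorm xi ^+ 2)) (dotp x xi)) *
    real_complex R ((i == j)%:R - xi ord0 i * xi ord0 j / enorm xi ^+ 2)).

(* The imaginary part of the integrand is odd in xi, so [oseen_integral] is
   real; [Re] only changes its type. *)
Definition oseen_kernel (i j : 'I_n) (t : R) (x : V) : R :=
  complex.Re (oseen_integral i j t x).

Definition grad_oseen (k i j : 'I_n) (t : R) (x : V) : R :=
  'D_(delta_mx ord0 k) (oseen_kernel i j t) x.

(* Where they do not converge, the integrals below have arbitrary values. *)
Definition heat_op (f : V -> V) (t : R) (x : V) : V :=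
  \row_i \int[mu]_y (heat_kernel t (x - y) * f y ord0 i).

Definition bilinear_op (u v : R -> V -> V) (t : R) (x : V) : V :=
  \row_i \int[@lebesgue_measure R]_(s in `]0, t[) \int[mu]_y
    (\sum_(j < n) \sum_(k < n)
      grad_oseen k i j (t - s) (x - y) * u s y ord0 j * v s y ord0 k).

End operators.

(* Main.v *)
Require Import Defs.
From mathcomp Require Import all_boot all_order all_algebra.
From mathcomp Require Import all_classical all_reals all_analysis.
From mathcomp Require Import measurable_realfun complex ring lra.

(** Write [rho = 1/r], [theta = 1/alpha], so that [2 * theta + n * rho <= 1],
    and let [w = u - v]. Subtracting the two equations removes [S[f]] and leaves
    [w = B[v,v] - B[u,u]], hence
      [|w(t,x)| <= C \int_0^t \int K(t-s,x-y) |w| (|u| + |v|)(s,y) dy ds]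
    for a majorant [K] of the gradient of the Oseen kernel. The right-hand side
    is a contraction in [w] on short time intervals, so [w = 0] there, and
    finitely many such intervals cover any [(0,T')] with [T' < T].

    Kernel. In Fourier variables the gradient of the Oseen kernel has the symbol
    [xi_k (delta_ij |xi|^2 - xi_i xi_j) e^(-t |xi|^2) / |xi|^2]. The singular
    factor [e^(-t |xi|^2) / |xi|^2] is the integral of [2 s e^(-s^2 |xi|^2)] over
    the scales [s > sqrt t], which leaves cubic monomials times Gaussians. Their
    Fourier integrals split into one-dimensional ones, and two integrations by
    parts bound each of these by a multiple of [1 / (1 + (x_l/s)^2)]. Therefore
    ([grad_oseen_bound])
      [K(t,x) = \int_(s > sqrt t) s^(-n-2) \prod_l 1 / (1 + (x_l/s)^2) ds]
    is a majorant, up to a constant.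

    Function spaces. The size of a nonnegative function is expressed by
    [mean_le kappa F A], meaning [\int_E F <= A |E|^kappa] for all [E] of finite
    measure, and by [weak_le rho k H], the weak L^(1/rho) bound. The product of
    [mean_le kappa] and [weak_le rho] is [mean_le (kappa - rho)]
    ([mean_le_mul]). Convolution with [K(t,.)] maps [mean_le (1 - 2 rho)] to
    [mean_le (1 - rho)] at the cost of a factor [t^(-(1 + n rho)/2)]
    ([oseen_conv_mean]), which on a bounded time interval is dominated by
    [t^(theta - 1)]; convolution with the latter in time maps
    [mean_le (1 - 2 theta)] to [mean_le (1 - theta)] ([time_conv_mean]). So if
    the spatial size of [w] is [g(s)] with [mean_le (1 - theta) g G], and [h(s)]
    bounds the spatial norms of [u] and [v], then one application of the
    inequality replaces [G] by [C H G], where [H] is the weak L^alpha size of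
    [h] on the interval in question.

    Smallness. Since [beta] is finite, the distribution function of the time
    profile [t |-> ||u(t)||] is [o(y^(-alpha))] at infinity ([lorentz_tail]),
    which makes [H] small on all sufficiently short intervals
    ([vanishing_tail_weak]). There [C H <= 1/2]; starting from the a priori
    bound of [w] by [|u| + |v|] and iterating, [w] has size [G / 2^k] for all
    [k] and vanishes ([bounded_halve], [bounded_vanish]).

    Three points lie outside this scheme. It requires [rho < 1/2], which follows
    from [r > n] when [n >= 2]; for [n = 1] the Leray symbol is zero and [B = 0].
    The data are merely Lebesgue measurable and their time profiles may be
    worse, so they are first replaced by Borel versions and Borel majorants
    ([path_space_Borel]). Finally, for the true supremum norm, equality of [u]
    and [v] almost everywhere makes [B[u,u]] and [B[v,v]] agree at every point,
    and the equations then give equality everywhere. *)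

Set Implicit Arguments.
Unset Strict Implicit.
Unset Printing Implicit Defensive.

Import Order.TTheory GRing.Theory Num.Theory.
Import numFieldNormedType.Exports.

Local Open Scope classical_set_scope.
Local Open Scope ring_scope.

(** * Integrals of powers *)

Section power_integrals.
Context {R : realType}.
Notation lam := (@lebesgue_measure R).

Lemma le_of_eq d (T : porderType d) (x y : T) : x = y -> (x <= y)%O.
Proof. by move->. Qed.

Lemma measurable_indic_itv (i : interval R) : measurable_fun setT (\1_([set` i]) : R -> R).
Proof. by apply: measurable_indic; exact: measurable_itv. Qed.

(** Monotone convergence, in the form that carries bounds from compact
    intervals, where the fundamental theorem of calculus applies, to half-lines. *)
Lemma le_integral_bigcup d (X : measurableType d) (m : {measure set X -> \bar R})
    (F : (set X)^nat) (f : X -> \bar R) (B : \bar R) :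
  {homo F : i j / (i <= j)%N >-> (i <= j)%O} ->
  (forall i, measurable (F i)) -> measurable_fun setT f ->
  (forall x, 0 <= f x)%E ->
  (forall i, \int[m]_(x in F i) f x <= B)%E ->
  (\int[m]_(x in \bigcup_i F i) f x <= B)%E.
Proof.
move=> ndF mF mf f0 FB.
have /cvg_lim <- // := @ge0_nondecreasing_set_cvg_integral _ _ _ F f m ndF mF
  (fun i => measurable_funTS mf) (fun i x _ => f0 x).
apply: lime_le; last by apply: nearW => i; exact: FB.
apply/ereal_nondecreasing_is_cvgn => i j ij.
by apply: ge0_subset_integral => //; [exact: measurable_funTS|apply/subsetPset/ndF].
Qed.

Lemma integral_powR_itv (a b q : R) : 0 < a -> a < b -> q != 1 ->
  (\int[lam]_(y in `[a, b]) (y `^ (- q))%:E =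
   ((b `^ (1 - q) - a `^ (1 - q)) / (1 - q))%:E)%E.
Proof.
move=> a0 ab q1.
have q1' : 1 - q != 0 by rewrite subr_eq0 eq_sym.
have dF (x : R) : 0 < x -> is_derive x 1 (fun y => y `^ (1 - q) / (1 - q)) (x `^ (- q)).
  move=> x0.
  have H := is_derive1_powR (1 - q) x0.
  have -> : x `^ (- q) = (1 - q)^-1 *: ((1 - q) * x `^ (1 - q - 1)).
    by rewrite /GRing.scale/= mulKf//; congr (_ `^ _); ring.
  rewrite (_ : (fun y => _) = (1 - q)^-1 \*: (@powR R ^~ (1 - q))); last first.
    by apply/funext => y /=; rewrite mulrC.
  exact: is_deriveZ.
have cF (x : R) : 0 < x -> {for x, continuous (fun y => y `^ (1 - q) / (1 - q))}.
  move=> x0; apply: differentiable_continuous; apply/derivable1_diffP.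
  by have [] := dF _ x0.
rewrite (@continuous_FTC2 _ _ (fun y => y `^ (1 - q) / (1 - q))) //.
- by rewrite -EFinB -mulrBl.
- apply: continuous_in_subspaceT => x; rewrite inE/= in_itv/= => /andP[ax _].
  apply: differentiable_continuous; apply/derivable1_diffP.
  apply: derivable_powR; rewrite in_itv/= andbT; exact: lt_le_trans ax.
- split.
  + move=> x; rewrite in_itv/= => /andP[ax _].
    by have [] := dF _ (lt_trans a0 ax).
  + by apply: cvg_at_right_filter; exact: cF.
  + by apply: cvg_at_left_filter; apply: cF; exact: lt_trans ab.
- move=> x; rewrite in_itv/= => /andP[ax _]; rewrite derive1E.
  by have [] := dF _ (lt_trans a0 ax).
Qed.

Lemma measurable_powRE (q : R) : measurable_fun setT (fun y : R => (y `^ q)%:E).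
Proof. by apply/measurable_EFinP; exact: measurable_powR. Qed.

Lemma le_integral_powR_tail (a q : R) : 0 < a -> 1 < q ->
  (\int[lam]_(y in `]a, +oo[) (y `^ (- q))%:E <= (a `^ (1 - q) / (q - 1))%:E)%E.
Proof.
move=> a0 q1.
rewrite (_ : `]a, +oo[%classic = \bigcup_i `]a, a + i%:R]%classic); last first.
  apply/seteqP; split => [x|x [i _]] /=; rewrite !in_itv/= ?andbT => ax.
    exists (Num.truncn (x - a)).+1 => //=; rewrite in_itv/= ax/=.
    by rewrite -lerBlDl ltW// truncnS_gt.
  by case/andP : ax.
apply: le_integral_bigcup => //.
- move=> i j ij; apply/subsetPset => x /=; rewrite !in_itv/= => /andP[-> /=].
  by move=> /le_trans; apply; rewrite lerD2l ler_nat.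
- exact: measurable_powRE.
- by move=> x; rewrite lee_fin powR_ge0.
move=> [|i].
  by rewrite addr0 set_itvoc0 integral_set0 lee_fin divr_ge0 ?powR_ge0// subr_ge0 ltW.
have ab : a < a + i.+1%:R by rewrite ltrDl.
have le1 : (\int[lam]_(y in `]a, (a + i.+1%:R)%R]) (y `^ (- q))%:E <=
    \int[lam]_(y in `[a, (a + i.+1%:R)%R]) (y `^ (- q))%:E)%E.
  apply: ge0_subset_integral => //.
  - by apply: measurable_funTS; exact: measurable_powRE.
  - by move=> x _; rewrite lee_fin powR_ge0.
  - by move=> x /=; rewrite !in_itv/= => /andP[/ltW -> ->].
apply: (le_trans le1).
rewrite integral_powR_itv // ?gt_eqF// lee_fin.
rewrite -[leLHS]mulrNN -invrN !opprB ler_pM2r ?invr_gt0 ?subr_gt0//.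
by rewrite lerBlDr lerDl powR_ge0.
Qed.

Lemma le_integral_powR_zero (b q : R) : 0 < b -> q < 1 ->
  (\int[lam]_(y in `]0%R, b]) (y `^ (- q))%:E <= (b `^ (1 - q) / (1 - q))%:E)%E.
Proof.
move=> b0 q1.
rewrite (_ : `]0, b]%classic = \bigcup_i `[b * i.+2%:R^-1, b]%classic); last first.
  apply/seteqP; split => [x|x [i _]] /=; rewrite !in_itv/=; last first.
    by move=> /andP[h ->]; rewrite andbT; apply: lt_le_trans h; rewrite divr_gt0.
  move=> /andP[x0 xb].
  exists (Num.truncn (b / x)).+1 => //=; rewrite in_itv/= xb andbT.
  rewrite ler_pdivrMr// mulrC -ler_pdivrMr// ltW//.
  by rewrite (lt_trans (truncnS_gt _))// ltr_nat.
apply: le_integral_bigcup => //.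
- move=> i j ij; apply/subsetPset => x /=; rewrite !in_itv/= => /andP[+ ->].
  rewrite andbT; apply: le_trans; rewrite ler_pM2l// lef_pV2 ?posrE// ler_nat.
  by rewrite !ltnS.
- exact: measurable_powRE.
- by move=> x; rewrite lee_fin powR_ge0.
move=> i.
have ab : b * i.+2%:R^-1 < b by rewrite gtr_pMr// invf_lt1// ltr1n.
rewrite integral_powR_itv ?divr_gt0// ?lt_eqF// lee_fin.
rewrite ler_pM2r ?invr_gt0 ?subr_gt0//.
by rewrite lerBlDr lerDl powR_ge0.
Qed.

End power_integrals.

(** * Weak-type bounds and products *)

Section layer_cake.
Context {R : realType} d (X : measurableType d).
Context (m : {sigma_finite_measure set X -> \bar R}).
Notation lam := (@lebesgue_measure R).
Local Open Scope ereal_scope.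
Implicit Types (E : set X) (F : X -> \bar R) (k : X -> R).

Lemma integral_mul_indic d' (Y : measurableType d') (nu : {measure set Y -> \bar R})
    (E : set Y) (f : Y -> \bar R) :
  \int[nu]_(x in E) f x = \int[nu]_x (f x * (\1_E x)%:E).
Proof.
rewrite integral_mkcond; apply: eq_integral => x _.
by rewrite patchE indicE; case: ifP => _; rewrite ?mule1 ?mule0.
Qed.

Lemma measurable_superlevel d' (Y : measurableType d') (k : Y -> R) (y : R) :
  measurable_fun setT k -> measurable [set x | (y < k x)%R].
Proof.
move=> mk; rewrite (_ : [set x | _] = k @^-1` `]y, +oo[).
  by rewrite -[X in measurable X]setTI; exact: mk.
by apply/seteqP; split => x /=; rewrite in_itv/= andbT.
Qed.

Lemma ge0_integral_exchange d' (Y : measurableType d')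
    (nu : {sigma_finite_measure set Y -> \bar R}) (f : X * Y -> \bar R) (A : set X) (B : set Y) :
  measurable A -> measurable B -> measurable_fun setT f -> (forall z, 0 <= f z) ->
  \int[m]_(x in A) \int[nu]_(y in B) f (x, y) = \int[nu]_(y in B) \int[m]_(x in A) f (x, y).
Proof.
move=> mA mB mf f0.
have mIA : measurable_fun setT (fun x => (\1_A x : R)%:E) by exact/measurable_EFinP/measurable_indic.
have mIB : measurable_fun setT (fun y => (\1_B y : R)%:E) by exact/measurable_EFinP/measurable_indic.
pose g (z : X * Y) := f z * (\1_A z.1)%:E * (\1_B z.2)%:E.
have mg : measurable_fun setT g.
  apply: emeasurable_funM; last exact: (measurableT_comp mIB measurable_snd).
  by apply: emeasurable_funM => //; exact: (measurableT_comp mIA measurable_fst).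
have g0 z : 0 <= g z by rewrite !mule_ge0// lee_fin.
transitivity (\int[m]_x \int[nu]_y g (x, y)).
  rewrite integral_mul_indic; apply: eq_integral => x _.
  rewrite integral_mul_indic -ge0_integralZr//.
  - by apply: eq_integral => y _; rewrite muleAC.
  - by apply: emeasurable_funM => //; exact: (measurableT_comp mf (measurable_pair1 x)).
  - by move=> y _; rewrite mule_ge0// lee_fin.
rewrite (@fubini_tonelli _ _ _ _ _ m nu g mg g0) [RHS]integral_mul_indic; apply: eq_integral => y _.
rewrite [in RHS]integral_mul_indic -ge0_integralZr//.
- by apply: emeasurable_funM => //; exact: (measurableT_comp mf (measurable_pair2 y)).
- by move=> x _; rewrite mule_ge0// lee_fin.
Qed.

Lemma measurable_subgraph k : measurable_fun setT k ->
  measurable [set p : X * R | (0 < p.2)%R /\ (p.2 < k p.1)%R].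
Proof.
move=> mk; apply: measurableI.
  exact: (@measurable_superlevel _ _ (@snd X R) 0%R measurable_snd).
rewrite (_ : (fun _ => _) = [set p : X * R | (0 < k p.1 - p.2)%R]).
  apply: measurable_superlevel; apply: measurable_funB => //.
  exact: measurableT_comp.
by apply/seteqP; split => p /=; rewrite subr_gt0.
Qed.

(** In all product estimates the mean bound of [F] is integrated over the
    superlevel sets of the other factor. *)
Lemma layer_cake F k :
  measurable_fun setT F -> (forall x, 0 <= F x) ->
  measurable_fun setT k -> (forall x, 0 <= k x)%R ->
  \int[m]_x (F x * (k x)%:E) =
  \int[lam]_(y in `]0%R, +oo[) \int[m]_(x in [set x | (y < k x)%R]) F x.
Proof.
move=> mF F0 mk k0.
pose A := [set p : X * R | (0 < p.2)%R /\ (p.2 < k p.1)%R].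
have mA : measurable A by exact: measurable_subgraph.
pose G (p : X * R) := F p.1 * (\1_A p)%:E.
have mG : measurable_fun setT G.
  apply: emeasurable_funM; first exact: measurableT_comp.
  by apply/measurable_EFinP; exact: measurable_indic.
have G0 p : 0 <= G p by rewrite mule_ge0// lee_fin.
transitivity (\int[m]_x \int[lam]_y G (x, y)).
  apply: eq_integral => x _; rewrite /G /=.
  rewrite ge0_integralZl//; last 1 first.
  - apply/measurable_EFinP.
    rewrite -[X in measurable_fun _ X]/(\1_A \o pair x).
    by apply: measurableT_comp; [exact: measurable_indic|exact: measurable_pair1].
  congr (_ * _).
  transitivity (\int[lam]_y (\1_(`]0%R, (k x)[%classic) y)%:E).
    rewrite integral_indic// setIT /= lebesgue_measure_itv/= lte_fin.
    by have := k0 x; rewrite le_eqVlt => /orP[/eqP <-|->]; rewrite ?ltxx// sube0.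
  apply: eq_integral => y _; congr EFin; rewrite !indicE; congr (_%:R).
  by congr nat_of_bool; apply/idP/idP; rewrite !inE /A/= in_itv/= => /andP.
transitivity (\int[lam]_y \int[m]_x G (x, y)).
  exact: (@fubini_tonelli _ _ _ _ _ m lam).
rewrite [RHS]integral_mul_indic.
apply: eq_integral => y _; rewrite [in RHS]integral_mul_indic.
rewrite -ge0_integralZr//; last 2 first.
- apply: emeasurable_funM => //; apply/measurable_EFinP.
  by apply: measurable_indic; exact: measurable_superlevel.
- by move=> x _; rewrite mule_ge0// lee_fin.
apply: eq_integral => x _; rewrite /G -muleA; congr (_ * _).
rewrite -EFinM; congr EFin; rewrite !indicE -natrM mulnb; congr (_%:R).
congr nat_of_bool; apply/idP/idP.
  by rewrite inE => -[h1 h2]; apply/andP; split; rewrite inE//= in_itv/= andbT.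
by move=> /andP[]; rewrite !inE/= in_itv/= andbT => ? ?; split.
Qed.

Lemma measurable_layer F k :
  measurable_fun setT F -> (forall x, 0 <= F x) -> measurable_fun setT k ->
  measurable_fun setT (fun y : R => \int[m]_(x in [set x | (y < k x)%R]) F x).
Proof.
move=> mF F0 mk.
pose A := [set p : X * R | (p.2 < k p.1)%R].
have mA : measurable A.
  rewrite (_ : A = [set p : X * R | (0 < k p.1 - p.2)%R]).
    apply: measurable_superlevel; apply: measurable_funB => //.
    exact: measurableT_comp.
  by apply/seteqP; split => p /=; rewrite subr_gt0.
pose G (p : X * R) := F p.1 * (\1_A p)%:E.
have mG : measurable_fun setT G.
  apply: emeasurable_funM; first exact: measurableT_comp.
  by apply/measurable_EFinP; exact: measurable_indic.
have G0 p : 0 <= G p by rewrite mule_ge0// lee_fin.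
have := @measurable_fun_fubini_tonelli_G _ _ _ _ _ m G mG G0.
congr (measurable_fun _ _); apply/funext => y.
by rewrite integral_mul_indic /fubini_G; apply: eq_integral.
Qed.

Lemma le_integral_split (f : R -> \bar R) (a : R) (B1 B2 : \bar R) :
  measurable_fun setT f -> (forall y, 0 <= f y) -> (0 < a)%R ->
  \int[lam]_(y in `]0%R, a]) f y <= B1 ->
  \int[lam]_(y in `]a, +oo[) f y <= B2 ->
  \int[lam]_(y in `]0%R, +oo[) f y <= B1 + B2.
Proof.
move=> mf f0 a0 h1 h2.
rewrite (_ : `]0%R, +oo[%classic = `]0%R, a]%classic `|` `]a, +oo[%classic); last first.
  apply/seteqP; split => y /=; rewrite !in_itv/= !andbT.
    by move=> y0; case: (lerP y a) => ya; [left; rewrite y0|right].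
  by move=> [/andP[]//|]; apply: lt_trans.
rewrite ge0_integral_setU//.
- exact: leeD.
- exact: measurable_funTS.
- rewrite disj_set2E; apply/eqP/seteqP; split => // y [] /=.
  by rewrite !in_itv/= andbT => /andP[_ /le_lt_trans h] /h; rewrite ltxx.
Qed.

(** For [kappa = 1 - 1/p] with [1 < p < oo] the least [A] is a norm equivalent to
    the one of L^(p,oo), and [kappa = 1] means that [F <= A] almost everywhere.
    In this form sums, averages and convolutions are estimated by exchanging
    integrals, without computing any rearrangement. *)
Definition mean_le (kappa : R) F (A : \bar R) : Prop :=
  forall E, measurable E -> m E < +oo ->
  \int[m]_(x in E) F x <= A * ((fine (m E)) `^ kappa)%:E.

(** A bound [H] for the L^(p,oo) norm with [rho = 1/p], read off from the
    distribution function; for [rho = 0] it bounds the essential supremum. *)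
Definition weak_le (rho : R) k (H : R) : Prop :=
  forall y t : R, (0 < y)%R -> (0 < t)%R ->
  t%:E < m [set x | (y < k x)%R] -> (y * t `^ rho <= H)%R.

Lemma weak_le_mono rho k H H' : (H <= H')%R -> weak_le rho k H -> weak_le rho k H'.
Proof. by move=> HH hk y t y0 t0 ty; apply: le_trans HH; exact: hk. Qed.

(** The factor 2 makes the bound strictly larger than every admissible [t], so
    that a measure exceeding it, possibly infinite, is contradictory. *)
Lemma weak_le_superlevel rho k H (y : R) : measurable_fun setT k ->
  weak_le rho k H -> (0 < rho)%R -> (0 < H)%R -> (0 < y)%R ->
  m [set x | (y < k x)%R] <= (2 * (H / y) `^ rho^-1)%:E.
Proof.
move=> mk wk rho0 H0 y0.
have aux t : (0 < t)%R -> t%:E < m [set x | (y < k x)%R] -> (t <= (H / y) `^ rho^-1)%R.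
  move=> t0 /(wk y _ y0 t0); rewrite mulrC -ler_pdivlMr// => h.
  have := ge0_ler_powR (ltW (_ : 0 < rho^-1)%R) _ _ h.
  rewrite -powRrM mulfV ?gt_eqF// powRr1 ?(ltW t0)//; apply; rewrite ?invr_gt0//.
    by rewrite nnegrE powR_ge0.
  by rewrite nnegrE divr_ge0// ltW.
have B0 : (0 < (H / y) `^ rho^-1)%R by rewrite powR_gt0// divr_gt0.
rewrite leNgt; apply/negP => h.
have /aux : (0 < 2 * (H / y) `^ rho^-1)%R by rewrite mulr_gt0.
move=> /(_ h); rewrite leNgt => /negP; apply.
by rewrite ltr_pMl// ltr1n.
Qed.

Lemma weak0_superlevel k H (y : R) : measurable_fun setT k ->
  weak_le 0 k H -> (H < y)%R -> (0 < y)%R -> m [set x | (y < k x)%R] = 0.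
Proof.
move=> mk wk Hy y0; apply/eqP; rewrite eq_le measure_ge0 andbT leNgt; apply/negP => h.
have [t t0 tm] : exists2 t : R, (0 < t)%R & t%:E < m [set x | (y < k x)%R].
  case E : (m [set x | (y < k x)%R]) h => [r| |]//.
    by rewrite lte_fin => r0; exists (r / 2)%R; rewrite ?divr_gt0// lte_fin ltr_pdivrMr// ltr_pMr// ltr1n.
  by exists 1%R => //; rewrite ltry.
by have := wk y t y0 t0 tm; rewrite powRr0 mulr1 leNgt Hy.
Qed.

Lemma fine_measure_le E E' : measurable E -> measurable E' -> E' `<=` E -> m E < +oo ->
  (0 <= fine (m E') <= fine (m E))%R.
Proof.
move=> mE mE' sE fE; rewrite fine_ge0//=.
have le1 : m E' <= m E by rewrite le_measure ?inE.
by rewrite fine_le// ge0_fin_numE// (le_lt_trans le1).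
Qed.

(** O'Neil's product inequality. The integral of [F] over the layer {k > y} of [E]
    is at most [A |E|^kappa] and, as the layer has measure of order
    [(H/y)^(1/rho)], at most a multiple of [A (H/y)^q] with [q = kappa / rho > 1].
    The first bound is integrable over low levels and the second over high ones.
    For [rho = 0] the high layers are null, and any [q > 1] serves. *)
Lemma mean_le_mul_fin (rho kappa q : R) F k (A H : R) :
  (0 <= rho)%R -> (rho < kappa)%R -> (1 < q)%R -> (rho != 0 -> q = kappa / rho)%R ->
  measurable_fun setT F -> (forall x, 0 <= F x) ->
  measurable_fun setT k -> (forall x, 0 <= k x)%R -> (0 <= A)%R -> (0 < H)%R ->
  mean_le kappa F A%:E -> weak_le rho k H ->
  mean_le (kappa - rho) (fun x => F x * (k x)%:E) ((1 + 2 `^ kappa / (q - 1)) * H * A)%:E.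
Proof.
move=> rho0 rk q1 qE mF F0 mk k0 A0 H0 hF hk E mE fE.
have kappa0 : (0 < kappa)%R by exact: le_lt_trans rk.
set e := fine (m E).
have e0 : (0 <= e)%R by rewrite fine_ge0.
have mFE : measurable_fun setT (fun x => F x * (\1_E x)%:E).
  by apply: emeasurable_funM => //; apply/measurable_EFinP; exact: measurable_indic.
have FE0 x : 0 <= F x * (\1_E x)%:E by rewrite mule_ge0// lee_fin.
have C0 : (0 <= (1 + 2 `^ kappa / (q - 1)) * H * A)%R.
  rewrite !mulr_ge0 ?(ltW H0)// addr_ge0// divr_ge0 ?powR_ge0// subr_ge0.
  exact: ltW.
have [e00|en0] := eqVneq e 0%R.
  rewrite (_ : \int[m]_(x in E) _ = 0).
    by rewrite -EFinM lee_fin mulr_ge0// powR_ge0.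
  apply: null_set_integral => //.
    apply/measurable_funTS/emeasurable_funM => //.
    exact/measurable_EFinP.
  by rewrite -[LHS]fineK ?ge0_fin_numE//; exact: congr1 e00.
have e_gt0 : (0 < e)%R by rewrite lt0r en0.
have y0 : (0 < H * e `^ (- rho))%R by rewrite mulr_gt0// powR_gt0.
(* the level at which both bounds are of the same order *)
set y1 := (H * e `^ (- rho))%R in y0.
have layerE y : \int[m]_(x in [set x | (y < k x)%R]) (F x * (\1_E x)%:E) =
    \int[m]_(x in E `&` [set x | (y < k x)%R]) F x.
  rewrite [RHS]integral_mul_indic [LHS]integral_mul_indic.
  apply: eq_integral => x _; rewrite -muleA -EFinM; congr (_ * _%:E).
  by rewrite indicI.
have mEy y : measurable (E `&` [set x | (y < k x)%R]).
  by apply: measurableI => //; exact: measurable_superlevel.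
have Ey y : (0 <= fine (m (E `&` [set x | (y < k x)%R])) <= e)%R.
  exact: fine_measure_le.
have Ey_fin y : m (E `&` [set x | (y < k x)%R]) < +oo.
  by apply: le_lt_trans fE; rewrite le_measure ?inE.
have B1 y : \int[m]_(x in [set x | (y < k x)%R]) (F x * (\1_E x)%:E) <=
    (A * e `^ kappa)%:E.
  rewrite layerE; apply: (le_trans (hF _ (mEy y) (Ey_fin y))).
  rewrite -EFinM lee_fin ler_wpM2l//.
  by have /andP[? ?] := Ey y; rewrite ge0_ler_powR ?nnegrE// ltW.
have B2 y : (y1 < y)%R -> \int[m]_(x in [set x | (y < k x)%R]) (F x * (\1_E x)%:E) <=
    (A * (e `^ kappa * 2 `^ kappa * y1 `^ q))%:E * (y `^ (- q))%:E.
  move=> yy; have yp := lt_trans y0 yy.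
  rewrite layerE; apply: (le_trans (hF _ (mEy y) (Ey_fin y))).
  rewrite -!EFinM lee_fin -[leRHS]mulrA ler_wpM2l//.
  have [r0|rn0] := eqVneq rho 0%R.
    rewrite (_ : fine _ = 0%R); last first.
      apply/eqP; rewrite eq_le fine_ge0// andbT.
      rewrite (_ : 0%R = fine 0)// fine_le// ?ge0_fin_numE//.
      rewrite -(@weak0_superlevel k H y mk _ _ yp).
      - by rewrite le_measure ?inE//; exact: measurable_superlevel.
      - by rewrite -r0.
      - by move: yy; rewrite /y1 r0 oppr0 powRr0 mulr1.
    by rewrite powR0 ?gt_eqF// !mulr_ge0// powR_ge0.
  have rp : (0 < rho)%R by rewrite lt0r rn0.
  have le1 : (fine (m (E `&` [set x | (y < k x)%R])) <= 2 * (H / y) `^ rho^-1)%R.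
    rewrite -lee_fin fineK ?ge0_fin_numE//.
    apply: le_trans (weak_le_superlevel mk hk rp H0 yp).
    by rewrite le_measure ?inE//; exact: measurable_superlevel.
  have Hy0 : (0 <= H / y)%R by rewrite divr_ge0 ?ltW.
  apply: (@le_trans _ _ ((2 * (H / y) `^ rho^-1) `^ kappa)%R).
    by rewrite ge0_ler_powR ?(ltW kappa0) ?nnegrE ?fine_ge0 ?mulr_ge0 ?powR_ge0.
  rewrite powRM ?powR_ge0// -powRrM (mulrC rho^-1%R) -qE//.
  have y1q : (y1 `^ q = H `^ q * e `^ (- kappa))%R.
    rewrite /y1 powRM ?powR_ge0 ?(ltW H0)// -powRrM.
    by congr (_ * _ `^ _)%R; rewrite qE// mulNr mulrCA mulfV// mulr1.
  have Hyq : ((H / y) `^ q = H `^ q * y `^ (- q))%R.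
    by rewrite powRM ?invr_ge0 ?(ltW yp) ?(ltW H0)// -powR_inv1 ?(ltW yp)// -powRrM mulN1r.
  rewrite y1q Hyq !powRN; apply: le_of_eq; field.
  by rewrite !gt_eqF ?powR_gt0.
rewrite (_ : \int[m]_(x in E) _ =
    \int[m]_x ((F x * (\1_E x)%:E) * (k x)%:E)); last first.
  rewrite integral_mul_indic; apply: eq_integral => x _.
  by rewrite -!muleA; congr (_ * _); rewrite muleC.
rewrite layer_cake//.
have -> : ((1 + 2 `^ kappa / (q - 1)) * H * A)%:E * (e `^ (kappa - rho))%:E =
    (A * e `^ kappa * y1)%:E +
    (A * (e `^ kappa * 2 `^ kappa * y1 `^ q))%:E * (y1 `^ (1 - q) / (q - 1))%:E.
  rewrite -!EFinM -EFinD; congr EFin.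
  have h1 : (y1 `^ q * y1 `^ (1 - q) = y1)%R.
    rewrite -powRD; last by rewrite (gt_eqF y0) implybT.
    by rewrite (_ : q + (1 - q) = 1)%R ?powRr1 ?(ltW y0)//; ring.
  have h2 : (e `^ (kappa - rho) = e `^ kappa * e `^ (- rho))%R.
    by rewrite -powRD// (gt_eqF e_gt0) implybT.
  transitivity (A * e `^ kappa * y1 +
    A * e `^ kappa * 2 `^ kappa * (y1 `^ q * y1 `^ (1 - q)) / (q - 1))%R; last by ring.
  by rewrite h1 h2 /y1; ring.
apply: (@le_integral_split _ y1) => //.
- exact: measurable_layer.
- by move=> y; apply: integral_ge0.
- apply: (@le_trans _ _ (\int[lam]_(y in `]0%R, y1]) (cst (A * e `^ kappa)%:E) y)).
    apply: ge0_le_integral => //.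
    + by move=> y _; apply: integral_ge0.
    + by apply: measurable_funTS; exact: measurable_layer.
  rewrite integral_cst//= lebesgue_measure_itv/= lte_fin y0.
  by rewrite sube0 -EFinM.
- apply: (@le_trans _ _ (\int[lam]_(y in `]y1, +oo[)
      ((A * (e `^ kappa * 2 `^ kappa * y1 `^ q))%:E * (y `^ (- q))%:E))).
    apply: ge0_le_integral => //.
    + by move=> y _; apply: integral_ge0.
    + by apply: measurable_funTS; exact: measurable_layer.
    + apply: measurable_funTS; apply: emeasurable_funM => //.
      exact: measurable_powRE.
    + by move=> y /=; rewrite in_itv/= andbT; exact: B2.
  have K0 : (0 <= A * (e `^ kappa * 2 `^ kappa * y1 `^ q))%R.
    by rewrite !mulr_ge0// powR_ge0.
  rewrite ge0_integralZl_EFin//.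
  + by rewrite lee_wpmul2l//; exact: le_integral_powR_tail.
  + by move=> y _; rewrite lee_fin powR_ge0.
  + by apply: measurable_funTS; exact: measurable_powRE.
Qed.

(** The constant precedes the functions because it has to be uniform in time. *)
Lemma mean_le_mul (rho kappa : R) : (0 <= rho)%R -> (rho < kappa)%R ->
  exists2 C : R, (0 < C)%R & forall F k (A : \bar R) (H : R),
  measurable_fun setT F -> (forall x, 0 <= F x) ->
  measurable_fun setT k -> (forall x, 0 <= k x)%R -> 0 <= A -> (0 < H)%R ->
  mean_le kappa F A -> weak_le rho k H ->
  mean_le (kappa - rho) (fun x => F x * (k x)%:E) ((C * H)%:E * A).
Proof.
move=> rho0 rk.
pose q := (if rho == 0 then 2 else kappa / rho)%R.
have q1 : (1 < q)%R.
  rewrite /q; case: eqVneq => [_|r0]; first by rewrite ltr1n.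
  by rewrite ltr_pdivlMr ?mul1r// lt0r r0.
have C0 : (0 < 1 + 2 `^ kappa / (q - 1))%R.
  by rewrite ltr_pwDl// divr_ge0 ?powR_ge0// subr_ge0 ltW.
exists (1 + 2 `^ kappa / (q - 1))%R => // F k [A| |//] H mF F0 mk k0 A0 H0 hF hk.
  rewrite -EFinM; apply: mean_le_mul_fin => //.
  by rewrite /q => /negbTE ->.
move=> E mE fE; rewrite gt0_muley ?lte_fin ?mulr_gt0//.
have [e00|en0] := eqVneq (m E) 0.
  rewrite (_ : \int[m]_(x in E) _ = 0) ?mule_ge0 ?lee_fin ?powR_ge0//.
  apply: null_set_integral => //.
  by apply/measurable_funTS/emeasurable_funM => //; exact/measurable_EFinP.
rewrite gt0_mulye ?leey// lte_fin powR_gt0// fine_gt0// fE andbT.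
by rewrite lt0e en0 measure_ge0.
Qed.

(** The bound [M] ends the integral over the levels, and [b * kappa < 1] makes it
    converge at level 0. *)
Lemma mean_le_mul_bounded (kappa b c M : R) F k (A : \bar R) :
  (0 <= kappa)%R -> (b * kappa < 1)%R -> (0 < c)%R -> (0 < M)%R ->
  measurable_fun setT F -> (forall x, 0 <= F x) ->
  measurable_fun setT k -> (forall x, 0 <= k x <= M)%R -> 0 <= A ->
  (forall y, (0 < y)%R -> m [set x | (y < k x)%R] <= (c * y `^ (- b))%:E) ->
  mean_le kappa F A ->
  \int[m]_x (F x * (k x)%:E) <=
    (c `^ kappa * M `^ (1 - b * kappa) / (1 - b * kappa))%:E * A.
Proof.
move=> kappa0 bk c0 M0 mF F0 mk k0M A0 hk hF.
have k0 x : (0 <= k x)%R by case/andP : (k0M x).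
have kM x : (k x <= M)%R by case/andP : (k0M x).
have K0 : (0 < c `^ kappa * M `^ (1 - b * kappa) / (1 - b * kappa))%R.
  by rewrite divr_gt0 ?mulr_gt0 ?powR_gt0// subr_gt0.
case: A A0 hF => [A| |//] A0 hF; last by rewrite gt0_muley ?leey ?lte_fin.
rewrite lee_fin in A0.
rewrite layer_cake//.
rewrite -[leRHS]adde0; apply: (@le_integral_split _ M) => //.
- exact: measurable_layer.
- by move=> y; apply: integral_ge0.
- apply: (@le_trans _ _ (\int[lam]_(y in `]0%R, M])
      ((A * c `^ kappa)%:E * (y `^ (- (b * kappa)))%:E))).
    apply: ge0_le_integral => //.
    + by move=> y _; apply: integral_ge0.
    + by apply: measurable_funTS; exact: measurable_layer.
    + apply: measurable_funTS; apply: emeasurable_funM => //.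
      exact: measurable_powRE.
    + move=> y /=; rewrite in_itv/= => /andP[y0 _].
      have my := measurable_superlevel y mk.
      have fy := le_lt_trans (hk y y0) (ltry _).
      apply: (le_trans (hF _ my fy)); rewrite -!EFinM lee_fin -[leRHS]mulrA ler_wpM2l//.
      have -> : (c `^ kappa * y `^ (- (b * kappa)) = (c * y `^ (- b)) `^ kappa)%R.
        by rewrite powRM ?powR_ge0 ?(ltW c0)// -powRrM mulNr.
      rewrite ge0_ler_powR ?nnegrE ?fine_ge0// ?mulr_ge0 ?powR_ge0 ?(ltW c0)//.
      by rewrite -lee_fin fineK ?ge0_fin_numE// hk.
  have K1 : (0 <= A * c `^ kappa)%R by rewrite !mulr_ge0// powR_ge0.
  rewrite ge0_integralZl_EFin//.
  + have -> : (c `^ kappa * M `^ (1 - b * kappa) / (1 - b * kappa))%:E * A%:E =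
      (A * c `^ kappa)%:E * (M `^ (1 - b * kappa) / (1 - b * kappa))%:E.
      by rewrite -!EFinM; congr EFin; ring.
    by rewrite lee_wpmul2l//; exact: le_integral_powR_zero.
  + by move=> y _; rewrite lee_fin powR_ge0.
  + by apply: measurable_funTS; exact: measurable_powRE.
- rewrite integral0_eq// => y /=; rewrite in_itv/= andbT => My.
  rewrite (_ : [set _ | _] = set0) ?integral_set0//.
  by apply/seteqP; split => x //=; rewrite ltNge (le_trans (kM x) (ltW My)).
Qed.

End layer_cake.

(** * Integration on R^n by slices *)

Section lebesgue_rV_theory.
Context {R : realType}.
Notation lam := (@lebesgue_measure R).
Local Notation mu n := (@lebesgue_rV R n).
Local Open Scope ereal_scope.

Lemma rVcons0 n (z : R * 'rV[R]_n) : rVcons z ord0 ord0 = z.1.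
Proof. by rewrite mxE; case: splitP => // j _; rewrite mxE. Qed.

Lemma rVconsS n (z : R * 'rV[R]_n) l : rVcons z ord0 (lift ord0 l) = z.2 ord0 l.
Proof.
rewrite (_ : lift ord0 l = rshift 1 l); first exact: row_mxEr.
exact: val_inj.
Qed.

Lemma rVunconsK n : cancel (@rVuncons R n) (@rVcons R n).
Proof.
move=> x; apply/rowP => l; case: (unliftP ord0 l) => [j ->|->].
  by rewrite rVconsS /= mxE; congr (x _ _); exact: val_inj.
by rewrite rVcons0.
Qed.

Lemma rVconsB n (c : 'rV[R]_n.+1) (z : R * 'rV[R]_n) :
  (c - rVcons z = rVcons ((rVuncons c).1 - z.1, (rVuncons c).2 - z.2))%R.
Proof.
rewrite -{1}(rVunconsK c); apply/rowP => l; rewrite !mxE.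
by case: splitP => j _; rewrite !mxE.
Qed.

Lemma integral_rV0 (f : 'rV[R]_0 -> \bar R) : \int[mu 0]_x f x = f 0%R.
Proof.
have fE : f = cst (f 0%R).
  by apply/funext => x; congr f; apply/rowP => -[].
by rewrite fE integral_dirac// diracT mul1e.
Qed.

Lemma ge0_integral_rVS n (f : 'rV[R]_n.+1 -> \bar R) :
  measurable_fun setT f -> (forall x, 0 <= f x) ->
  \int[mu n.+1]_x f x = \int[lam]_a \int[mu n]_v f (rVcons (a, v)).
Proof.
move=> mf f0.
transitivity (\int[(lam \x mu n)]_z (f \o @rVcons R n) z); last first.
  apply: (@fubini_tonelli1 _ _ _ _ _ lam (mu n)); last by move=> z; exact: f0.
  by apply: measurableT_comp => //; exact: measurable_rVcons.
transitivity (\int[pushforward (lam \x mu n)%E (@rVcons R n)]_x f x) => //.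
rewrite ge0_integral_pushforward//; last exact: measurable_rVcons.
Qed.

Lemma measurable_rVB d (X : measurableType d) n (f g : X -> 'rV[R]_n) :
  measurable_fun setT f -> measurable_fun setT g ->
  measurable_fun setT (fun x => f x - g x)%R.
Proof.
move=> mf mg; apply: measurable_fun_rV => i.
rewrite (_ : (fun _ => _) = (fun x => f x ord0 i - g x ord0 i)%R); last first.
  by apply/funext => x; rewrite !mxE.
by apply: measurable_funB; apply: (measurableT_comp (@measurable_coord R n i)).
Qed.

Lemma measurable_rVD d (X : measurableType d) n (f g : X -> 'rV[R]_n) :
  measurable_fun setT f -> measurable_fun setT g ->
  measurable_fun setT (fun x => f x + g x)%R.
Proof.
move=> mf mg; apply: measurable_fun_rV => i.
rewrite (_ : (fun _ => _) = (fun x => f x ord0 i + g x ord0 i)%R); last first.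
  by apply/funext => x; rewrite !mxE.
by apply: measurable_funD; apply: (measurableT_comp (@measurable_coord R n i)).
Qed.

Lemma measurable_coordT d (X : measurableType d) n (f : X -> 'rV[R]_n) i :
  measurable_fun setT f -> measurable_fun setT (fun x => f x ord0 i).
Proof. by move=> mf; apply: (measurableT_comp (@measurable_coord R n i)). Qed.

Lemma measurable_dotp d (X : measurableType d) n (f g : X -> 'rV[R]_n) :
  measurable_fun setT f -> measurable_fun setT g ->
  measurable_fun setT (fun x => dotp (f x) (g x)).
Proof.
move=> mf mg; rewrite /dotp; apply: measurable_sum => i.
by apply: measurable_funM; exact: measurable_coordT.
Qed.

Lemma measurable_enorm d (X : measurableType d) n (f : X -> 'rV[R]_n) :
  measurable_fun setT f -> measurable_fun setT (fun x => enorm (f x)).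
Proof.
move=> mf; rewrite /enorm.
apply: (@measurableT_comp _ _ _ _ _ _ (@Num.sqrt R)); last exact: measurable_dotp.
by apply: continuous_measurable_fun; exact: sqrt_continuous.
Qed.

Lemma ge0_integral_reflect1 (c : R) (f : R -> \bar R) :
  measurable_fun setT f -> (forall x, 0 <= f x) ->
  \int[lam]_y f (c - y)%R = \int[lam]_y f y.
Proof.
move=> mf f0.
have mphi : measurable_fun setT ((fun y => c - y)%R : _ -> measurableTypeR R).
  by apply: measurable_funB.
transitivity (\int[pushforward lam ((fun y => c - y)%R : _ -> measurableTypeR R)]_y f y).
  by rewrite ge0_integral_pushforward.
apply: eq_measure_integral => A mA _.
apply/esym/lebesgue_measure_unique => //= _ [[a b]] _ <-.
rewrite /pushforward.
rewrite (_ : _ @^-1` _ = `[(c - b)%R, (c - a)%R[%classic); last first.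
  apply/seteqP; split => y /=; rewrite !in_itv/=.
    by move=> /andP[? ?]; apply/andP; split; [rewrite lerBlDr -lerBlDl|rewrite ltrBrDr -ltrBrDl].
  by move=> /andP[? ?]; apply/andP; split; [rewrite ltrBrDr -ltrBrDl|rewrite lerBlDr -lerBlDl].
rewrite !lebesgue_measure_itv/= !lte_fin ltrD2l ltrN2.
by case: ifP => //= _; congr EFin; ring.
Qed.

Lemma ge0_integral_reflect n (c : 'rV[R]_n) (f : 'rV[R]_n -> \bar R) :
  measurable_fun setT f -> (forall x, 0 <= f x) ->
  \int[mu n]_y f (c - y)%R = \int[mu n]_y f y.
Proof.
elim: n c f => [|n IHn] c f mf f0.
  by rewrite !integral_rV0; congr f; apply/rowP => -[].
have mfr : measurable_fun setT (fun y : 'rV[R]_n.+1 => f (c - y)%R).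
  by apply: (measurableT_comp mf); exact: measurable_rVB.
rewrite (ge0_integral_rVS mfr (fun=> f0 _)) (ge0_integral_rVS mf f0).
have mfc : measurable_fun setT (fun z => f (rVcons z)).
  by apply: measurableT_comp => //; exact: measurable_rVcons.
transitivity (\int[lam]_a \int[mu n]_v f (rVcons ((rVuncons c).1 - a, v)%R)).
  apply: eq_integral => a _.
  rewrite -[RHS](IHn (rVuncons c).2)//; last first.
    exact: (measurableT_comp mfc (measurable_pair1 _)).
  by apply: eq_integral => v _; rewrite rVconsB.
apply: (ge0_integral_reflect1 (rVuncons c).1 (f := fun a => \int[mu n]_v f (rVcons (a, v)))).
  exact: (@measurable_fun_fubini_tonelli_F _ _ _ _ _ (mu n) (fun z => f (rVcons z))).
by move=> a; apply: integral_ge0.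
Qed.

(** A translation is the composition of two reflections. *)
Lemma ge0_integral_translate n (c : 'rV[R]_n) (f : 'rV[R]_n -> \bar R) :
  measurable_fun setT f -> (forall x, 0 <= f x) ->
  \int[mu n]_y f (y + c)%R = \int[mu n]_y f y.
Proof.
move=> mf f0.
have mfN : measurable_fun setT (fun y : 'rV[R]_n => f (- y)%R).
  apply: measurableT_comp => //.
  rewrite (_ : -%R = (fun x : 'rV_n => cst 0 x - x)%R).
    exact: measurable_rVB.
  by apply/funext => x; rewrite sub0r.
transitivity (\int[mu n]_y f (- y)%R).
  rewrite -[RHS](ge0_integral_reflect (- c)%R)//.
  by apply: eq_integral => y _; rewrite opprB opprK.
rewrite -[RHS](ge0_integral_reflect 0%R)//.
by apply: eq_integral => y _; rewrite sub0r.
Qed.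

Lemma measurable_prod_coord n (phi : 'I_n -> R -> R) :
  (forall l, measurable_fun setT (phi l)) ->
  measurable_fun setT (fun x : 'rV[R]_n => \prod_(l < n) phi l (x ord0 l))%R.
Proof.
move=> mphi; apply: measurable_prod => l _.
exact: (measurableT_comp (mphi l) (measurable_coord l)).
Qed.

Lemma le_integral_prod n (phi : 'I_n -> R -> R) (c : 'I_n -> R) :
  (forall l, measurable_fun setT (phi l)) ->
  (forall l x, 0 <= phi l x)%R ->
  (forall l, \int[lam]_a (phi l a)%:E <= (c l)%:E) ->
  \int[mu n]_x (\prod_(l < n) phi l (x ord0 l))%:E <= (\prod_(l < n) c l)%:E.
Proof.
elim: n phi c => [|n IHn] phi c mphi phi0 hc.
  by rewrite integral_rV0 !big_ord0.
have c0 l : (0 <= c l)%R.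
  by rewrite -lee_fin (le_trans _ (hc l))// integral_ge0// => x _; rewrite lee_fin.
rewrite ge0_integral_rVS//; last 2 first.
- by apply/measurable_EFinP; exact: measurable_prod_coord.
- by move=> x; rewrite lee_fin prodr_ge0.
apply: (@le_trans _ _ (\int[lam]_a ((\prod_(l < n) c (lift ord0 l))%:E * (phi ord0 a)%:E))).
  apply: ge0_le_integral => //.
  - by move=> a _; apply: integral_ge0 => v _; rewrite lee_fin prodr_ge0.
  - apply: (@measurable_fun_fubini_tonelli_F _ _ _ _ _ (mu n)
     (fun z => (\prod_(l < n.+1) phi l (rVcons z ord0 l))%:E)).
      apply/measurable_EFinP.
      exact: (measurableT_comp (measurable_prod_coord mphi) (@measurable_rVcons R n)).
    by move=> z; rewrite lee_fin prodr_ge0.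
  - by apply: emeasurable_funM => //; apply/measurable_EFinP; exact: mphi.
  move=> a _.
  under eq_integral => v _.
    rewrite big_ord_recl rVcons0 /=.
    under eq_bigr => l _ do rewrite rVconsS /=.
    rewrite EFinM; over.
  rewrite ge0_integralZl_EFin//.
  - by rewrite muleC lee_wpmul2r ?lee_fin// (IHn (fun l => phi (lift ord0 l))).
  - by move=> v _; rewrite lee_fin prodr_ge0.
  - apply/measurable_EFinP.
    exact: (measurable_prod_coord (fun l => mphi (lift ord0 l))).
rewrite ge0_integralZl_EFin//.
- rewrite big_ord_recl mulrC EFinM lee_wpmul2l// lee_fin.
  by rewrite prodr_ge0.
- by move=> a _; rewrite lee_fin.
- by apply/measurable_EFinP; exact: mphi.
- by rewrite prodr_ge0.
Qed.

End lebesgue_rV_theory.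

(** * Fourier integrals of Gaussian monomials *)

Section gauss_monomials.
Context {R : realType}.
Notation lam := (@lebesgue_measure R).

Lemma is_derive_continuous (f : R -> R) (x l : R) :
  is_derive x 1 f l -> {for x, continuous f}.
Proof.
by move=> [df _]; apply: differentiable_continuous; apply/derivable1_diffP.
Qed.

(** The decay of [H] kills the boundary terms of the fundamental theorem of
    calculus on [[-N, N]] as [N] grows. *)
Lemma integral_derivative_eq0 (H h : R -> R) (C : R) :
  (forall x : R, is_derive x 1 H (h x)) -> continuous h ->
  lam.-integrable setT (EFin \o h) ->
  (forall x : R, `|H x| * (1 + `|x|) <= C) ->
  (\int[lam]_x (h x)%:E = 0)%E.
Proof.
move=> dH ch ih HC.
have mh : measurable_fun setT h by exact: continuous_measurable_fun.
have C0 : 0 <= C by apply: le_trans (HC 0); rewrite mulr_ge0.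
pose f_ (n : nat) (x : R) := ((h x) * \1_(`[- n.+1%:R, n.+1%:R]%classic) x)%:E.
have f_E (n : nat) : (\int[lam]_x f_ n x = (H n.+1%:R - H (- n.+1%:R))%:E)%E.
  transitivity (\int[lam]_(x in `[(- n.+1%:R)%R, n.+1%:R]) (h x)%:E)%E.
    by rewrite [RHS]integral_mul_indic; apply: eq_integral => x _; rewrite -EFinM.
  rewrite (@continuous_FTC2 _ _ H) ?EFinB//.
  - by rewrite (@lt_trans _ _ 0) ?oppr_lt0.
  - by apply: continuous_subspaceT => x; exact: ch.
  - split.
    + by move=> x _; have [] := dH x.
    + by apply: cvg_at_right_filter; apply: is_derive_continuous.
    + by apply: cvg_at_left_filter; apply: is_derive_continuous.
  - by move=> x _; rewrite derive1E; have [] := dH x.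
have cv : (\int[lam]_x f_ n x)%E @[n --> \oo] --> (\int[lam]_x (h x)%:E)%E.
  apply: (@dominated_cvg _ _ _ lam setT _ f_ (EFin \o h) (EFin \o (fun x => `|h x|))) => //=.
  - by move=> n; apply/measurable_EFinP; apply: measurable_funM => //; exact: measurable_indic.
  - move=> x _; apply: cvg_EFin; first exact: nearW.
    apply: cvg_near_cst; near=> n; rewrite /f_/= indicE mem_set ?mulr1//=.
    rewrite in_itv/= -ler_norml ltW//; near: n.
    apply: filterS (nbhs_infty_gtr `|x|) => j xj.
    by apply: lt_trans xj _; rewrite ltr_nat.
  - by have := integrable_norm ih.
  - move=> n x _; rewrite /f_/= lee_fin normrM ler_piMr// indicE.
    by case: (_ \in _); rewrite ?normr1 ?normr0.
have fE : (fun n => \int[lam]_x f_ n x)%E = (fun n : nat => (H n.+1%:R - H (- n.+1%:R))%:E).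
  by apply/funext.
rewrite fE in cv.
have : (H n.+1%:R - H (- n.+1%:R))%:E @[n --> \oo] --> (0%E : \bar R).
  apply: cvg_EFin; first exact: nearW.
  apply/cvgrPdist_le => /= e e0; near=> n.
  rewrite sub0r normrN (le_trans (ler_normB _ _))//.
  have n0 : 0 < 1 + n.+1%:R :> R by [].
  apply: (@le_trans _ _ (C / (1 + n.+1%:R) + C / (1 + n.+1%:R))).
    apply: lerD; rewrite ler_pdivlMr//.
      by have := HC n.+1%:R; rewrite normr_nat.
    by have := HC (- n.+1%:R); rewrite normrN normr_nat.
  rewrite -mulrDl ler_pdivrMr//.
  rewrite mulrC -ler_pdivrMr// ltW// (@lt_le_trans _ _ n.+1%:R)//; last by rewrite lerDr.
  near: n; apply: filterS (nbhs_infty_gtr ((C + C) / e)) => j xj.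
  by apply: lt_trans xj _; rewrite ltr_nat.
by move=> /(cvg_unique _ cv) ->.
Unshelve. all: end_near.
Qed.

(** The factor that a polynomial times the Gaussian of scale [s] contributes in
    one coordinate. *)
Definition gmono (s : R) (k : nat) (x : R) : R := x ^+ k * expR (- (s * x) ^+ 2).

Lemma is_derive_gmono (s : R) k (x : R) : is_derive x 1 (gmono s k)
  (k%:R * gmono s k.-1 x - 2 * s ^+ 2 * gmono s k.+1 x).
Proof.
have idX j (y : R) : ((@idfun R) ^+ j) y = y ^+ j.
  by elim: j => // j ih; rewrite !exprS -ih.
have d1 : is_derive x 1 ((@idfun R) ^+ k) (k%:R * x ^+ k.-1).
  by apply: is_derive_eq; rewrite /GRing.scale/= mulr1.
have d3 : is_derive x 1 (fun y : R => - (s * y) ^+ 2) (- (2 * s ^+ 2 * x)).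
  rewrite (_ : (fun y => _) = (- s ^+ 2) \*: ((@idfun R) ^+ 2)); last first.
    by apply/funext => y; rewrite exprMn -mulNr.
  by apply: is_derive_eq; rewrite /GRing.scale/= mulr1; ring.
have d2 : is_derive x 1 (expR \o (fun y : R => - (s * y) ^+ 2))
    (expR (- (s * x) ^+ 2) * (- (2 * s ^+ 2 * x))).
  exact: is_derive1_comp.
have H := is_deriveM d1 d2; rewrite (_ : _ * _ = gmono s k) in H; last first.
  by apply/funext => y; rewrite /gmono -idX.
apply: (is_derive_eq H); rewrite /GRing.scale/= /gmono.
by rewrite idX (exprS x k); set e := expR _; ring.
Qed.

Definition gmono_const (k : nat) : R := (2 * k%:R) ^+ k.

Lemma gmono_const_ge0 k : 0 <= gmono_const k.
Proof. by rewrite exprn_ge0// mulr_ge0. Qed.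

(** Half of the Gaussian absorbs the monomial: [|u|^k e^(-u^2/2) <= (2k)^k] follows
    from [1 + y <= e^y] at [y = u^2/(2k)]. *)
Lemma gmono_bound (s : R) k (x : R) : 0 < s ->
  `|gmono s k x| <= gmono_const k * s ^- k * expR (- (s * x) ^+ 2 / 2).
Proof.
move=> s0; rewrite /gmono_const /gmono normrM (ger0_norm (expR_ge0 _)) normrX.
have sk : 0 < s ^+ k by rewrite exprn_gt0.
set E := expR (- (s * x) ^+ 2 / 2).
have E0 : 0 < E by exact: expR_gt0.
have -> : expR (- (s * x) ^+ 2) = E * E.
  by rewrite -expRD; congr expR; field.
rewrite mulrA ler_pM2r//.
set u := s * x.
suff : `|u| ^+ k * E <= (2 * k%:R) ^+ k.
  have -> : `|u| ^+ k = s ^+ k * `|x| ^+ k.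
    by rewrite /u normrM (ger0_norm (ltW s0)) exprMn.
  by move=> h; rewrite ler_pdivlMr// mulrC mulrA.
rewrite -ler_pdivlMr//.
rewrite /E -expRN mulNr opprK -/u.
case: k sk => [|k] sk; first by rewrite !expr0 mul1r -[leLHS]expR0 ler_expR divr_ge0// sqr_ge0.
have k0 : 0 < k.+1%:R :> R by [].
rewrite (_ : u ^+ 2 / 2 = k.+1%:R * (u ^+ 2 / 2 / k.+1%:R)); last by field; rewrite gt_eqF.
rewrite expRM_natl -exprMn ler_pXn2r ?nnegrE ?mulr_ge0 ?expR_ge0//.
apply: (@le_trans _ _ (2 * k.+1%:R * (1 + u ^+ 2 / 2 / k.+1%:R))); last first.
  by rewrite ler_pM2l ?mulr_gt0// expR_ge1Dx.
have -> : 2 * k.+1%:R * (1 + u ^+ 2 / 2 / k.+1%:R) = 2 * k.+1%:R + u ^+ 2 by field; rewrite gt_eqF.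
have : `|u| ^+ 2 = u ^+ 2 by rewrite real_normK ?num_real.
have : 1 <= k.+1%:R :> R by rewrite ler1n.
nra.
Qed.

Lemma measurable_scaled_gauss (s : R) :
  measurable_fun setT (fun x : R => expR (- (s * x) ^+ 2 / 2)).
Proof.
apply: (measurableT_comp (@measurable_expR R)).
apply: measurable_funM => //; apply: measurable_funN.
by apply: measurable_funX; exact: measurable_funM.
Qed.

Lemma integral_gauss_scaled (s : R) : 0 < s ->
  (\int[lam]_x (expR (- (s * x) ^+ 2 / 2))%:E = (Num.sqrt (2 * pi) / s)%:E)%E.
Proof.
move=> s0.
have si0 : s^-1 != 0 by rewrite invr_neq0 ?gt_eqF.
have := integral_normal_pdf 0 s^-1; rewrite normal_pdfE//.
under eq_integral => x _.
  rewrite (_ : normal_fun 0 s^-1 x = expR (- (s * x) ^+ 2 / 2)); last first.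
    rewrite /normal_fun subr0; congr expR; rewrite -mulr_natr; field.
    by rewrite gt_eqF.
  rewrite EFinM; over.
have p0 := normal_peak_gt0 si0.
rewrite ge0_integralZl_EFin//; last 2 first.
- by apply/measurable_EFinP; exact: measurable_scaled_gauss.
- exact: ltW.
move=> int1.
have -> : Num.sqrt (2 * pi) / s = (normal_peak s^-1)^-1.
  rewrite /normal_peak invrK.
  rewrite (_ : s^-1 ^+ 2 * pi *+ 2 = s^-1 ^+ 2 * (2 * pi)); last by ring.
  by rewrite [in RHS]sqrtrM ?sqr_ge0// sqrtr_sqr ger0_norm ?invr_ge0 ?ltW// mulrC.
move: int1; case: (\int[lam]_x _)%E => [r| |]; last 2 first.
- by rewrite gt0_muley ?lte_fin.
- by rewrite gt0_muleNy ?lte_fin.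
by rewrite -EFinM => -[] /(congr1 (fun z => (normal_peak s^-1)^-1 * z)); rewrite mulKf ?gt_eqF// mulr1 => ->.
Qed.

Lemma continuous_gmono (s : R) k : continuous (gmono s k).
Proof. by move=> x; apply: is_derive_continuous; exact: is_derive_gmono. Qed.

Lemma measurable_gmono s k : measurable_fun setT (gmono s k).
Proof. by apply: continuous_measurable_fun; exact: continuous_gmono. Qed.

Lemma le_integral_gauss_bound (s c : R) (g : R -> R) : 0 < s -> measurable_fun setT g ->
  (forall x, `|g x| <= c * expR (- (s * x) ^+ 2 / 2)) ->
  (\int[lam]_x (`|g x|)%:E <= (c * (Num.sqrt (2 * pi) / s))%:E)%E.
Proof.
move=> s0 mg gc; have mE := measurable_scaled_gauss s.
have c0 : 0 <= c.
  by have := le_trans (normr_ge0 _) (gc 0); rewrite pmulr_lge0 ?expR_gt0.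
apply: (@le_trans _ _ (\int[lam]_x (c%:E * (expR (- (s * x) ^+ 2 / 2))%:E))%E).
  apply: ge0_le_integral => //.
  - by apply/measurable_EFinP; exact: measurableT_comp.
  - by apply: emeasurable_funM => //; apply/measurable_EFinP.
  - by move=> x _; rewrite -EFinM lee_fin.
rewrite ge0_integralZl_EFin//; first by rewrite integral_gauss_scaled.
exact/measurable_EFinP.
Qed.

Lemma le_integral_gmono (s : R) k : 0 < s ->
  (\int[lam]_x (`|gmono s k x|)%:E <= (gmono_const k * Num.sqrt (2 * pi) * s ^- k.+1)%:E)%E.
Proof.
move=> s0; have gk x := @gmono_bound s k x s0.
apply: (le_trans (le_integral_gauss_bound s0 (measurable_gmono s k) gk)).
rewrite lee_fin; apply: le_of_eq.
by rewrite (exprS s k); field; rewrite expf_neq0 gt_eqF.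
Qed.

Lemma integrable_gmono (s : R) k : 0 < s -> lam.-integrable setT (EFin \o gmono s k).
Proof.
move=> s0; apply/integrableP; split; first by apply/measurable_EFinP; exact: measurable_gmono.
exact: le_lt_trans (le_integral_gmono k s0) (ltry _).
Qed.

Lemma gmono_decay (s : R) k : 0 < s -> exists C, forall x : R, `|gmono s k x| * (1 + `|x|) <= C.
Proof.
move=> s0; exists (gmono_const k * s ^- k + gmono_const k.+1 * s ^- k.+1) => x.
have bnd j : `|gmono s j x| <= gmono_const j * s ^- j.
  apply: (le_trans (gmono_bound j x s0)).
  apply: ler_piMr; first by rewrite divr_ge0 ?gmono_const_ge0// exprn_ge0// ltW.
  by rewrite expR_le1 mulNr oppr_le0 divr_ge0// sqr_ge0.
rewrite mulrDr mulr1 lerD//.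
have -> : `|gmono s k x| * `|x| = `|gmono s k.+1 x|.
  by rewrite -normrM /gmono (exprS x k); congr (`|_|); set e := expR _; ring.
exact: bnd.
Qed.

Definition dgmono (s : R) k (x : R) : R :=
  k%:R * gmono s k.-1 x - 2 * s ^+ 2 * gmono s k.+1 x.

Definition ddgmono (s : R) k (x : R) : R :=
  (k * k.-1)%:R * gmono s k.-2 x - 2 * s ^+ 2 * (k + k.+1)%:R * gmono s k x
  + 4 * s ^+ 4 * gmono s k.+2 x.

Lemma is_derive_dgmono (s : R) k (x : R) : is_derive x 1 (dgmono s k) (ddgmono s k x).
Proof.
have H1 := is_deriveZ k%:R (is_derive_gmono s k.-1 x).
have H2 := is_deriveZ (2 * s ^+ 2) (is_derive_gmono s k.+1 x).
apply: (is_derive_eq (is_deriveB H1 H2)); rewrite /GRing.scale/= /ddgmono.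
case: k {H1 H2} => [|k] /=.
  by rewrite muln0 add0n; ring.
by rewrite natrM natrD -!natr1; ring.
Qed.

Lemma measurable_ddgmono (s : R) k : measurable_fun setT (ddgmono s k).
Proof.
by apply: measurable_funD; [apply: measurable_funB|]; apply: measurable_funM => //;
  exact: measurable_gmono.
Qed.

Definition ddgmono_const (k : nat) : R :=
  (k * k.-1)%:R * gmono_const k.-2 + 2 * (k + k.+1)%:R * gmono_const k + 4 * gmono_const k.+2.

Lemma ddgmono_bound (s : R) k (x : R) : 0 < s ->
  `|ddgmono s k x| <= ddgmono_const k * s ^- k * s ^+ 2 * expR (- (s * x) ^+ 2 / 2).
Proof.
move=> s0; set E := expR _.
have bnd (c : R) j : 0 <= c -> `|c * gmono s j x| <= c * (gmono_const j * s ^- j * E).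
  by move=> c0; rewrite normrM ger0_norm// ler_wpM2l// gmono_bound.
have -> : ddgmono_const k * s ^- k * s ^+ 2 * E =
    (k * k.-1)%:R * (gmono_const k.-2 * s ^- k.-2 * E) +
    2 * s ^+ 2 * (k + k.+1)%:R * (gmono_const k * s ^- k * E) +
    4 * s ^+ 4 * (gmono_const k.+2 * s ^- k.+2 * E).
  rewrite /ddgmono_const.
  have -> : s ^- k.+2 = s ^- k * s ^- 2 by rewrite -invfM -exprD addn2.
  have -> : (k * k.-1)%:R * (gmono_const k.-2 * s ^- k.-2 * E) =
      (k * k.-1)%:R * gmono_const k.-2 * (s ^- k * s ^+ 2) * E.
    case: k bnd => [|[|k]] _; rewrite ?mul0n ?muln0 ?mul0r//=.
    have -> : s ^- k.+2 = s ^- k * s ^- 2 by rewrite -invfM -exprD addn2.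
    by rewrite -(mulrA (s ^- k)) mulVf ?expf_neq0 ?gt_eqF// mulr1; ring.
  by set e := s ^- k; field; rewrite gt_eqF.
rewrite (le_trans (ler_normD _ _))// lerD//; last first.
  by apply: bnd; rewrite mulr_ge0// exprn_ge0// ltW.
rewrite (le_trans (ler_normB _ _))// lerD//; apply: bnd => //.
by rewrite mulr_ge0// mulr_ge0// sqr_ge0.
Qed.

Lemma le_integral_ddgmono (s : R) k : 0 < s ->
  (\int[lam]_x (`|ddgmono s k x|)%:E <=
    (ddgmono_const k * Num.sqrt (2 * pi) * s ^- k.+1 * s ^+ 2)%:E)%E.
Proof.
move=> s0; have gk x := @ddgmono_bound s k x s0.
apply: (le_trans (le_integral_gauss_bound s0 (measurable_ddgmono s k) gk)).
rewrite lee_fin; apply: le_of_eq.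
by rewrite (exprS s k); field; rewrite expf_neq0 gt_eqF.
Qed.

Lemma measurable_cosT d (X : measurableType d) (f : X -> R) :
  measurable_fun setT f -> measurable_fun setT (fun x => cos (f x)).
Proof.
apply: (measurableT_comp (f := @cos R)).
exact: continuous_measurable_fun (@continuous_cos R).
Qed.

Lemma measurable_sinT d (X : measurableType d) (f : X -> R) :
  measurable_fun setT f -> measurable_fun setT (fun x => sin (f x)).
Proof.
apply: (measurableT_comp (f := @sin R)).
exact: continuous_measurable_fun (@continuous_sin R).
Qed.

Lemma norm_cos_le1 (x : R) : `|cos x| <= 1.
Proof. by rewrite ler_norml cos_geN1 cos_le1. Qed.

Lemma norm_sin_le1 (x : R) : `|sin x| <= 1.
Proof. by rewrite ler_norml sin_geN1 sin_le1. Qed.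

Lemma integrable_mul_le1 d (X : measurableType d) (m : {measure set X -> \bar R})
    (g f : X -> R) :
  measurable_fun setT g -> (forall x, `|g x| <= 1) ->
  m.-integrable setT (EFin \o f) ->
  m.-integrable setT (EFin \o (fun x => g x * f x)).
Proof.
move=> mg g1 fi; apply: (le_integrable _ _ _ fi) => //.
  apply/measurable_EFinP; apply: measurable_funM => //.
  by have /measurable_EFinP := measurable_int _ fi.
by move=> x _; rewrite lee_fin normrM ler_piMl// norm_cos_le1.
Qed.

(** Two integrations by parts at once: with [g = gmono s k] the integrand is the
    derivative of [a sin(a x + theta) g + cos(a x + theta) g']. The phase [theta]
    covers sine and cosine together. *)
Lemma integral_cos_gmono2 (s a theta : R) k : 0 < s ->
  (\int[lam]_x (a ^+ 2 * (cos (a * x + theta) * gmono s k x)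
     + cos (a * x + theta) * ddgmono s k x)%:E = 0)%E.
Proof.
move=> s0.
pose H x := a * sin (a * x + theta) * gmono s k x + cos (a * x + theta) * dgmono s k x.
have dl (x : R) : is_derive x 1 (fun y : R => a * y + theta) a.
  rewrite (_ : (fun y => _) = (a \*: (@idfun R)) + cst theta)//.
  by apply: is_derive_eq; rewrite /GRing.scale/= addr0 mulr1.
have dsin (x : R) : is_derive x 1 (sin \o (fun y : R => a * y + theta)) (cos (a * x + theta) * a).
  exact: is_derive1_comp.
have dcos (x : R) : is_derive x 1 (cos \o (fun y : R => a * y + theta)) (- sin (a * x + theta) * a).
  exact: is_derive1_comp.
have dH (x : R) : is_derive x 1 H (a ^+ 2 * (cos (a * x + theta) * gmono s k x)
     + cos (a * x + theta) * ddgmono s k x).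
  have H1 := is_deriveM (is_deriveZ a (dsin x)) (is_derive_gmono s k x).
  have H2 := is_deriveM (dcos x) (is_derive_dgmono s k x).
  apply: (is_derive_eq (is_deriveD H1 H2)).
  transitivity (a * sin (a * x + theta) * dgmono s k x
    + gmono s k x * (a * (cos (a * x + theta) * a))
    + (cos (a * x + theta) * ddgmono s k x + dgmono s k x * (- sin (a * x + theta) * a))) => //.
  by ring.
have cdd : continuous (ddgmono s k).
  move=> x; apply: cvgD; first apply: cvgB; apply: cvgM; (try exact: cvg_cst); exact: continuous_gmono.
have ccos : continuous (fun x : R => cos (a * x + theta)).
  by move=> x; exact: is_derive_continuous (dcos x).
have le1 := @norm_cos_le1; have le1' := @norm_sin_le1.
have mcos : measurable_fun setT (fun x : R => cos (a * x + theta)) by exact: continuous_measurable_fun.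
have [C0 hC0] := @gmono_decay s k s0.
have [C1 hC1] := @gmono_decay s k.-1 s0.
have [C2 hC2] := @gmono_decay s k.+1 s0.
apply: (@integral_derivative_eq0 H _ (`|a| * C0 + (k%:R * C1 + 2 * s ^+ 2 * C2)) dH).
- move=> x; apply: cvgD; apply: cvgM; (try exact: cvg_cst).
  + by apply: cvgM; [exact: ccos|exact: continuous_gmono].
  + exact: ccos.
  + exact: cdd.
- have i1 : lam.-integrable setT (EFin \o (fun x => cos (a * x + theta) * gmono s k x)).
    by apply: integrable_mul_le1 => //; exact: integrable_gmono.
  have i2 : lam.-integrable setT (EFin \o (fun x => cos (a * x + theta) * ddgmono s k x)).
    have idd : lam.-integrable setT (EFin \o ddgmono s k).
      apply/integrableP; split; first by apply/measurable_EFinP; exact: measurable_ddgmono.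
      exact: le_lt_trans (le_integral_ddgmono k s0) (ltry _).
    exact: integrable_mul_le1.
  have := integrableD measurableT (integrableZl measurableT (a ^+ 2) i1) i2.
  by apply: eq_integrable.
- move=> x; have x0 : 0 <= 1 + `|x| by rewrite addr_ge0.
  apply: (@le_trans _ _ ((`|a| * `|gmono s k x| + `|dgmono s k x|) * (1 + `|x|))).
    rewrite ler_wpM2r// (le_trans (ler_normD _ _))// lerD//.
      by rewrite !normrM ler_wpM2r// ler_piMr.
    by rewrite normrM ler_piMl.
  rewrite mulrDl lerD//; first by rewrite -mulrA ler_wpM2l.
  apply: (@le_trans _ _ ((k%:R * `|gmono s k.-1 x| + 2 * s ^+ 2 * `|gmono s k.+1 x|) * (1 + `|x|))).
    have c2 : 0 <= 2 * s ^+ 2 by rewrite mulr_ge0// sqr_ge0.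
    rewrite ler_wpM2r// (le_trans (ler_normB _ _))// (normrM k%:R) normr_nat.
    by rewrite (normrM (2 * s ^+ 2)) (ger0_norm c2).
  rewrite mulrDl -!(mulrA _ _ (1 + _)); apply: lerD; apply: ler_wpM2l => //.
  by rewrite mulr_ge0// sqr_ge0.
Qed.

Definition osc_const (k : nat) : R :=
  gmono_const k * Num.sqrt (2 * pi) + ddgmono_const k * Num.sqrt (2 * pi).

Lemma osc_const_ge0 k : 0 <= osc_const k.
Proof.
rewrite /osc_const /ddgmono_const.
have g := gmono_const_ge0.
rewrite -mulrDl mulr_ge0// addr_ge0// !addr_ge0//; exact: mulr_ge0 (g _).
Qed.

(** By [integral_cos_gmono2], [a^2] times the integral is minus the integral with
    [ddgmono], which is of order [s^2] times the trivial bound; adding the trivial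
    bound itself gives the factor [1 + (a/s)^2]. *)
Lemma oscillatory_bound (s a theta : R) k : 0 < s ->
  `|\int[lam]_x (cos (a * x + theta) * gmono s k x)| <=
  osc_const k * s ^- k.+1 * (1 + (a / s) ^+ 2)^-1.
Proof.
move=> s0.
have mcos : measurable_fun setT (fun x : R => cos (a * x + theta)).
  by apply: measurable_cosT; apply: measurable_funD => //; exact: measurable_funM.
have bnd (g : R -> R) (B : R) : measurable_fun setT g ->
    (\int[lam]_x (`|g x|)%:E <= B%:E)%E ->
    lam.-integrable setT (EFin \o (fun x => cos (a * x + theta) * g x)) /\
    `|\int[lam]_x (cos (a * x + theta) * g x)| <= B.
  move=> mg hB.
  have mm : measurable_fun setT (fun x => cos (a * x + theta) * g x) by exact: measurable_funM.
  have leB : (\int[lam]_x (`|cos (a * x + theta) * g x|)%:E <= B%:E)%E.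
    apply: le_trans hB; apply: ge0_le_integral => //.
    - by apply/measurable_EFinP; exact: measurableT_comp.
    - by apply/measurable_EFinP; exact: measurableT_comp.
    - by move=> x _; rewrite lee_fin normrM ler_piMl// norm_cos_le1.
  have ii : lam.-integrable setT (EFin \o (fun x => cos (a * x + theta) * g x)).
    apply/integrableP; split; first exact/measurable_EFinP.
    exact: le_lt_trans leB (ltry _).
  split => //.
  apply: (le_trans (le_normr_Rintegral measurableT ii)).
  rewrite -lee_fin /Rintegral fineK//.
  by apply: integrable_fin_num => //; exact: integrable_norm.
have [i1 b1] := bnd _ _ (measurable_gmono s k) (le_integral_gmono k s0).
have [i2 b2] := bnd _ _ (measurable_ddgmono s k) (le_integral_ddgmono k s0).
set J := \int[lam]_x _ in b1 *.
set K := \int[lam]_x _ in b2.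
have JK : a ^+ 2 * J + K = 0.
  rewrite /J /K -RintegralZl// -RintegralD//; last first.
    by have := integrableZl measurableT (a ^+ 2) i1; apply: eq_integrable.
  by rewrite /Rintegral integral_cos_gmono2.
have p0 : 0 < 1 + (a / s) ^+ 2 by rewrite ltr_pwDl// sqr_ge0.
rewrite ler_pdivlMr// mulrDr mulr1 /osc_const mulrDl lerD//.
have -> : `|J| * (a / s) ^+ 2 = `|K| / s ^+ 2.
  have -> : K = - (a ^+ 2 * J) by move: JK => /eqP; rewrite addrC addr_eq0 => /eqP.
  rewrite normrN normrM (@ger0_norm _ (a ^+ 2)) ?sqr_ge0//.
  by field; rewrite gt_eqF.
by rewrite ler_pdivrMr// exprn_gt0.
Qed.

End gauss_monomials.

(** * Fourier integrals of products *)

Section fourier_product.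
Context {R : realType}.
Notation lam := (@lebesgue_measure R).
Local Notation mu n := (@lebesgue_rV R n).

Lemma integrable_prod_coord n (phi : 'I_n -> R -> R) :
  (forall l, lam.-integrable setT (EFin \o phi l)) ->
  (mu n).-integrable setT (EFin \o (fun x : 'rV[R]_n => \prod_(l < n) phi l (x ord0 l))).
Proof.
move=> iphi.
have mphi l : measurable_fun setT (phi l).
  by have /measurable_EFinP := measurable_int _ (iphi l).
apply/integrableP; split.
  by apply/measurable_EFinP; exact: measurable_prod_coord.
have fin l : (\int[lam]_a (`|phi l a|)%:E)%E \is a fin_num.
  have /integrableP[_ h] := iphi l.
  by rewrite ge0_fin_numE// integral_ge0.
apply: (@le_lt_trans _ _ (\prod_(l < n) fine (\int[lam]_a (`|phi l a|)%:E)%E)%:E); last exact: ltry.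
have := @le_integral_prod R n (fun l a => `|phi l a|) (fun l => fine (\int[lam]_a (`|phi l a|)%:E)%E).
have -> : (fun x : 'rV[R]_n => (\prod_(l < n) `|phi l (x ord0 l)|)%:E) =
   (abse \o (EFin \o (fun x : 'rV[R]_n => \prod_(l < n) phi l (x ord0 l)))).
  by apply/funext => x /=; rewrite normr_prod.
apply => [l||l].
- by apply: measurableT_comp.
- by [].
- by rewrite fineK.
Qed.

Lemma Rintegral_rVS n (f : 'rV[R]_n.+1 -> R) (g : R -> R) :
  (mu n.+1).-integrable setT (EFin \o f) ->
  (forall a, (\int[mu n]_v (f (rVcons (a, v)))%:E = (g a)%:E)%E) ->
  \int[mu n.+1]_x f x = \int[lam]_a g a.
Proof.
move=> fi fg; rewrite /Rintegral; congr fine.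
have mf : measurable_fun setT (EFin \o f) := measurable_int _ fi.
have mc := @measurable_rVcons R n.
have ic : (lam \x mu n)%E.-integrable setT ((EFin \o f) \o @rVcons R n).
  have /integrableP[_ h] := fi.
  apply/integrableP; split; first exact: measurableT_comp.
  apply: le_lt_trans h.
  have -> : (\int[mu n.+1]_x `|(EFin \o f) x| =
    \int[pushforward (lam \x mu n)%E (@rVcons R n)]_x `|(EFin \o f) x|)%E by [].
  by rewrite ge0_integral_pushforward//; exact: measurableT_comp.
transitivity (\int[lam \x mu n]_z ((EFin \o f) \o @rVcons R n) z)%E.
  transitivity (\int[pushforward (lam \x mu n)%E (@rVcons R n)]_x (EFin \o f) x)%E => //.
  by rewrite integral_pushforward// preimage_setT.
rewrite -integral12_prod_meas1//; apply: eq_integral => a _.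
by rewrite -fg.
Qed.

Lemma dotp_rVcons n (x : 'rV[R]_n.+1) (z : R * 'rV[R]_n) :
  dotp x (rVcons z) = (rVuncons x).1 * z.1 + dotp (rVuncons x).2 z.2.
Proof.
rewrite /dotp big_ord_recl rVcons0; congr (_ + _).
apply: eq_bigr => l _; rewrite rVconsS; congr (_ * _).
by rewrite -{1}(rVunconsK x) rVconsS.
Qed.

(** The cosine of a sum is not a product. Splitting off one coordinate by the
    addition formula leaves a cosine and a sine integral in that coordinate, each
    times an integral in the others with its own phase: hence a factor 2 per
    coordinate, and the quantification over all phases. *)
Lemma oscillatory_prod_bound n (phi : 'I_n -> R -> R) (b : 'I_n -> R) (x : 'rV[R]_n) :
  (forall l, lam.-integrable setT (EFin \o phi l)) ->
  (forall l theta, `|\int[lam]_a (cos (x ord0 l * a + theta) * phi l a)| <= b l) ->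
  forall theta, `|\int[mu n]_xi (cos (dotp x xi + theta) * \prod_(l < n) phi l (xi ord0 l))|
    <= \prod_(l < n) (2 * b l).
Proof.
elim: n phi b x => [|n IHn] phi b x iphi hb theta.
  rewrite /Rintegral integral_rV0/= /dotp !big_ord0 add0r mulr1.
  exact: norm_cos_le1.
pose phi' l := phi (lift ord0 l); pose x' := (rVuncons x).2; pose x0 := x ord0 ord0.
have mphi l : measurable_fun setT (phi l).
  by have /measurable_EFinP := measurable_int _ (iphi l).
pose I th := \int[mu n]_v (cos (dotp x' v + th) * \prod_(l < n) phi' l (v ord0 l)).
have hI th : `|I th| <= \prod_(l < n) (2 * b (lift ord0 l)).
  apply: (IHn phi') => [l|l t]; first exact: iphi.
  have -> : x' ord0 l = x ord0 (lift ord0 l) by rewrite -{1}(rVunconsK x) rVconsS.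
  exact: hb.
have iP : (mu n).-integrable setT
    (EFin \o (fun v : 'rV[R]_n => \prod_(l < n) phi' l (v ord0 l))).
  by apply: integrable_prod_coord => l; exact: iphi.
have mdot m (y : 'rV[R]_m) th : measurable_fun setT (fun v : 'rV[R]_m => dotp y v + th).
  by apply: measurable_funD => //; exact: measurable_dotp.
have iI th : (mu n).-integrable setT
    (EFin \o (fun v => cos (dotp x' v + th) * \prod_(l < n) phi' l (v ord0 l))).
  apply: integrable_mul_le1 => //; first by apply: measurable_cosT; exact: mdot.
  by move=> v; exact: norm_cos_le1.
have IE th : (\int[mu n]_v (cos (dotp x' v + th) * \prod_(l < n) phi' l (v ord0 l))%:E = (I th)%:E)%E.
  rewrite /I /Rintegral fineK//.
  exact: (integrable_fin_num measurableT (iI th)).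
have ID th1 th2 : I (th1 + th2) = cos th1 * I th2 + sin th1 * I (th2 + pi / 2).
  have i1 := integrableZl measurableT (cos th1) (iI th2).
  have i2 := integrableZl measurableT (sin th1) (iI (th2 + pi / 2)).
  rewrite /I -RintegralZl// -RintegralZl// -RintegralD//.
  apply: eq_Rintegral => v _.
  rewrite !addrA cosDpihalf (_ : dotp x' v + th1 + th2 = th1 + (dotp x' v + th2)); last by ring.
  by rewrite cosD; ring.
pose c0 := \int[lam]_a (cos (x0 * a) * phi ord0 a).
pose s0 := \int[lam]_a (sin (x0 * a) * phi ord0 a).
have hc0 : `|c0| <= b ord0.
  have := hb ord0 0; congr (`|_| <= _).
  by apply: eq_Rintegral => a _; rewrite addr0.
have ic : lam.-integrable setT (EFin \o (fun a => cos (x0 * a) * phi ord0 a)).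
  apply: integrable_mul_le1 => //; last by move=> a; exact: norm_cos_le1.
  by apply: measurable_cosT; exact: measurable_funM.
have is_ : lam.-integrable setT (EFin \o (fun a => sin (x0 * a) * phi ord0 a)).
  apply: integrable_mul_le1 => //; last by move=> a; exact: norm_sin_le1.
  by apply: measurable_sinT; exact: measurable_funM.
have hs0 : `|s0| <= b ord0.
  have := hb ord0 (pi / 2); congr (_ <= _).
  rewrite -[in RHS]normrN -[in RHS]mulN1r /s0 -RintegralZl//; congr (`|_|).
  by apply: eq_Rintegral => a _; rewrite cosDpihalf; ring.
have b0 : 0 <= b ord0 by exact: le_trans hc0.
have mx0 : measurable_fun setT (fun x1 : 'rV[R]_n.+1 => cos (dotp x x1 + theta)).
  by apply: measurable_cosT; exact: mdot.
rewrite (@Rintegral_rVS n _ (fun a => I theta * (cos (x0 * a) * phi ord0 a)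
   + I (theta + pi / 2) * (sin (x0 * a) * phi ord0 a))); last 2 first.
- apply: integrable_mul_le1 => //; last exact: integrable_prod_coord.
  by move=> v; exact: norm_cos_le1.
- move=> a.
  transitivity (\int[mu n]_v ((phi ord0 a)%:E *
      (cos (dotp x' v + (x0 * a + theta)) * \prod_(l < n) phi' l (v ord0 l))%:E))%E.
    apply: eq_integral => v _; rewrite -EFinM; congr EFin.
    rewrite big_ord_recl rVcons0 dotp_rVcons/= -/x' -/x0.
    under eq_bigr do rewrite rVconsS /=.
    by rewrite mulrCA; congr (_ * (cos _ * _)); ring.
  rewrite integralZl//; last exact: iI.
  rewrite IE -EFinM (ID (x0 * a) theta); congr EFin.
  by rewrite mulrDr !(mulrC (phi ord0 a)) -!mulrA !(mulrCA (I _)).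
rewrite RintegralD//; last 2 first.
- by have := integrableZl measurableT (I theta) ic; apply: eq_integrable.
- by have := integrableZl measurableT (I (theta + pi / 2)) is_; apply: eq_integrable.
rewrite !RintegralZl// -/c0 -/s0 big_ord_recl.
apply: (le_trans (ler_normD _ _)); rewrite !normrM.
set B := \prod_(l < n) _ in hI *.
apply: (@le_trans _ _ (B * b ord0 + B * b ord0)); last by apply: le_of_eq; ring.
by apply: lerD; apply: ler_pM.
Qed.

(** The decay in [x] of the Fourier integrals at scale [s]. It is bounded by 1 and
    its integral is of order [s^n]; the convolution estimates rest on these two
    facts. *)
Definition cauchy_prod n (s : R) (x : 'rV[R]_n) : R :=
  \prod_(l < n) (1 + (x ord0 l / s) ^+ 2)^-1.

Lemma cauchy_prod_ge0 n s (x : 'rV[R]_n) : 0 <= cauchy_prod s x.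
Proof. by apply: prodr_ge0 => l _; rewrite invr_ge0 addr_ge0// sqr_ge0. Qed.

Lemma cauchy_prod_le1 n s (x : 'rV[R]_n) : cauchy_prod s x <= 1.
Proof.
apply: (@le_trans _ _ (\prod_(l < n) 1)); last by rewrite big1_eq.
apply: ler_prod => l _; rewrite invr_ge0 addr_ge0 ?sqr_ge0//=.
by rewrite invf_le1 ?lerDl ?sqr_ge0// ltr_pwDl ?sqr_ge0.
Qed.

Lemma prod_exp_eq n (a : 'I_n) (x : 'I_n -> R) :
  \prod_(l < n) x l ^+ (l == a) = x a.
Proof.
rewrite (bigD1 a)//= eqxx expr1 big1 ?mulr1// => l /negbTE ->.
by rewrite expr0.
Qed.

Lemma cubic_gaussE n (s : R) (a b c : 'I_n) (xi : 'rV[R]_n) :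
  xi ord0 a * xi ord0 b * xi ord0 c * expR (- (s ^+ 2 * dotp xi xi)) =
  \prod_(l < n) gmono s ((l == a) + (l == b) + (l == c))%N (xi ord0 l).
Proof.
rewrite /gmono big_split/= -expR_sum; congr (_ * expR _).
  under eq_bigr do rewrite !exprD.
  by rewrite !big_split/= !prod_exp_eq.
rewrite /dotp mulr_sumr -sumrN; apply: eq_bigr => l _.
by rewrite exprMn expr2 (expr2 (xi _ _)).
Qed.

(** A coordinate occurs at most three times in a cubic monomial. *)
Definition osc_max : R := \sum_(k < 4) osc_const k.

Lemma osc_const_le_max k : (k < 4)%N -> osc_const k <= osc_max.
Proof.
move=> k4; rewrite /osc_max (bigD1 (Ordinal k4))//= lerDl.
by apply: sumr_ge0 => l _; exact: osc_const_ge0.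
Qed.

Lemma integrable_cubic_gauss n (s : R) (a b c : 'I_n) : 0 < s ->
  (mu n).-integrable setT (EFin \o (fun xi : 'rV[R]_n =>
    xi ord0 a * xi ord0 b * xi ord0 c * expR (- (s ^+ 2 * dotp xi xi)))).
Proof.
move=> s0; rewrite (_ : (fun xi => _) = (fun xi : 'rV[R]_n =>
  \prod_(l < n) gmono s ((l == a) + (l == b) + (l == c))%N (xi ord0 l))).
  apply: (integrable_prod_coord (phi := fun l => gmono s ((l == a) + (l == b) + (l == c))%N)) => l.
  exact: integrable_gmono.
by apply/funext => xi; rewrite cubic_gaussE.
Qed.

(** Cubic monomials are what [xi_k] times the numerator of the Leray symbol
    consists of. *)
Lemma cubic_gauss_fourier_bound n (s theta : R) (a b c : 'I_n) (x : 'rV[R]_n) : 0 < s ->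
  `|\int[mu n]_xi (cos (dotp x xi + theta) *
      (xi ord0 a * xi ord0 b * xi ord0 c * expR (- (s ^+ 2 * dotp xi xi))))|
  <= (2 * osc_max) ^+ n * s ^- (n + 3) * cauchy_prod s x.
Proof.
move=> s0; under eq_Rintegral do rewrite cubic_gaussE.
pose m (l : 'I_n) := ((l == a) + (l == b) + (l == c))%N.
apply: (le_trans (@oscillatory_prod_bound n (fun l => gmono s (m l))
  (fun l => osc_const (m l) * s ^- (m l).+1 * (1 + (x ord0 l / s) ^+ 2)^-1) x _ _ theta)).
- by move=> l; exact: integrable_gmono.
- by move=> l th; exact: oscillatory_bound.
have -> : (2 * osc_max) ^+ n * s ^- (n + 3) * cauchy_prod s x =
   \prod_(l < n) (2 * (osc_max * s ^- (m l).+1 * (1 + (x ord0 l / s) ^+ 2)^-1)).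
  under eq_bigr do rewrite !mulrA.
  rewrite !big_split/= -/(cauchy_prod s x) !prodr_const card_ord exprMn; congr (_ * _ * _).
  rewrite prodfV prodrXr; congr ((s ^+ _)^-1).
  rewrite (eq_bigr (fun l => (l == a) + (l == b) + (l == c) + 1)%N); last by move=> l _; rewrite addn1.
  rewrite !big_split/= sum1_card card_ord.
  have s1 (e : 'I_n) : (\sum_(l < n) (l == e) = 1)%N by rewrite -big_mkcond/= sum1_card card1.
  by rewrite !s1 addnC.
apply: ler_prod => l _.
have p0 : 0 <= (1 + (x ord0 l / s) ^+ 2)^-1 by rewrite invr_ge0 addr_ge0// sqr_ge0.
have q0 : 0 <= s ^- (m l).+1 by rewrite invr_ge0 exprn_ge0// ltW.
rewrite !mulr_ge0 ?osc_const_ge0//= ler_pM2l// ler_wpM2r// ler_wpM2r//.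
apply: osc_const_le_max; rewrite /m.
by case: (l == a); case: (l == b); case: (l == c).
Qed.

End fourier_product.

(** * The gradient of the Oseen kernel *)

Section oseen_gradient.
Context {R : realType} (n : nat).
Notation lam := (@lebesgue_measure R).
Notation V := 'rV[R]_n.
Notation mu := (@lebesgue_rV R n).
Implicit Types (x xi : V) (t s : R) (i j k : 'I_n).

Lemma measurable_invT d (X : measurableType d) (f : X -> R) :
  measurable_fun setT f -> measurable_fun setT (fun a => (f a)^-1).
Proof.
move=> mf; rewrite (_ : (fun a => _) = (fun a => f a * (f a ^+ 2) `^ (-1))).
  apply: measurable_funM => //.
  apply: (measurableT_comp (f := fun q : R => q `^ (-1))); first exact: measurable_powR.
  exact: measurable_funX.
apply/funext => a; rewrite powR_inv1 ?sqr_ge0//.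
have [->|f0] := eqVneq (f a) 0; first by rewrite invr0 mul0r.
by rewrite expr2 invfM mulVKf.
Qed.

Lemma enorm_sqr x : enorm x ^+ 2 = dotp x x.
Proof. by rewrite sqr_sqrtr// sumr_ge0// => l _; rewrite -expr2 sqr_ge0. Qed.

Lemma dotp_ge0 x : 0 <= dotp x x.
Proof. by rewrite -enorm_sqr sqr_ge0. Qed.

Lemma enorm_ge0 x : 0 <= enorm x.
Proof. exact: sqrtr_ge0. Qed.

Lemma sqr_coord_le x i : x ord0 i ^+ 2 <= dotp x x.
Proof.
rewrite /dotp (bigD1 i)//= -expr2 lerDl; apply: sumr_ge0 => l _.
by rewrite -expr2 sqr_ge0.
Qed.

Lemma dotp_eq0 x i : dotp x x = 0 -> x ord0 i = 0.
Proof.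
move=> x0; apply/eqP; rewrite -(sqrf_eq0 (x ord0 i)) eq_le sqr_ge0 andbT.
by rewrite -x0 sqr_coord_le.
Qed.

Lemma norm_coord_mul_le x i j : `|x ord0 i * x ord0 j| <= dotp x x.
Proof.
have := sqr_coord_le x i; have := sqr_coord_le x j.
set a := x ord0 i; set b := x ord0 j => hb ha.
have := sqr_ge0 (a - b); have := sqr_ge0 (a + b).
rewrite ler_norml; nra.
Qed.

(** The Fourier symbol of the Leray projection. *)
Definition leray i j xi : R := (i == j)%:R - xi ord0 i * xi ord0 j / dotp xi xi.

(** Clearing the denominator leaves a polynomial, to which the Gaussian bounds
    apply. *)
Definition leray_num i j xi : R := (i == j)%:R * dotp xi xi - xi ord0 i * xi ord0 j.

Lemma leray_numE i j xi : leray_num i j xi = leray i j xi * dotp xi xi.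
Proof.
rewrite /leray_num /leray; have [q0|q0] := eqVneq (dotp xi xi) 0.
  by rewrite q0 !mulr0 (dotp_eq0 i q0) mul0r subr0.
by rewrite mulrBl divfK.
Qed.

Lemma norm_leray_le i j xi : `|leray i j xi| <= 2.
Proof.
rewrite /leray; apply: (le_trans (ler_normB _ _)).
rewrite -[leRHS]/(1 + 1) lerD//; first by case: (i == j); rewrite ?normr1 ?normr0.
have [q0|q0] := eqVneq (dotp xi xi) 0.
  by rewrite (dotp_eq0 i q0) !mul0r normr0.
rewrite normrM normfV (ger0_norm (dotp_ge0 xi)) ler_pdivrMr ?mul1r.
  exact: norm_coord_mul_le.
by rewrite lt0r q0 dotp_ge0.
Qed.

Lemma measurable_sqnorm : measurable_fun setT (fun xi => dotp xi xi).
Proof. exact: measurable_dotp. Qed.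

Lemma measurable_leray i j : measurable_fun setT (leray i j).
Proof.
apply: measurable_funB => //; apply: measurable_funM.
  by apply: measurable_funM; exact: measurable_coord.
by apply: measurable_invT; exact: measurable_sqnorm.
Qed.

Definition gauss t xi : R := expR (- (t * dotp xi xi)).

Lemma gauss_prodE t xi : 0 < t ->
  gauss t xi = \prod_(l < n) gmono (Num.sqrt t) 0 (xi ord0 l).
Proof.
move=> t0; rewrite /gauss /gmono big_split/= -expR_sum.
rewrite big1 ?mul1r; last by move=> l _; rewrite expr0.
congr expR; rewrite /dotp mulr_sumr -sumrN; apply: eq_bigr => l _.
by rewrite exprMn sqr_sqrtr ?(ltW t0)// expr2.
Qed.

Lemma coord_gauss_prodE t k xi : 0 < t ->
  xi ord0 k * gauss t xi = \prod_(l < n) gmono (Num.sqrt t) (l == k) (xi ord0 l).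
Proof.
move=> t0; rewrite /gauss /gmono big_split/= -expR_sum prod_exp_eq; congr (_ * expR _).
rewrite /dotp mulr_sumr -sumrN; apply: eq_bigr => l _.
by rewrite exprMn sqr_sqrtr ?(ltW t0)// expr2.
Qed.

Lemma integrable_gauss t : 0 < t -> mu.-integrable setT (EFin \o gauss t).
Proof.
move=> t0; rewrite (_ : gauss t = (fun xi => \prod_(l < n) gmono (Num.sqrt t) 0 (xi ord0 l))).
  apply: (integrable_prod_coord (phi := fun=> gmono (Num.sqrt t) 0)) => l.
  by apply: integrable_gmono; rewrite sqrtr_gt0.
by apply/funext => xi; exact: gauss_prodE.
Qed.

Lemma integrable_coord_gauss t k : 0 < t ->
  mu.-integrable setT (EFin \o (fun xi => xi ord0 k * gauss t xi)).
Proof.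
move=> t0; rewrite (_ : (fun xi => _) =
    (fun xi => \prod_(l < n) gmono (Num.sqrt t) (l == k) (xi ord0 l))).
  apply: (integrable_prod_coord (phi := fun l : 'I_n => gmono (Num.sqrt t) (l == k))) => l.
  by apply: integrable_gmono; rewrite sqrtr_gt0.
by apply/funext => xi; exact: coord_gauss_prodE.
Qed.

Lemma integrable_mul_le2 d (X : measurableType d) (m : {measure set X -> \bar R})
    (g f : X -> R) :
  measurable_fun setT g -> (forall y, `|g y| <= 2) ->
  m.-integrable setT (EFin \o f) ->
  m.-integrable setT (EFin \o (fun y => f y * g y)).
Proof.
move=> mg g2 fi.
have mf : measurable_fun setT f by have /measurable_EFinP := measurable_int _ fi.
apply: (le_integrable _ _ _ (integrableZl measurableT 2 fi)) => //.
  by apply/measurable_EFinP; exact: measurable_funM.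
move=> x _ /=; rewrite lee_fin !normrM mulrC ler_pM//.
by rewrite (@ger0_norm _ 2).
Qed.

Lemma oseen_kernelE i j t x : 0 < t ->
  oseen_kernel i j t x =
  \int[mu]_xi ((2 * pi) ^- n * (cos (dotp x xi) * (gauss t xi * leray i j xi))).
Proof.
move=> t0; rewrite RintegralZl//; last first.
  apply: integrable_mul_le1; last 1 first.
  - apply: integrable_mul_le2; [exact: measurable_leray|exact: norm_leray_le|exact: integrable_gauss].
  - by apply: measurable_cosT; exact: measurable_dotp.
  - by move=> xi; exact: norm_cos_le1.
rewrite /oseen_kernel /oseen_integral /cintegral /= mul0r subr0; congr (_ * _).
apply: eq_Rintegral => xi _ /=.
by rewrite mulr0 subr0 enorm_sqr /gauss /leray mulrAC mulrC mulrA.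
Qed.

(** The gradient as a Fourier integral: in this form Fubini's theorem gives its
    joint measurability in [(t, x)]. *)
Definition grad_oseen_int k i j t x : R :=
  \int[mu]_xi ((2 * pi) ^- n * (- sin (dotp x xi) * (xi ord0 k * gauss t xi * leray i j xi))).

Lemma dotp_shift h k x xi : dotp (h *: delta_mx ord0 k + x) xi = h * xi ord0 k + dotp x xi.
Proof.
rewrite /dotp; under eq_bigr do rewrite !mxE mulrDl.
rewrite big_split/=; congr (_ + _).
rewrite (bigD1 k)//= eqxx mulr1 big1 ?addr0// => l /negbTE lk.
by rewrite lk mulr0 mul0r.
Qed.

Lemma grad_oseenE k i j t x : 0 < t -> grad_oseen k i j t x = grad_oseen_int k i j t x.
Proof.
move=> t0; rewrite /grad_oseen.
pose f (h : R) xi := (2 * pi) ^- n *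
  (cos (h * xi ord0 k + dotp x xi) * (gauss t xi * leray i j xi)).
have fE h : oseen_kernel i j t (h *: delta_mx ord0 k + x) = \int[mu]_xi f h xi.
  by rewrite oseen_kernelE//; apply: eq_Rintegral => xi _; rewrite dotp_shift.
have -> : 'D_(delta_mx ord0 k) (oseen_kernel i j t) x = derive1 (fun h => \int[mu]_xi f h xi) 0.
  have E : (fun h : R => h^-1 *: ((oseen_kernel i j t \o shift x) (h *: delta_mx ord0 k)
      - oseen_kernel i j t x)) =
    (fun h : R => h^-1 *: (\int[mu]_xi f (h + 0) xi - \int[mu]_xi f 0 xi)).
    by apply/funext => h /=; rewrite addr0 -!fE scale0r add0r.
  by rewrite /derive E.
have iW : mu.-integrable setT (EFin \o (fun xi => gauss t xi * leray i j xi)).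
  by apply: integrable_mul_le2; [exact: measurable_leray|exact: norm_leray_le|exact: integrable_gauss].
have ikW : mu.-integrable setT (EFin \o (fun xi => xi ord0 k * gauss t xi * leray i j xi)).
  by apply: integrable_mul_le2; [exact: measurable_leray|exact: norm_leray_le|exact: integrable_coord_gauss].
have dl (h : R) xi : is_derive h 1 (fun h : R => h * xi ord0 k + dotp x xi) (xi ord0 k).
  rewrite (_ : (fun y => _) = ((xi ord0 k) \*: (@idfun R)) + cst (dotp x xi)); last first.
    by apply/funext => y; rewrite mulrC.
  by apply: is_derive_eq; rewrite /GRing.scale/= addr0 mulr1.
have dcos (h : R) xi : is_derive h 1 (cos \o (fun h : R => h * xi ord0 k + dotp x xi))
    (- sin (h * xi ord0 k + dotp x xi) * xi ord0 k).
  exact: is_derive1_comp.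
have df (h : R) xi : is_derive h 1 (f^~ xi) ((2 * pi) ^- n *
    (- sin (h * xi ord0 k + dotp x xi) * (xi ord0 k * gauss t xi * leray i j xi))).
  have H := is_deriveZ ((2 * pi) ^- n * (gauss t xi * leray i j xi)) (dcos h xi).
  rewrite (_ : f^~ xi = ((2 * pi) ^- n * (gauss t xi * leray i j xi)) \*:
     (cos \o (fun h : R => h * xi ord0 k + dotp x xi))); last first.
    by apply/funext => y; rewrite /f (mulrC (cos _)) mulrA.
  by apply: (is_derive_eq H); rewrite /GRing.scale/=; ring.
have p1 (h : R) xi : partial1of2 f h xi = (2 * pi) ^- n *
    (- sin (h * xi ord0 k + dotp x xi) * (xi ord0 k * gauss t xi * leray i j xi)).
  by rewrite partial1of2E; have [] := df h xi.
have mlin (h : R) : measurable_fun setT (fun xi => h * xi ord0 k + dotp x xi).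
  apply: measurable_funD; last exact: measurable_dotp.
  by apply: measurable_funM => //; exact: measurable_coord.
have ig : mu.-integrable setT (EFin \o (fun xi => (2 * pi) ^- n *
    `|xi ord0 k * gauss t xi * leray i j xi|)).
  have := integrableZl measurableT ((2 * pi) ^- n) (integrable_norm ikW).
  by apply: eq_integrable.
have c0 : 0 <= (2 * pi) ^- n :> R by rewrite invr_ge0 exprn_ge0// mulr_ge0// pi_ge0.
rewrite (@differentiation_under_integral _ _ _ mu f setT measurableT 0 (-1) 1 _ _ _ _ _ ig).
- apply: eq_Rintegral => xi _; rewrite p1.
  by congr (_ * (- sin _ * _)); rewrite mul0r add0r.
- by rewrite /= in_itv/= oppr_lt0 ltr01.
- move=> h _.
  have i1 : mu.-integrable setT (EFin \o (fun xi => cos (h * xi ord0 k + dotp x xi) *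
      (gauss t xi * leray i j xi))).
    apply: integrable_mul_le1 => //; first exact: measurable_cosT.
    by move=> xi; exact: norm_cos_le1.
  have := integrableZl measurableT ((2 * pi) ^- n) i1.
  by apply: eq_integrable.
- by move=> h xi _ _; have [] := df h xi.
- by move=> xi; rewrite mulr_ge0.
- move=> h xi _ _; rewrite p1 normrM ger0_norm// ler_wpM2l//.
  by rewrite normrM normrN ler_piMl// norm_sin_le1.
Qed.

(** With [q = |xi|^2], this expresses the denominator of the Leray symbol through
    Gaussians of the scales [s > sqrt t]. *)
Lemma integral_gauss_tail (t q : R) : 0 < t -> 0 < q ->
  (\int[lam]_(s in `[Num.sqrt t, +oo[) (2 * s * expR (- (s ^+ 2 * q)))%:E
    = (expR (- (t * q)) / q)%:E)%E.
Proof.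
move=> t0 q0.
have st0 : 0 < Num.sqrt t by rewrite sqrtr_gt0.
pose F s := - expR (- (s ^+ 2 * q)) / q.
have dE (s : R) : is_derive s 1 (fun s : R => expR (- (s ^+ 2 * q)))
    (expR (- (s ^+ 2 * q)) * (- (2 * s * q))).
  have d1 : is_derive s 1 (fun s : R => - (s ^+ 2 * q)) (- (2 * s * q)).
    rewrite (_ : (fun s => _) = (- q) \*: ((@idfun R) ^+ 2)); last first.
      by apply/funext => y; rewrite mulrC -mulNr.
    by apply: is_derive_eq; rewrite /GRing.scale/= mulr1; ring.
  exact: is_derive1_comp.
have dF (s : R) : is_derive s 1 F (2 * s * expR (- (s ^+ 2 * q))).
  rewrite (_ : F = (- q^-1) \*: (fun s : R => expR (- (s ^+ 2 * q)))); last first.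
    by apply/funext => y; rewrite /F [RHS]mulNr mulNr mulrC.
  apply: (is_derive_eq (is_deriveZ _ (dE s))); rewrite /GRing.scale/=.
  by field; rewrite gt_eqF.
rewrite (@ge0_continuous_FTC2y _ _ F _ 0).
- by rewrite sub0e /F sqr_sqrtr ?(ltW t0)// mulNr EFinN oppeK.
- move=> s st; rewrite mulr_ge0 ?expR_ge0// mulr_ge0//.
  exact: le_trans st.
- apply: continuous_subspaceT => s.
  apply: cvgM; first by apply: cvgM; [exact: cvg_cst|exact: cvg_id].
  exact: (is_derive_continuous (dE s)).
- apply/cvgrPdist_le => /= e e0; near=> s.
  have s1 : 1 <= s by near: s; apply: nbhs_pinfty_ge; rewrite num_real.
  rewrite sub0r normrN /F mulNr normrN ger0_norm; last first.
    by rewrite divr_ge0 ?expR_ge0// ltW.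
  rewrite expRN -invfM invf_ple ?posrE ?mulr_gt0 ?expR_gt0//.
  rewrite -ler_pdivrMr// (le_trans _ (expR_ge1Dx _))//.
  have : e^-1 / q / q <= s by near: s; apply: nbhs_pinfty_ge; rewrite num_real.
  rewrite ler_pdivrMr// => h.
  have : s * q <= s ^+ 2 * q by rewrite ler_pM2r// expr2 ler_peMl// (le_trans ler01).
  by lra.
- by move=> s _; have [] := dF s.
- by apply: cvg_at_right_filter; apply: is_derive_continuous; exact: dF.
- by move=> s _; rewrite derive1E; have [] := dF s.
Unshelve. all: end_near. Qed.

Lemma measurable_cauchy_term2 :
  measurable_fun setT (fun z : R * V => z.1 ^- (n + 2) * cauchy_prod z.1 z.2).
Proof.
apply: measurable_funM; first by apply: measurable_invT; exact: measurable_funX.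
apply: measurable_prod => l _; apply: measurable_invT; apply: measurable_funD => //.
apply: measurable_funX; apply: measurable_funM; first exact: measurable_coordT.
exact: measurable_invT.
Qed.

Lemma measurable_cauchy_term x :
  measurable_fun setT (fun s : R => s ^- (n + 2) * cauchy_prod s x).
Proof.
rewrite -[X in measurable_fun _ X]/((fun z : R * V => z.1 ^- (n + 2) * cauchy_prod z.1 z.2)
  \o (fun s : R => (s, x))).
by apply: measurableT_comp; [exact: measurable_cauchy_term2|exact: measurable_pair2].
Qed.

(** The bounds of [cubic_gauss_fourier_bound], of order [s^(-n-3)], superposed over
    the scales with the weight [2 s] of [integral_gauss_tail]. *)
Definition oseen_majorant t x : \bar R :=
  (\int[lam]_(s in `]Num.sqrt t, +oo[) (s ^- (n + 2) * cauchy_prod s x)%:E)%E.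

Lemma oseen_majorant_ge0 t x : (0 <= oseen_majorant t x)%E.
Proof.
apply: integral_ge0 => s /=; rewrite in_itv/= andbT => ts.
have s0 : 0 < s by apply: le_lt_trans ts; exact: sqrtr_ge0.
by rewrite lee_fin mulr_ge0 ?cauchy_prod_ge0// invr_ge0 exprn_ge0// ltW.
Qed.

Lemma norm_Rintegral_sum d (X : measurableType d) (m : {measure set X -> \bar R})
    (I : Type) (r : seq I) (f : I -> X -> R) (B : R) :
  (forall a, m.-integrable setT (EFin \o f a)) ->
  (forall a, `|\int[m]_y f a y| <= B) ->
  m.-integrable setT (EFin \o (fun y => \sum_(a <- r) f a y)) /\
  `|\int[m]_y (\sum_(a <- r) f a y)| <= (size r)%:R * B.
Proof.
move=> fi fB; elim: r => [|i0 r [ih1 ih2]].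
  rewrite (_ : (fun y => _) = cst 0); last by apply/funext => y; rewrite big_nil.
  split; first exact: integrable0.
  by rewrite /Rintegral integral0 normr0 mul0r.
rewrite (_ : (fun y => _) = (fun y => f i0 y + \sum_(a <- r) f a y)); last first.
  by apply/funext => y; rewrite big_cons.
split.
  by have := integrableD measurableT (fi i0) ih1; apply: eq_integrable.
rewrite RintegralD// (le_trans (ler_normD _ _))//= -natr1 mulrDl mul1r addrC.
exact: lerD.
Qed.

Let K : R := (2 * osc_max) ^+ n.

(** [- sin] is a cosine with the phase [pi/2], and the numerator of the symbol is a
    combination of cubic monomials. *)
Lemma leray_num_fourier_bound k i j s x : 0 < s ->
  let f xi := - sin (dotp x xi) * (xi ord0 k * leray_num i j xi * gauss (s ^+ 2) xi) in
  mu.-integrable setT (EFin \o f) /\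
  `|\int[mu]_xi f xi| <= (n%:R + 1) * (K * s ^- (n + 3) * cauchy_prod s x).
Proof.
move=> s0 f; set B := K * _ * _.
pose g (a b c : 'I_n) xi := cos (dotp x xi + pi / 2) *
  (xi ord0 a * xi ord0 b * xi ord0 c * expR (- (s ^+ 2 * dotp xi xi))).
have gi a b c : mu.-integrable setT (EFin \o g a b c).
  apply: integrable_mul_le1; last exact: integrable_cubic_gauss.
    by apply: measurable_cosT; apply: measurable_funD => //; exact: measurable_dotp.
  by move=> xi; exact: norm_cos_le1.
have gB a b c : `|\int[mu]_xi g a b c xi| <= B by exact: cubic_gauss_fourier_bound.
have [si sB] := norm_Rintegral_sum (index_enum 'I_n) (fun l => gi k l l) (fun l => gB k l l).
have B0 : 0 <= B.
  by apply: le_trans (gB k k k).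
have szn : size (index_enum 'I_n) = n by rewrite /index_enum -enumT size_enum_ord.
have fE : f = (fun xi => (i == j)%:R * (\sum_(l <- index_enum 'I_n) g k l l xi) - g k i j xi).
  apply/funext => xi; rewrite /f /g cosDpihalf /leray_num /gauss.
  rewrite -[in RHS]big_distrr/= -[in RHS]big_distrl/=.
  have -> : \sum_(l < n) xi ord0 k * xi ord0 l * xi ord0 l = xi ord0 k * dotp xi xi.
    by rewrite /dotp mulr_sumr; apply: eq_bigr => l _; rewrite mulrA.
  by set e := expR _; ring.
have di : mu.-integrable setT (EFin \o (fun xi => (i == j)%:R * (\sum_(l <- index_enum 'I_n) g k l l xi))).
  by have := integrableZl measurableT (i == j)%:R si; apply: eq_integrable.
rewrite fE; split.
  by have := integrableB measurableT di (gi k i j); apply: eq_integrable.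
rewrite RintegralB// RintegralZl// (le_trans (ler_normB _ _))// mulrDl mul1r lerD//.
rewrite normrM -[in leRHS]szn (le_trans _ sB)// ler_piMl//.
by case: (i == j); rewrite ?normr1 ?normr0.
Qed.

Lemma measurable_oseen_integrand k i j (x : V) :
  measurable_fun setT (fun z : V * R => 2 * z.2 *
    (- sin (dotp x z.1) * (z.1 ord0 k * leray_num i j z.1 * gauss (z.2 ^+ 2) z.1))).
Proof.
have m1 : measurable_fun setT (fun z : V * R => dotp x z.1).
  exact: (measurable_dotp (f := fun=> x)).
have m2 : measurable_fun setT (fun z : V * R => dotp z.1 z.1) by exact: measurable_dotp.
have mc (l : 'I_n) : measurable_fun setT (fun z : V * R => z.1 ord0 l) by exact: measurable_coordT.
apply: measurable_funM; first exact: measurable_funM.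
apply: measurable_funM; first by apply: measurable_funN; exact: measurable_sinT.
apply: measurable_funM.
  apply: measurable_funM => //; apply: measurable_funB; last exact: measurable_funM.
  exact: measurable_funM.
apply: (measurableT_comp (@measurable_expR R)); apply: measurable_funN.
by apply: measurable_funM => //; exact: measurable_funX.
Qed.

(** After [integral_gauss_tail] the integrals over frequency and scale are
    exchanged, and the frequency integral is bounded at each scale. The exchange
    is legitimate because the absolute integral over the scales is at most
    [2 |xi_k| e^(-t |xi|^2)]. *)
Lemma oseen_fourier_bound k i j t x : 0 < t ->
  (`| (\int[mu]_xi (- sin (dotp x xi) * (xi ord0 k * gauss t xi * leray i j xi)))%R%:E | <=
    (2 * (n%:R + 1) * K)%:E * oseen_majorant t x)%E.
Proof.
move=> t0.
have st0 : 0 < Num.sqrt t by rewrite sqrtr_gt0.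
pose h (z : V * R) : R := 2 * z.2 *
  (- sin (dotp x z.1) * (z.1 ord0 k * leray_num i j z.1 * gauss (z.2 ^+ 2) z.1)).
have mh : measurable_fun setT h by exact: measurable_oseen_integrand.
pose I : set R := `]Num.sqrt t, +oo[%classic.
have mI : measurable_fun setT (\1_I : R -> R).
  exact: measurable_indic_itv.
pose G (z : V * R) : \bar R := (h z * \1_I z.2)%:E.
have mG : measurable_fun setT G.
  apply/measurable_EFinP; apply: measurable_funM => //.
  rewrite -[X in measurable_fun _ X]/((\1_I : R -> R) \o snd).
  by apply: measurableT_comp.
pose w q s := 2 * s * expR (- (s ^+ 2 * q)) * \1_I s.
have w0 q s : 0 <= w q s.
  rewrite /w indicE; case: (boolP (s \in I)) => [|_]; last by rewrite mulr0.
  rewrite inE /I/= in_itv/= andbT => ss.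
  by rewrite mulr1 mulr_ge0 ?expR_ge0// mulr_ge0// ltW// (lt_trans st0).
have me q : measurable_fun setT (fun s : R => 2 * s * expR (- (s ^+ 2 * q))).
  apply: measurable_funM; first exact: measurable_funM.
  apply: (measurableT_comp (@measurable_expR R)); apply: measurable_funN.
  by apply: measurable_funM.
have mw q : measurable_fun setT (w q) by exact: measurable_funM.
have tail q : 0 < q -> (\int[lam]_s (w q s)%:E = (expR (- (t * q)) / q)%:E)%E.
  move=> q0; rewrite -integral_gauss_tail// -integral_itv_obnd_cbnd; last first.
    by apply: measurable_funTS; apply/measurable_EFinP; exact: me.
  by rewrite [RHS]integral_mul_indic.
pose c xi := - sin (dotp x xi) * (xi ord0 k * leray_num i j xi).
have GE xi s : G (xi, s) = ((c xi)%:E * (w (dotp xi xi) s)%:E)%E.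
  rewrite /G /h /w /c /gauss /= -EFinM; congr EFin.
  by set e := expR _; set o := \1_I _; ring.
have c0 xi : dotp xi xi = 0 -> c xi = 0.
  by move=> q0; rewrite /c (dotp_eq0 k q0) mul0r mulr0.
have q0 xi : dotp xi xi != 0 -> 0 < dotp xi xi by move=> q0; rewrite lt0r q0 dotp_ge0.
pose W xi := - sin (dotp x xi) * (xi ord0 k * gauss t xi * leray i j xi).
have E1 xi : (\int[lam]_s G (xi, s) = (W xi)%:E)%E.
  under eq_integral do rewrite GE.
  have [qq|qq] := eqVneq (dotp xi xi) 0.
    rewrite (c0 _ qq) integral0_eq; last by move=> s _; rewrite mul0e.
    by rewrite /W (dotp_eq0 k qq) !mul0r mulr0.
  rewrite integralZl//; last first.
    apply/integrableP; split; first by apply/measurable_EFinP; exact: mw.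
    under eq_integral do rewrite /= ger0_norm//.
    by rewrite tail ?q0// ltry.
  rewrite tail ?q0// -EFinM; congr EFin; rewrite /W /c leray_numE /gauss.
  by set e := expR _; field.
have E2 xi : (\int[lam]_s `|G (xi, s)| <= 2%:E * (`|xi ord0 k * gauss t xi|)%:E)%E.
  under eq_integral do rewrite GE abseM.
  have [qq|qq] := eqVneq (dotp xi xi) 0.
    rewrite (c0 _ qq) integral0_eq; last by move=> s _; rewrite abse0 mul0e.
    by rewrite -EFinM lee_fin mulr_ge0.
  under eq_integral do rewrite /= (ger0_norm (w0 _ _)).
  rewrite ge0_integralZl_EFin//; last 2 first.
  - by move=> s _; rewrite lee_fin.
  - by apply/measurable_EFinP; exact: mw.
  rewrite tail ?q0// -!EFinM lee_fin /c leray_numE normrM normrN.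
  apply: (@le_trans _ _ (`|xi ord0 k * (leray i j xi * dotp xi xi)| * (expR (- (t * dotp xi xi)) / dotp xi xi))).
    rewrite ler_wpM2r//; first by rewrite divr_ge0 ?expR_ge0 ?dotp_ge0.
    by rewrite ler_piMl// norm_sin_le1.
  rewrite !normrM (ger0_norm (dotp_ge0 xi)) (@ger0_norm _ (gauss t xi)) ?expR_ge0// -/(gauss t xi).
  have -> : `|xi ord0 k| * (`|leray i j xi| * dotp xi xi) * (gauss t xi / dotp xi xi) =
    `|leray i j xi| * (`|xi ord0 k| * gauss t xi) by field.
  by rewrite ler_wpM2r ?norm_leray_le// mulr_ge0// expR_ge0.
have ikg := integrable_coord_gauss k t0.
have iG : (mu \x lam)%E.-integrable setT G.
  have [_ lty] := @integrable12ltyP _ _ _ _ _ mu lam G mG; apply: lty.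
  apply: (@le_lt_trans _ _ (\int[mu]_xi (2%:E * (`|xi ord0 k * gauss t xi|)%:E))%E).
    apply: ge0_le_integral => //.
    - by move=> xi _; apply: integral_ge0.
    - apply: (@measurable_fun_fubini_tonelli_F _ _ _ _ _ lam (abse \o G)).
        exact: measurableT_comp.
      by move=> z; exact: abse_ge0.
    - apply: emeasurable_funM => //; apply/measurable_EFinP; apply: measurableT_comp => //.
      by have /measurable_EFinP := measurable_int _ ikg.
  by have := integrable_lty measurableT (integrableZl measurableT 2 (integrable_norm ikg)).
have iW : mu.-integrable setT (EFin \o W).
  apply: integrable_mul_le1.
  - by apply: measurable_funN; apply: measurable_sinT; exact: measurable_dotp.
  - by move=> xi; rewrite normrN norm_sin_le1.
  - by apply: integrable_mul_le2; [exact: measurable_leray|exact: norm_leray_le|].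
have -> : ((\int[mu]_xi W xi)%R%:E = \int[mu]_xi (W xi)%:E)%E.
  by rewrite /Rintegral fineK//; exact: (integrable_fin_num measurableT iW).
under eq_integral do rewrite -E1.
rewrite (Fubini iG).
apply: (le_trans (le_abse_integral _ measurableT _)).
  exact: (measurable_fubini_G iG).
have C0 : 0 <= 2 * (n%:R + 1) * K.
  by rewrite !mulr_ge0// ?addr_ge0// exprn_ge0// mulr_ge0// sumr_ge0// => l _; exact: osc_const_ge0.
have mP : measurable_fun setT (fun s : R => (s ^- (n + 2) * cauchy_prod s x)%:E).
  by apply/measurable_EFinP; exact: measurable_cauchy_term.
rewrite /oseen_majorant -ge0_integralZl_EFin//; last 2 first.
- move=> s /=; rewrite in_itv/= andbT => ss; rewrite lee_fin mulr_ge0 ?cauchy_prod_ge0//.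
  by rewrite invr_ge0 exprn_ge0// ltW// (lt_trans st0).
- exact: measurable_funTS.
rewrite [leRHS]integral_mul_indic; apply: ge0_le_integral => //.
- by apply: measurableT_comp => //; exact: (measurable_fubini_G iG).
- apply: emeasurable_funM; first exact: emeasurable_funM.
  by apply/measurable_EFinP; exact: mI.
move=> s _; rewrite indicE; case: (boolP (s \in _)) => [|nI]; last first.
  rewrite mule0 integral0_eq ?abse0// => xi _.
  by rewrite /G indicE (negbTE nI) mulr0.
rewrite inE/= in_itv/= andbT mule1 => ss.
have s0 := lt_trans st0 ss.
have [fi fb] := leray_num_fourier_bound k i j x s0.
have -> : (\int[mu]_xi G (xi, s) = (2 * s)%:E * \int[mu]_xi (- sin (dotp x xi) *
    (xi ord0 k * leray_num i j xi * gauss (s ^+ 2) xi))%:E)%E.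
  rewrite -integralZl//; apply: eq_integral => xi _.
  have GI : \1_I s = 1 :> R by rewrite indicE mem_set// /I/= in_itv/= ss.
  by rewrite /G GI mulr1 -EFinM.
have -> : (\int[mu]_xi (- sin (dotp x xi) *
    (xi ord0 k * leray_num i j xi * gauss (s ^+ 2) xi))%:E = (\int[mu]_xi (- sin (dotp x xi) *
    (xi ord0 k * leray_num i j xi * gauss (s ^+ 2) xi)))%R%:E)%E.
  by rewrite /Rintegral fineK//; exact: (integrable_fin_num measurableT fi).
rewrite -!EFinM lee_fin normrM ger0_norm ?mulr_ge0 ?(ltW s0)//.
apply: (le_trans (ler_wpM2l _ fb)); first by rewrite mulr_ge0 ?(ltW s0).
apply: le_of_eq.
have -> : s ^- (n + 2) = s * s ^- (n + 3).
  by rewrite (addnS n 2) exprS invfM mulVKf// gt_eqF.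
by ring.
Qed.

Lemma grad_oseen_bound k i j : exists2 C : R, 0 < C & forall t x, 0 < t ->
  ((`|grad_oseen k i j t x|)%:E <= C%:E * oseen_majorant t x)%E.
Proof.
have c0 : 0 <= (2 * pi) ^- n :> R by rewrite invr_ge0 exprn_ge0// mulr_ge0// pi_ge0.
(* [+ 1] makes the constant positive *)
exists ((2 * pi) ^- n * (2 * (n%:R + 1) * K) + 1).
  have K0 : 0 <= K by rewrite exprn_ge0// mulr_ge0// sumr_ge0// => l _; exact: osc_const_ge0.
  by rewrite ltr_wpDl// mulr_ge0// mulr_ge0// mulr_ge0// ?addr_ge0.
move=> t x t0; rewrite grad_oseenE// /grad_oseen_int.
have iW : mu.-integrable setT (EFin \o
    (fun xi => - sin (dotp x xi) * (xi ord0 k * gauss t xi * leray i j xi))).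
  apply: integrable_mul_le1.
  - by apply: measurable_funN; apply: measurable_sinT; exact: measurable_dotp.
  - by move=> xi; rewrite normrN norm_sin_le1.
  - by apply: integrable_mul_le2; [exact: measurable_leray|exact: norm_leray_le|exact: integrable_coord_gauss].
rewrite RintegralZl// normrM ger0_norm// EFinM.
apply: (@le_trans _ _ (((2 * pi) ^- n)%:E * ((2 * (n%:R + 1) * K)%:E * oseen_majorant t x)))%E.
  by apply: lee_wpmul2l; rewrite ?lee_fin//; exact: oseen_fourier_bound.
rewrite muleA -EFinM; apply: lee_wpmul2r; first exact: oseen_majorant_ge0.
by rewrite lee_fin lerDl.
Qed.

Lemma measurable_Rintegral d1 d2 (X : measurableType d1) (Y : measurableType d2)
    (m : {sigma_finite_measure set Y -> \bar R}) (f : X * Y -> R) :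
  measurable_fun setT f -> measurable_fun setT (fun a => \int[m]_b f (a, b)).
Proof.
move=> mf; have mfE : measurable_fun setT (EFin \o f) by exact/measurable_EFinP.
rewrite /Rintegral; apply: (measurableT_comp (@fine_measurable R setT measurableT)).
pose fp z := maxe (f z)%:E 0%E; pose fm z := maxe (- (f z)%:E)%E 0%E.
have mfp : measurable_fun setT fp by apply: measurable_maxe.
have mfm : measurable_fun setT fm.
  apply: measurable_maxe => //.
  have : measurable_fun setT (EFin \o (fun z => - f z)); last exact.
  by apply/measurable_EFinP; exact: measurable_funN.
rewrite (_ : (fun _ => _) = (fun a => \int[m]_b fp (a, b) - \int[m]_b fm (a, b))%E); last first.
  apply/funext => a; rewrite integralE; congr (_ - _)%E; apply: eq_integral => b _.
    by rewrite funeposE.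
  by rewrite funenegE.
apply: emeasurable_funB.
  apply: (@measurable_fun_fubini_tonelli_F _ _ _ _ _ m fp) => // z.
  by rewrite /fp le_max lexx orbT.
apply: (@measurable_fun_fubini_tonelli_F _ _ _ _ _ m fm) => // z.
by rewrite /fm le_max lexx orbT.
Qed.

Lemma measurable_grad_oseen_int k i j :
  measurable_fun setT (fun z : R * V => grad_oseen_int k i j z.1 z.2).
Proof.
apply: (@measurable_Rintegral _ _ _ _ mu (fun z : (R * V) * V => (2 * pi) ^- n *
  (- sin (dotp z.1.2 z.2) * (z.2 ord0 k * gauss z.1.1 z.2 * leray i j z.2)))).
have m1 : measurable_fun setT (fun z : (R * V) * V => dotp z.1.2 z.2).
  by apply: measurable_dotp => //; exact: (measurableT_comp measurable_snd).
have m2 : measurable_fun setT (fun z : (R * V) * V => dotp z.2 z.2) by exact: measurable_dotp.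
apply: measurable_funM => //; apply: measurable_funM.
  by apply: measurable_funN; exact: measurable_sinT.
apply: measurable_funM; last exact: (measurableT_comp (measurable_leray i j)).
apply: measurable_funM; first exact: measurable_coordT.
apply: (measurableT_comp (@measurable_expR R)); apply: measurable_funN.
by apply: measurable_funM => //; exact: (measurableT_comp measurable_fst).
Qed.

End oseen_gradient.

(** * Convolution estimates in space and time *)

Section convolution_estimates.
Context {R : realType}.
Notation lam := (@lebesgue_measure R).
Local Open Scope ereal_scope.

(** Young's inequality with an integrable kernel. A translate of [E] has the measure
    of [E], so all translates of [F] satisfy the mean bound of [F], and the
    convolution is their average with weight [k]. The group enters through [sub]
    and [add], to cover the line and R^n. *)
Lemma mean_le_conv d (X : measurableType d) (m : {sigma_finite_measure set X -> \bar R})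
    (sub add : X -> X -> X) (kappa : R) (F : X -> \bar R) (k : X -> R) (A : \bar R) :
  measurable_fun setT (fun z : X * X => sub z.1 z.2) ->
  measurable_fun setT (fun z : X * X => add z.1 z.2) ->
  (forall x y, sub x (sub x y) = y) -> (forall w z, sub (add w z) z = w) ->
  (forall c (f : X -> \bar R), measurable_fun setT f -> (forall x, 0 <= f x) ->
     \int[m]_y f (sub c y) = \int[m]_y f y) ->
  (forall c (f : X -> \bar R), measurable_fun setT f -> (forall x, 0 <= f x) ->
     \int[m]_y f (add y c) = \int[m]_y f y) ->
  measurable_fun setT F -> (forall x, 0 <= F x) ->
  measurable_fun setT k -> (forall x, 0 <= k x)%R -> 0 <= A ->
  mean_le m kappa F A ->
  mean_le m kappa (fun x => \int[m]_y (F y * (k (sub x y))%:E)) (\int[m]_z (k z)%:E * A).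
Proof.
move=> msub madd subK addK reflect translate mF F0 mk k0 A0 hF E mE fE.
have mI : measurable_fun setT (\1_E : X -> R) by exact: measurable_indic.
have mkE : measurable_fun setT (EFin \o k) by exact/measurable_EFinP.
have msub1 x : measurable_fun setT (sub x).
  exact: (measurableT_comp msub (measurable_pair1 x)).
have madd1 z : measurable_fun setT (add ^~ z).
  exact: (measurableT_comp madd (measurable_pair2 z)).
pose G (p : X * X) := (F (sub p.1 p.2) * (k p.2)%:E) * (\1_E p.1)%:E.
have mG : measurable_fun setT G.
  apply: emeasurable_funM; last first.
    by apply/measurable_EFinP; apply: (measurableT_comp mI).
  apply: emeasurable_funM; first exact: (measurableT_comp mF).
  by apply/measurable_EFinP; apply: (measurableT_comp mk).
have G0 p : 0 <= G p by rewrite !mule_ge0// lee_fin.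
have -> : \int[m]_(x in E) \int[m]_y (F y * (k (sub x y))%:E) = \int[m]_z \int[m]_x G (x, z).
  rewrite -(@fubini_tonelli _ _ _ _ _ m m G mG G0) integral_mul_indic.
  apply: eq_integral => x _.
  rewrite -ge0_integralZr//; last 2 first.
  - apply: emeasurable_funM => //; apply/measurable_EFinP.
    exact: (measurableT_comp mk (msub1 x)).
  - by move=> y _; rewrite mule_ge0// lee_fin.
  rewrite -[RHS](reflect x); last 2 first.
  - exact: (measurableT_comp mG (measurable_pair1 x)).
  - by move=> y; exact: G0.
  by apply: eq_integral => y _; rewrite /G/= subK.
pose A' := A * ((fine (m E)) `^ kappa)%:E.
have A'0 : 0 <= A' by rewrite mule_ge0// lee_fin powR_ge0.
rewrite -muleA -/A'.
have inner z : \int[m]_x G (x, z) <= (k z)%:E * A'.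
  have -> : \int[m]_x G (x, z) = (k z)%:E * \int[m]_(w in (fun w => add w z) @^-1` E) F w.
    pose g x := F (sub x z) * (\1_E x)%:E.
    have mg : measurable_fun setT g.
      apply: emeasurable_funM; last exact/measurable_EFinP.
      exact: (measurableT_comp mF (measurableT_comp msub (measurable_pair2 z))).
    have g0 x : 0 <= g x by rewrite mule_ge0// lee_fin.
    transitivity (\int[m]_x ((k z)%:E * g x)).
      by apply: eq_integral => x _; rewrite /G/= muleAC muleC.
    rewrite ge0_integralZl_EFin//; congr (_ * _).
    rewrite -(translate z)// [RHS]integral_mul_indic.
    by apply: eq_integral => w _; rewrite /g addK !indicE.
  rewrite lee_wpmul2l ?lee_fin//.
  have mE' : measurable ((fun w => add w z) @^-1` E).
    by rewrite -[X in measurable X]setTI; exact: madd1.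
  have mE'E : m ((fun w => add w z) @^-1` E) = m E.
    have mIB B : measurable B -> m B = \int[m]_x (\1_B x)%:E.
      by move=> mB; rewrite integral_indic// setIT.
    rewrite (mIB _ mE') (mIB _ mE) -[RHS](translate z)//.
    exact/measurable_EFinP.
  apply: (le_trans (hF _ mE' _)); first by rewrite mE'E.
  by rewrite mE'E.
apply: (@le_trans _ _ (\int[m]_z ((k z)%:E * A'))).
  apply: ge0_le_integral => //.
  - by move=> z _; apply: integral_ge0.
  - exact: (@measurable_fun_fubini_tonelli_G _ _ _ _ _ m G).
  - by apply: emeasurable_funM.
rewrite ge0_integralZr//.
by move=> z _; rewrite lee_fin.
Qed.

Lemma integral_cauchy1 (s : R) : (0 < s)%R ->
  \int[lam]_x ((1 + (x / s) ^+ 2)^-1)%:E <= (4 * s)%:E.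
Proof.
move=> s0; pose f (x : R) : R := ((1 + (x / s) ^+ 2)^-1)%R.
have p0 (x : R) : (0 < 1 + (x / s) ^+ 2)%R by rewrite ltr_pwDl// sqr_ge0.
have f0 x : (0 <= f x)%R by rewrite invr_ge0 ltW.
have mf : measurable_fun setT f.
  apply: measurable_invT; apply: measurable_funD => //; apply: measurable_funX.
  exact: measurable_funM.
have mfE : measurable_fun setT (EFin \o f) by exact/measurable_EFinP.
have half : \int[lam]_(x in `]0%R, +oo[) (f x)%:E <= (2 * s)%:E.
  have -> : (2 * s)%:E = s%:E + s%:E by rewrite -EFinD; congr EFin; ring.
  apply: (@le_integral_split R (fun x => (f x)%:E) s) => //.
  - apply: (@le_trans _ _ (\int[lam]_(x in `]0%R, s]) (cst 1%E x))).
      apply: ge0_le_integral.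
      + exact: measurable_itv.
      + by move=> x _; rewrite lee_fin.
      + exact: measurable_funTS.
      + exact: measurable_cst.
      + by move=> x _; rewrite lee_fin /f invf_le1// lerDl sqr_ge0.
    by rewrite integral_cst//= mul1e lebesgue_measure_itv/= lte_fin s0 sube0.
  - apply: (@le_trans _ _ (\int[lam]_(x in `]s, +oo[) ((s ^+ 2)%:E * (x `^ (- 2))%:E))).
      apply: ge0_le_integral.
      + exact: measurable_itv.
      + by move=> x _; rewrite lee_fin.
      + exact: measurable_funTS.
      + apply: measurable_funTS; apply: emeasurable_funM => //.
        exact: measurable_powRE.
      + move=> x /=; rewrite in_itv/= andbT => sx; have x0 := lt_trans s0 sx.
        rewrite -EFinM lee_fin /f powR_invn ?(ltW x0)//.
        rewrite ler_pdivlMr ?exprn_gt0// ler_pdivrMl// expr_div_n.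
        by rewrite mulrDl mul1r divfK ?lerDr ?sqr_ge0// expf_neq0// gt_eqF.
    rewrite ge0_integralZl_EFin//; last 3 first.
    + by move=> x _; rewrite lee_fin powR_ge0.
    + by apply: measurable_funTS; exact: measurable_powRE.
    + exact: sqr_ge0.
    apply: (le_trans (lee_wpmul2l _ (le_integral_powR_tail s0 _))).
    + by rewrite lee_fin sqr_ge0.
    + by rewrite ltr1n.
    rewrite -EFinM lee_fin (_ : (1 - 2 = -1)%R); last by ring.
    rewrite (_ : (2 - 1 = 1)%R); last by ring.
    by rewrite powR_inv1 ?(ltW s0)// divr1 expr2 mulfK// gt_eqF.
have -> : \int[lam]_x (f x)%:E = \int[lam]_(x in `]0%R, +oo[ `|` `]-oo, 0%R]) (f x)%:E.
  congr (integral _ _ _); apply/seteqP; split => x //= _; rewrite !in_itv/= andbT.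
  by case: (ltrP 0%R x) => h; [left|right].
rewrite ge0_integral_setU//; last 3 first.
- exact: measurable_funTS.
- by move=> x _; rewrite lee_fin.
- rewrite disj_set2E; apply/eqP/seteqP; split => // x [] /=.
  by rewrite !in_itv/= andbT => /lt_le_trans h /h; rewrite ltxx.
have -> : (4 * s)%:E = (2 * s)%:E + (2 * s)%:E by rewrite -EFinD; congr EFin; ring.
apply: leeD => //.
have -> : \int[lam]_(x in `]-oo, 0%R]) (f x)%:E = \int[lam]_(x in `]-oo, 0%R]) (f (- x))%:E.
  by apply: eq_integral => x _; rewrite /f mulNr sqrrN.
rewrite -(@ge0_integration_by_substitution0 R (EFin \o f))//.
by rewrite -integral_itv_obnd_cbnd//; exact: measurable_funTS.
Qed.

Lemma ge0_integral_translate1 (c : R) (f : R -> \bar R) :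
  measurable_fun setT f -> (forall x, 0 <= f x) ->
  \int[lam]_y f (y + c)%R = \int[lam]_y f y.
Proof.
move=> mf f0; rewrite -[RHS](ge0_integral_reflect1 c)//.
rewrite -[LHS](ge0_integral_reflect1 0 (f := fun y => f (y + c)%R))//.
  by apply: eq_integral => y _; rewrite sub0r addrC.
by apply: (measurableT_comp mf); exact: measurable_funD.
Qed.

Context {n : nat}.
Notation V := 'rV[R]_n.
Notation mu := (@lebesgue_rV R n).

Lemma integral_cauchy_prod (s : R) : (0 < s)%R ->
  \int[mu]_x (cauchy_prod s x)%:E <= ((4 * s) ^+ n)%:E.
Proof.
move=> s0; apply: (le_trans (@le_integral_prod R n (fun l a => (1 + (a / s) ^+ 2)^-1)%R (fun=> 4 * s)%R _ _ _)).
- move=> l; apply: measurable_invT; apply: measurable_funD => //; apply: measurable_funX.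
  exact: measurable_funM.
- by move=> l x; rewrite invr_ge0 addr_ge0// sqr_ge0.
- by move=> l; exact: integral_cauchy1.
- by rewrite prodr_const card_ord.
Qed.

Lemma measurable_cauchy_prod (s : R) : measurable_fun setT (fun x : V => cauchy_prod s x).
Proof.
apply: measurable_prod => l _; apply: measurable_invT; apply: measurable_funD => //.
by apply: measurable_funX; apply: measurable_funM => //; exact: measurable_coord.
Qed.

(** For [kappa = 1] the function [F] acts as if bounded by [A]. *)
Lemma mean_le1_bound d (X : measurableType d) (m : {sigma_finite_measure set X -> \bar R})
    (F : X -> \bar R) (k : X -> R) (A : \bar R) :
  measurable_fun setT F -> (forall x, 0 <= F x) -> measurable_fun setT k ->
  (forall x, 0 <= k x)%R -> 0 <= A ->
  (forall y, (0 < y)%R -> m [set x | (y < k x)%R] < +oo) ->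
  mean_le m 1 F A -> \int[m]_x (F x * (k x)%:E) <= A * \int[m]_x (k x)%:E.
Proof.
move=> mF F0 mk k0 A0 hk hF.
have -> : \int[m]_x (k x)%:E = \int[m]_x (cst 1 x * (k x)%:E).
  by apply: eq_integral => x _; rewrite mul1e.
rewrite !layer_cake// -ge0_integralZl//; last 2 first.
- by apply: measurable_funTS; exact: measurable_layer.
- by move=> y _; apply: integral_ge0.
apply: ge0_le_integral => //.
- by move=> y _; apply: integral_ge0.
- by apply: measurable_funTS; exact: measurable_layer.
- apply: emeasurable_funM => //.
  by apply: measurable_funTS; exact: measurable_layer.
move=> y /=; rewrite in_itv/= andbT => y0.
have my := measurable_superlevel y mk.
rewrite integral_cst// mul1e; apply: (le_trans (hF _ my (hk _ y0))).
by rewrite powRr1 ?fine_ge0// fineK// ge0_fin_numE// hk.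
Qed.

(** Chebyshev's inequality. *)
Lemma cauchy_prod_superlevel (s y : R) (x : V) : (0 < s)%R -> (0 < y)%R ->
  mu [set z | (y < cauchy_prod s (x - z))%R] <= ((4 * s) ^+ n * y `^ (- 1))%:E.
Proof.
move=> s0 y0; have mP := measurable_cauchy_prod s.
have mPx : measurable_fun setT (fun z : V => cauchy_prod s (x - z)).
  by apply: (measurableT_comp mP); exact: measurable_rVB.
rewrite powR_inv1 ?(ltW y0)//.
have := integral_cauchy_prod s0.
rewrite -(ge0_integral_reflect x)//; last 2 first.
- exact/measurable_EFinP.
- by move=> z; rewrite lee_fin cauchy_prod_ge0.
move=> h; rewrite mulrC EFinM lee_pdivlMl//.
apply: le_trans h; rewrite -integral_cst; last exact: measurable_superlevel.
rewrite integral_mul_indic; apply: ge0_le_integral => //.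
- by move=> z _; rewrite mule_ge0 ?lee_fin// ltW.
- apply: emeasurable_funM => //; apply/measurable_EFinP; apply: measurable_indic.
  exact: measurable_superlevel.
- exact/measurable_EFinP.
- move=> z _; rewrite /= -EFinM lee_fin indicE; case: (boolP (z \in _)) => [|_].
    by rewrite inE/= mulr1 => /ltW.
  by rewrite mulr0 cauchy_prod_ge0.
Qed.

(** For [kappa < 1] this is [mean_le_mul_bounded] with the superlevel sets of
    [cauchy_prod_superlevel]; at [kappa = 1] that integral over the levels
    diverges, and the integral of the kernel takes over. *)
Lemma cauchy_conv_sup (kappa : R) : (0 < kappa <= 1)%R ->
  exists2 C : R, (0 < C)%R & forall (F : V -> \bar R) (A : \bar R) (s : R) x,
  measurable_fun setT F -> (forall x, 0 <= F x) -> 0 <= A -> (0 < s)%R ->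
  mean_le mu kappa F A ->
  \int[mu]_y (F y * (cauchy_prod s (x - y))%:E) <= (C * s `^ (n%:R * kappa))%:E * A.
Proof.
move=> /andP[k0]; rewrite le_eqVlt => /orP[/eqP->|k1].
  exists (4 ^+ n)%R; first by rewrite exprn_gt0.
  move=> F A s x mF F0 A0 s0 hF.
  have mP := measurable_cauchy_prod s.
  have mPx : measurable_fun setT (fun z : V => cauchy_prod s (x - z)).
    by apply: (measurableT_comp mP); exact: measurable_rVB.
  apply: (le_trans (mean_le1_bound mF F0 mPx _ A0 _ hF)).
  - by move=> z; exact: cauchy_prod_ge0.
  - move=> y y0; apply: le_lt_trans (ltry _); exact: cauchy_prod_superlevel.
  rewrite muleC; apply: lee_wpmul2r => //.
  rewrite (@ge0_integral_reflect R n x (fun z => (cauchy_prod s z)%:E)); last 2 first.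
  - exact/measurable_EFinP.
  - by move=> z; rewrite lee_fin cauchy_prod_ge0.
  by rewrite mulr1 powR_mulrn ?(ltW s0)// -exprMn integral_cauchy_prod.
have bk : (1 * kappa < 1)%R by rewrite mul1r.
exists (4 `^ (n%:R * kappa) / (1 - 1 * kappa))%R.
  by rewrite divr_gt0 ?powR_gt0 ?subr_gt0.
move=> F A s x mF F0 A0 s0 hF.
have mP := measurable_cauchy_prod s.
have mPx : measurable_fun setT (fun z : V => cauchy_prod s (x - z)).
  by apply: (measurableT_comp mP); exact: measurable_rVB.
have c0 : (0 < (4 * s) ^+ n)%R by rewrite exprn_gt0// mulr_gt0.
apply: (le_trans (@mean_le_mul_bounded _ _ _ mu kappa 1 ((4 * s) ^+ n) 1 F _ A (ltW k0) bk c0 ltr01 mF F0 mPx _ A0 _ hF)).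
- by move=> z; rewrite cauchy_prod_ge0 cauchy_prod_le1.
- by move=> y y0; exact: cauchy_prod_superlevel.
rewrite powR1 mulr1; apply: le_of_eq; congr (_%:E * _).
rewrite -powR_mulrn ?mulr_ge0 ?(ltW s0)// -powRrM powRM ?(ltW s0)//.
by rewrite mulrAC.
Qed.

(** The convolution satisfies the mean bound of exponent [kappa], by
    [mean_le_conv], and that of exponent 1, by [cauchy_conv_sup]. The geometric
    mean of the two is the bound with the average exponent. *)
Lemma cauchy_conv_mean (kappa : R) : (0 < kappa <= 1)%R ->
  exists2 C : R, (0 < C)%R & forall (F : V -> \bar R) (A s : R),
  measurable_fun setT F -> (forall x, 0 <= F x) -> (0 <= A)%R -> (0 < s)%R ->
  mean_le mu kappa F A%:E ->
  mean_le mu ((1 + kappa) / 2) (fun x => \int[mu]_y (F y * (cauchy_prod s (x - y))%:E))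
    (C * s `^ (n%:R * ((1 + kappa) / 2)) * A)%:E.
Proof.
move=> kk; have [C C0 hC] := cauchy_conv_sup kk.
have c40 : (0 < 4 ^+ n :> R)%R by rewrite exprn_gt0.
exists (Num.sqrt (4 ^+ n * C)); first by rewrite sqrtr_gt0 mulr_gt0.
move=> F A s mF F0 A0 s0 hF E mE fE.
have mP := measurable_cauchy_prod s.
set e := fine (mu E).
have e0 : (0 <= e)%R by rewrite fine_ge0.
have eE : mu E = e%:E by rewrite fineK// ge0_fin_numE.
set I := \int[mu]_(x in E) _.
have I0 : 0 <= I.
  apply: integral_ge0 => x _; apply: integral_ge0 => y _.
  by rewrite mule_ge0// lee_fin cauchy_prod_ge0.
have mconv : measurable_fun setT (fun x : V => \int[mu]_y (F y * (cauchy_prod s (x - y))%:E)).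
  apply: (@measurable_fun_fubini_tonelli_F _ _ _ _ _ mu
      (fun z : V * V => F z.2 * (cauchy_prod s (z.1 - z.2))%:E)).
    apply: emeasurable_funM; first exact: (measurableT_comp mF).
    apply/measurable_EFinP; apply: (measurableT_comp mP); exact: measurable_rVB.
  by move=> z; rewrite mule_ge0// lee_fin cauchy_prod_ge0.
have h1 : I <= ((4 * s) ^+ n * A * e `^ kappa)%:E.
  have := @mean_le_conv _ V mu (fun x y => x - y)%R (fun x y => x + y)%R kappa F (cauchy_prod s) A%:E
    (measurable_rVB measurable_fst measurable_snd) (measurable_rVD measurable_fst measurable_snd)
    (fun x y => subKr x y) (fun w z => addrK z w)
    (fun c f mf f0 => ge0_integral_reflect c mf f0) (fun c f mf f0 => ge0_integral_translate c mf f0)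
    mF F0 mP (fun x => cauchy_prod_ge0 s x) A0 hF E mE fE.
  move=> /le_trans; apply; rewrite -/e !EFinM; apply: lee_wpmul2r.
    by rewrite lee_fin powR_ge0.
  by apply: lee_wpmul2r => //; exact: integral_cauchy_prod.
have h2 : I <= (C * s `^ (n%:R * kappa) * A * e)%:E.
  apply: (@le_trans _ _ (\int[mu]_(x in E) cst (C * s `^ (n%:R * kappa) * A)%:E x)).
    apply: ge0_le_integral => //.
    - move=> x _; apply: integral_ge0 => y _.
      by rewrite mule_ge0// lee_fin cauchy_prod_ge0.
    - exact: measurable_funTS.
    - by move=> x _ /=; rewrite EFinM; exact: hC.
  have -> : \int[mu]_(x in E) cst (C * s `^ (n%:R * kappa) * A)%:E x =
      (C * s `^ (n%:R * kappa) * A)%:E * mu E by exact: integral_cst.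
  by rewrite eE -EFinM.
have Ifin : I \is a fin_num by rewrite ge0_fin_numE// (le_lt_trans h1)// ltry.
rewrite -EFinM -(fineK Ifin) lee_fin.
rewrite -(fineK Ifin) !lee_fin in h1 h2 I0.
set r := fine I in h1 h2 I0 *.
have b0 : (0 <= Num.sqrt (4 ^+ n * C) * s `^ (n%:R * ((1 + kappa) / 2)) * A * e `^ ((1 + kappa) / 2))%R.
  by rewrite !mulr_ge0// powR_ge0.
rewrite -(@ler_pXn2r _ 2)//.
have -> : ((Num.sqrt (4 ^+ n * C) * s `^ (n%:R * ((1 + kappa) / 2)) * A * e `^ ((1 + kappa) / 2)) ^+ 2 =
   ((4 * s) ^+ n * A * e `^ kappa) * (C * s `^ (n%:R * kappa) * A * e))%R.
  have hs : ((s `^ (n%:R * ((1 + kappa) / 2))) ^+ 2 = s ^+ n * s `^ (n%:R * kappa))%R.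
    rewrite -powR_mulrn ?powR_ge0// -powRrM -powR_mulrn ?(ltW s0)// -powRD ?(gt_eqF s0) ?implybT//.
    by congr (_ `^ _)%R; field.
  have he : ((e `^ ((1 + kappa) / 2)) ^+ 2 = e * e `^ kappa)%R.
    have kp : (0 < 1 + kappa)%R by case/andP : kk => k0 _; rewrite addr_gt0.
    rewrite -powR_mulrn ?powR_ge0// -powRrM.
    have -> : ((1 + kappa) / 2 * 2%:R = 1 + kappa)%R by field.
    by rewrite -(mulr_powRB1 e0 kp) addrAC subrr add0r.
  rewrite !exprMn sqr_sqrtr; last by rewrite ltW// mulr_gt0.
  by rewrite hs he; ring.
by rewrite expr2; apply: ler_pM.
Qed.

Lemma measurable_oseen_majorant :
  measurable_fun setT (fun z : R * V => oseen_majorant z.1 z.2).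
Proof.
pose S := [set p : (R * V) * R | (0 < p.2 - Num.sqrt p.1.1)%R].
have mS : measurable S.
  apply: measurable_superlevel; apply: measurable_funB => //.
  apply: (@measurableT_comp _ _ _ _ _ _ (@Num.sqrt R)).
    by apply: continuous_measurable_fun; exact: sqrt_continuous.
  exact: (measurableT_comp measurable_fst measurable_fst).
pose G (p : (R * V) * R) := (p.2 ^- (n + 2) * cauchy_prod p.2 p.1.2 * \1_S p)%:E.
have mc : measurable_fun setT ((fun z : R * V => z.1 ^- (n + 2) * cauchy_prod z.1 z.2)%R \o
    (fun p : (R * V) * R => (p.2, p.1.2))).
  apply: measurableT_comp; first exact: measurable_cauchy_term2.
  apply/measurable_fun_pairP; split; first exact: measurable_snd.
  exact: (measurableT_comp measurable_snd measurable_fst).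
have mG : measurable_fun setT G.
  by apply/measurable_EFinP; apply: measurable_funM; [exact: mc|exact: measurable_indic].
rewrite (_ : (fun z => _) = fun z => \int[lam]_s G (z, s)); last first.
  apply/funext => z; rewrite /oseen_majorant integral_mul_indic.
  apply: eq_integral => s _; rewrite -EFinM; congr (_ * _)%:E.
  rewrite !indicE; congr (nat_of_bool _)%:R.
  by apply/idP/idP => /set_mem h; apply/mem_set; move: h; rewrite /S /= in_itv/= andbT subr_gt0.
apply: (@measurable_fun_fubini_tonelli_F _ _ _ _ _ lam G mG).
move=> p; rewrite /G lee_fin indicE; case: (boolP (p \in S)) => [/set_mem|_]; last by rewrite mulr0.
rewrite /S/= subr_gt0 => ps; have s0 : (0 < p.2)%R by apply: le_lt_trans ps; exact: sqrtr_ge0.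
by rewrite mulr1 mulr_ge0 ?cauchy_prod_ge0// invr_ge0 exprn_ge0// ltW.
Qed.

(** The smoothing L^(r/2) to L^r, with [rho = 1/r], of the gradient of the heat
    flow: the bounds of [cauchy_conv_mean] at [kappa = 1 - 2 rho] are of order
    [s^(-(2 + n rho))] after weighting, and are integrated over [s > sqrt t]. *)
Lemma oseen_conv_mean (rho : R) : (0 <= rho < 2^-1)%R ->
  exists2 C : R, (0 < C)%R & forall (F : V -> \bar R) (A : \bar R) (t : R),
  measurable_fun setT F -> (forall x, 0 <= F x) -> 0 <= A -> (0 < t)%R ->
  mean_le mu (1 - 2 * rho) F A ->
  mean_le mu (1 - rho) (fun x => \int[mu]_y (F y * oseen_majorant t (x - y)))
    ((C * t `^ (- ((1 + n%:R * rho) / 2)))%:E * A).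
Proof.
move=> /andP[r0 r1].
have kk : (0 < 1 - 2 * rho <= 1)%R by apply/andP; split; lra.
have [C C0 hC] := cauchy_conv_mean kk.
have kE : ((1 + (1 - 2 * rho)) / 2 = 1 - rho)%R by field.
rewrite kE in hC.
have nr0 : (0 < 1 + n%:R * rho)%R by rewrite ltr_wpDr// mulr_ge0.
have Cn0 : (0 < C / (1 + n%:R * rho))%R by rewrite divr_gt0.
exists (C / (1 + n%:R * rho))%R => // F A t mF F0 A0 t0 hF E mE fE.
have P0 : (0 < C / (1 + n%:R * rho) * t `^ (- ((1 + n%:R * rho) / 2)))%R.
  by rewrite mulr_gt0// powR_gt0.
have st0 : (0 < Num.sqrt t)%R by rewrite sqrtr_gt0.
have mI : measurable_fun setT (\1_E : V -> R) by exact: measurable_indic.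
pose J : set R := `]Num.sqrt t, +oo[%classic.
have mJ : measurable_fun setT (\1_J : R -> R).
  exact: measurable_indic_itv.
pose c (s : R) : R := (s ^- (n + 2) * \1_J s)%R.
have c0 s : (0 <= c s)%R.
  rewrite /c indicE; case: (boolP (s \in J)) => [|_]; last by rewrite mulr0.
  rewrite inE /J/= in_itv/= andbT => ss.
  by rewrite mulr1 invr_ge0 exprn_ge0// ltW// (lt_trans st0).
have mc : measurable_fun setT c.
  by apply: measurable_funM => //; apply: measurable_invT; exact: measurable_funX.
have mP2 : measurable_fun setT (fun z : R * V => cauchy_prod z.1 z.2).
  apply: measurable_prod => l _; apply: measurable_invT; apply: measurable_funD => //.
  apply: measurable_funX; apply: measurable_funM; first exact: measurable_coordT.
  exact: measurable_invT.
have majE (x : V) : oseen_majorant t x = \int[lam]_s ((c s)%:E * (cauchy_prod s x)%:E).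
  rewrite /oseen_majorant integral_mul_indic; apply: eq_integral => s _.
  by rewrite -!EFinM /c; congr EFin; ring.
have mg : measurable_fun setT (fun z : R * V => (c z.1)%:E * (cauchy_prod z.1 z.2)%:E).
  apply: emeasurable_funM; apply/measurable_EFinP => //.
  exact: (measurableT_comp mc).
have maj_meas : measurable_fun setT (fun x : V => oseen_majorant t x).
  exact: (measurableT_comp measurable_oseen_majorant (measurable_pair1 t)).
have maj0 (x : V) : 0 <= oseen_majorant t x by exact: oseen_majorant_ge0.
have mB : measurable_fun setT (fun z : V * V => z.1 - z.2)%R by exact: measurable_rVB.
have mconv : measurable_fun setT (fun x : V => \int[mu]_y (F y * oseen_majorant t (x - y))).
  apply: (@measurable_fun_fubini_tonelli_F _ _ _ _ _ mu
      (fun z : V * V => F z.2 * oseen_majorant t (z.1 - z.2))).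
    apply: emeasurable_funM; first exact: (measurableT_comp mF).
    exact: (measurableT_comp maj_meas mB).
  by move=> z; rewrite mule_ge0.
have [e00|en0] := eqVneq (mu E) 0.
  rewrite (_ : \int[mu]_(x in E) _ = 0).
    by rewrite !mule_ge0// lee_fin ?powR_ge0// ltW.
  by apply: null_set_integral => //; exact: measurable_funTS.
case: A A0 hF => [A| |//] A0 hF; last first.
  rewrite gt0_muley ?lte_fin//.
  by rewrite gt0_mulye ?leey// lte_fin powR_gt0// fine_gt0// fE andbT lt0e en0 measure_ge0.
rewrite lee_fin in A0.
(* exchange the integral over the scale with the spatial ones *)
pose conv s (x : V) := \int[mu]_y (F y * (cauchy_prod s (x - y))%:E).
have conv0 s x : 0 <= conv s x.
  by apply: integral_ge0 => y _; rewrite mule_ge0// lee_fin cauchy_prod_ge0.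
have mtriple : measurable_fun setT (fun z : (V * R) * V => F z.2 * (cauchy_prod z.1.2 (z.1.1 - z.2))%:E).
  apply: emeasurable_funM; first exact: (measurableT_comp mF).
  apply/measurable_EFinP.
  apply: (measurableT_comp mP2 (g := fun z : (V * R) * V => (z.1.2, z.1.1 - z.2)%R)).
  apply/measurable_fun_pairP; split; first exact: (measurableT_comp measurable_snd).
  by apply: measurable_rVB => //; exact: (measurableT_comp measurable_fst).
have mconv2 : measurable_fun setT (fun z : V * R => conv z.2 z.1).
  apply: (@measurable_fun_fubini_tonelli_F _ _ _ _ _ mu _ mtriple).
  by move=> z; rewrite mule_ge0// lee_fin cauchy_prod_ge0.
have swap1 (x : V) : \int[mu]_y (F y * oseen_majorant t (x - y)) = \int[lam]_s ((c s)%:E * conv s x).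
  pose H (z : V * R) := F z.1 * ((c z.2)%:E * (cauchy_prod z.2 (x - z.1))%:E).
  have mH : measurable_fun setT H.
    apply: emeasurable_funM; first exact: (measurableT_comp mF).
    apply: (measurableT_comp mg (g := fun z : V * R => (z.2, x - z.1)%R)).
    apply/measurable_fun_pairP; split; first exact: measurable_snd.
    exact: (measurable_rVB (measurable_cst x) measurable_fst).
  have H0 z : 0 <= H z.
    by rewrite mule_ge0// -EFinM lee_fin mulr_ge0// cauchy_prod_ge0.
  transitivity (\int[mu]_y \int[lam]_s H (y, s)).
    apply: eq_integral => y _; rewrite majE /H/= ge0_integralZl//.
    - exact: (measurableT_comp mg (measurable_pair2 (x - y)%R)).
    - by move=> s _; rewrite -EFinM lee_fin mulr_ge0// cauchy_prod_ge0.
  rewrite (@fubini_tonelli _ _ _ _ _ mu lam H mH H0).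
  apply: eq_integral => s _; rewrite /H /conv.
  transitivity (\int[mu]_y ((c s)%:E * (F y * (cauchy_prod s (x - y))%:E))).
    by apply: eq_integral => y _; rewrite /= muleCA.
  rewrite ge0_integralZl_EFin//.
  - by move=> y _; rewrite mule_ge0// lee_fin cauchy_prod_ge0.
  - exact: (measurableT_comp mtriple (measurable_pair1 (x, s))).
have -> : \int[mu]_(x in E) \int[mu]_y (F y * oseen_majorant t (x - y)) =
    \int[lam]_s ((c s)%:E * \int[mu]_(x in E) conv s x).
  pose H (z : V * R) := (c z.2)%:E * conv z.2 z.1.
  have mH : measurable_fun setT H.
    by apply: emeasurable_funM => //; apply/measurable_EFinP; exact: (measurableT_comp mc).
  have H0 z : 0 <= H z by rewrite mule_ge0// lee_fin.
  under eq_integral do rewrite swap1.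
  rewrite (@ge0_integral_exchange _ _ _ mu _ _ lam H _ _ mE measurableT mH H0); apply: eq_integral => s _.
  rewrite /H/= ge0_integralZl_EFin//.
  by apply: measurable_funTS; exact: (measurableT_comp mconv2 (measurable_pair2 s)).
set e := fine (mu E).
pose B : R := (C * A * e `^ (1 - rho))%R.
have B0 : (0 <= B)%R by rewrite !mulr_ge0 ?powR_ge0// ltW.
apply: (@le_trans _ _ (\int[lam]_(s in `]Num.sqrt t, +oo[) (B%:E * (s `^ (- (2 + n%:R * rho)))%:E))).
  rewrite [leRHS]integral_mul_indic; apply: ge0_le_integral.
  - exact: measurableT.
  - by move=> s _; rewrite mule_ge0 ?lee_fin// integral_ge0.
  - apply: emeasurable_funM; first exact/measurable_EFinP.
    rewrite (_ : (fun s => _) = (fun s => \int[mu]_x (conv s x * (\1_E x)%:E))); last first.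
      by apply/funext => s; rewrite integral_mul_indic.
    apply: (@measurable_fun_fubini_tonelli_G _ _ _ _ _ mu (fun z : V * R => conv z.2 z.1 * (\1_E z.1)%:E)).
      by apply: emeasurable_funM => //; apply/measurable_EFinP; exact: (measurableT_comp mI).
    by move=> z; rewrite mule_ge0// lee_fin.
  - apply: emeasurable_funM; last exact/measurable_EFinP.
    by apply: emeasurable_funM => //; exact: measurable_powRE.
  - move=> s _; rewrite /c indicE; case: (boolP (s \in J)) => [|_]; last first.
      by rewrite mulr0 mul0e mule0.
    rewrite inE /J/= in_itv/= andbT => ss; have s0 := lt_trans st0 ss.
    rewrite mulr1 mule1.
    apply: (le_trans (lee_wpmul2l _ (hC F A s mF F0 A0 s0 hF E mE fE))).
      by rewrite lee_fin invr_ge0 exprn_ge0// ltW.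
    rewrite -/e -!EFinM lee_fin; apply: le_of_eq.
    have -> : (s `^ (- (2 + n%:R * rho)) = s ^- (n + 2) * s `^ (n%:R * (1 - rho)))%R.
      rewrite -powR_invn ?(ltW s0)// -powRD ?(gt_eqF s0) ?implybT//.
      by congr (_ `^ _)%R; rewrite natrD; ring.
    by rewrite /B; ring.
rewrite ge0_integralZl_EFin//; last 2 first.
- by move=> s _; rewrite lee_fin powR_ge0.
- by apply: measurable_funTS; exact: measurable_powRE.
have q1 : (1 < 2 + n%:R * rho)%R by rewrite ltr_wpDr ?ltr1n// mulr_ge0.
apply: (le_trans (lee_wpmul2l _ (le_integral_powR_tail st0 q1))) => //.
rewrite -!EFinM lee_fin; apply: le_of_eq.
have -> : ((Num.sqrt t) `^ (1 - (2 + n%:R * rho)) = t `^ (- ((1 + n%:R * rho) / 2)))%R.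
  rewrite -powR12_sqrt ?(ltW t0)// -powRrM; congr (_ `^ _)%R; by field.
rewrite /B (_ : (2 + n%:R * rho - 1 = 1 + n%:R * rho)%R); last by ring.
by ring.
Qed.

(** The kernel of fractional integration of order [theta]. *)
Definition time_kernel (theta r : R) : R := (r `^ (theta - 1) * \1_(`]0%R, +oo[) r)%R.

Lemma time_kernel_ge0 theta r : (0 <= time_kernel theta r)%R.
Proof. by rewrite mulr_ge0// powR_ge0. Qed.

Lemma measurable_time_kernel theta : measurable_fun setT (time_kernel theta).
Proof.
apply: measurable_funM; first exact: measurable_powR.
exact: measurable_indic_itv.
Qed.

Lemma measurable_time_conv (q : R -> \bar R) (k : R -> R) :
  measurable_fun setT q -> (forall s, 0 <= q s) ->
  measurable_fun setT k -> (forall r, 0 <= k r)%R ->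
  measurable_fun setT (fun t : R => \int[lam]_s (q s * (k (t - s))%:E)).
Proof.
move=> mq q0 mk k0.
apply: (@measurable_fun_fubini_tonelli_F _ _ _ _ _ lam
    (fun z : R * R => q z.2 * (k (z.1 - z.2)%R)%:E)).
  apply: emeasurable_funM; first exact: (measurableT_comp mq).
  apply/measurable_EFinP; apply: (measurableT_comp mk); exact: measurable_funB.
by move=> z; rewrite mule_ge0// lee_fin.
Qed.

(** The Hardy-Littlewood-Sobolev inequality L^(alpha/2) to L^alpha, with
    [theta = 1/alpha]. The kernel is split at [r = |E|]. The near part has integral
    [|E|^theta / theta] and preserves the mean bound of [q]; the far part maps [q]
    to a function bounded by a multiple of [A |E|^(-theta)]. Both contribute a
    multiple of [A |E|^(1 - theta)] to the integral over [E]. *)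
Lemma time_conv_mean (theta : R) : (0 < theta < 2^-1)%R ->
  exists2 C : R, (0 < C)%R & forall (q : R -> \bar R) (A : \bar R),
  measurable_fun setT q -> (forall s, 0 <= q s) -> 0 <= A ->
  mean_le lam (1 - 2 * theta) q A ->
  mean_le lam (1 - theta) (fun t => \int[lam]_s (q s * (time_kernel theta (t - s))%:E))
    (C%:E * A).
Proof.
move=> /andP[th0 th1].
have th1' : (0 < 1 - theta)%R by lra.
have C0 : (0 < theta^-1 + (1 - theta) / theta)%R.
  by rewrite addr_gt0 ?invr_gt0// divr_gt0.
exists (theta^-1 + (1 - theta) / theta)%R => // q A mq q0 A0 hq E mE fE.
have mpow : measurable_fun setT (fun r : R => r `^ (theta - 1))%R by exact: measurable_powR.
have conv_meas k mk k0 := @measurable_time_conv q k mq q0 mk k0.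
have mK := measurable_time_kernel theta.
have [e00|en0] := eqVneq (lam E) 0.
  rewrite (_ : \int[lam]_(x in E) _ = 0).
    by rewrite !mule_ge0// lee_fin ?powR_ge0// ltW.
  apply: null_set_integral => //; apply: measurable_funTS; apply: conv_meas => //.
  exact: time_kernel_ge0.
set e := fine (lam E).
have e0 : (0 < e)%R by rewrite fine_gt0// fE andbT lt0e en0 measure_ge0.
have eE : lam E = e%:E by rewrite fineK// ge0_fin_numE.
pose near r : R := (r `^ (theta - 1) * \1_(`]0%R, e]) r)%R.
pose far r : R := (r `^ (theta - 1) * \1_(`]e, +oo[) r)%R.
have near0 r : (0 <= near r)%R by rewrite mulr_ge0// powR_ge0.
have far0 r : (0 <= far r)%R by rewrite mulr_ge0// powR_ge0.
have mnear : measurable_fun setT near.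
  by apply: measurable_funM => //; exact: measurable_indic_itv.
have mfar : measurable_fun setT far.
  by apply: measurable_funM => //; exact: measurable_indic_itv.
have KE r : time_kernel theta r = (near r + far r)%R.
  rewrite /time_kernel /near /far -mulrDr !indicE; congr (_ * _)%R.
  rewrite !mem_setE !in_itv/= !andbT.
  by case: (ltrP 0%R r) => r0; case: (lerP r e) => re; rewrite ?addr0 ?add0r//; lra.
have mB c : measurable_fun setT (fun s : R => c - s)%R by exact: measurable_funB.
have mqk (k : R -> R) c : measurable_fun setT k ->
    measurable_fun setT (fun s : R => q s * (k (c - s)%R)%:E).
  move=> mk; apply: emeasurable_funM => //; apply/measurable_EFinP.
  exact: (measurableT_comp mk (mB c)).
have -> : \int[lam]_(t in E) \int[lam]_s (q s * (time_kernel theta (t - s))%:E) =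
   \int[lam]_(t in E) \int[lam]_s (q s * (near (t - s)%R)%:E) +
   \int[lam]_(t in E) \int[lam]_s (q s * (far (t - s)%R)%:E).
  rewrite -ge0_integralD//; last 4 first.
  - by move=> t _; apply: integral_ge0 => s _; rewrite mule_ge0 ?lee_fin.
  - by apply: measurable_funTS; exact: conv_meas.
  - by move=> t _; apply: integral_ge0 => s _; rewrite mule_ge0 ?lee_fin.
  - by apply: measurable_funTS; exact: conv_meas.
  apply: eq_integral => t _; rewrite -ge0_integralD//; last 4 first.
  - by move=> s _; rewrite mule_ge0 ?lee_fin.
  - exact: mqk.
  - by move=> s _; rewrite mule_ge0 ?lee_fin.
  - exact: mqk.
  by apply: eq_integral => s _; rewrite KE EFinD ge0_muleDr// lee_fin.
rewrite EFinD ge0_muleDl; last 2 first.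
- by rewrite lee_fin invr_ge0 ltW.
- by rewrite lee_fin ltW// divr_gt0.
rewrite ge0_muleDl; last 2 first.
- by rewrite mule_ge0// lee_fin invr_ge0 ltW.
- by rewrite mule_ge0// lee_fin ltW// divr_gt0.
apply: leeD.
  have := @mean_le_conv _ _ lam (fun x y => x - y)%R (fun x y => x + y)%R (1 - 2 * theta) q near A
    (measurable_funB measurable_fst measurable_snd) (measurable_funD measurable_fst measurable_snd)
    (fun x y => subKr x y) (fun w z => addrK z w)
    (fun c f mf f0 => ge0_integral_reflect1 c mf f0) (fun c f mf f0 => ge0_integral_translate1 c mf f0)
    mq q0 mnear near0 A0 hq E mE fE.
  move=> /le_trans; apply; rewrite -/e.
  have near_int : \int[lam]_z (near z)%:E <= (e `^ theta / theta)%:E.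
    have q1 : (1 - theta < 1)%R by lra.
    have := le_integral_powR_zero e0 q1.
    rewrite integral_mul_indic (_ : 1 - (1 - theta) = theta)%R; last by ring.
    by rewrite opprB.
  apply: (@le_trans _ _ ((e `^ theta / theta)%:E * A * (e `^ (1 - 2 * theta))%:E)).
    by apply: lee_wpmul2r; [rewrite lee_fin powR_ge0|apply: lee_wpmul2r].
  rewrite (_ : (e `^ (1 - theta) = e `^ theta * e `^ (1 - 2 * theta))%R); last first.
    by rewrite -powRD ?(gt_eqF e0) ?implybT//; congr (_ `^ _)%R; ring.
  rewrite [leLHS]muleAC [leRHS]muleAC -!EFinM; apply: le_of_eq.
  by congr (_%:E * _); ring.
have sup t : \int[lam]_s (q s * (far (t - s)%R)%:E) <= ((1 - theta) / theta * e `^ (- theta))%:E * A.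
  have bk : ((1 - theta)^-1 * (1 - 2 * theta) < 1)%R by rewrite ltr_pdivrMl// mulr1; lra.
  have M0 : (0 < e `^ (theta - 1))%R by rewrite powR_gt0.
  have k0 : (0 <= 1 - 2 * theta)%R by lra.
  have mft : measurable_fun setT (fun s : R => far (t - s)%R) by exact: (measurableT_comp mfar (mB t)).
  apply: (le_trans (@mean_le_mul_bounded _ _ _ lam (1 - 2 * theta) (1 - theta)^-1 1 (e `^ (theta - 1)) q _ A k0 bk ltr01 M0 mq q0 mft _ A0 _ hq)).
  - move=> s; rewrite far0 /far indicE mem_setE in_itv/= andbT; case: ltP => es.
      rewrite mulr1.
      have -> : (theta - 1 = - (1 - theta))%R by ring.
      rewrite !powRN lef_pV2 ?posrE ?powR_gt0// ?(lt_trans e0)//.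
      by rewrite ge0_ler_powR ?nnegrE ?ltW// (lt_trans e0).
    by rewrite mulr0 powR_ge0.
  - move=> y y0; rewrite mul1r.
    apply: (@le_trans _ _ (lam `](t - y `^ (- (1 - theta)^-1))%R, t[%classic)).
      apply: le_measure; rewrite ?inE.
      + exact: measurable_superlevel.
      + exact: measurable_itv.
      move=> s /=; rewrite in_itv/= /far indicE mem_setE in_itv/= andbT.
      case: (ltP e (t - s)%R) => es; last by rewrite mulr0 => /lt_trans => /(_ _ y0); rewrite ltxx.
      rewrite mulr1 => ys; have ts0 := lt_trans e0 es.
      rewrite -[X in _ && X]subr_gt0 ts0 andbT ltrBlDr -ltrBlDl ltNge; apply/negP => h.
      move: ys; rewrite ltNge => /negP; apply.
      have -> : (theta - 1 = - (1 - theta))%R by ring.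
      rewrite powRN -[leRHS]invrK lef_pV2 ?posrE ?powR_gt0 ?invr_gt0//.
      have -> : (y^-1 = (y `^ (- (1 - theta)^-1)) `^ (1 - theta))%R.
        by rewrite -powRrM mulNr mulVf ?(gt_eqF th1')// powR_inv1 // ltW.
      by rewrite ge0_ler_powR ?nnegrE ?powR_ge0// ltW.
    rewrite lebesgue_measure_itv/= lte_fin ltrBlDr ltrDl powR_gt0// -EFinB lee_fin.
    by rewrite opprB addrC subrK.
  rewrite powR1 mul1r -powRrM; apply: le_of_eq; congr (_%:E * _).
  have -> : (1 - (1 - theta)^-1 * (1 - 2 * theta) = theta / (1 - theta))%R.
    by field; rewrite gt_eqF.
  have -> : ((theta - 1) * (theta / (1 - theta)) = - theta)%R.
    by field; rewrite gt_eqF.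
  by field; rewrite !gt_eqF.
apply: (@le_trans _ _ (\int[lam]_(x in E) cst (((1 - theta) / theta * e `^ (- theta))%:E * A) x)).
  apply: ge0_le_integral.
  - exact: mE.
  - by move=> t _; apply: integral_ge0 => s _; rewrite mule_ge0 ?lee_fin.
  - by apply: measurable_funTS; exact: conv_meas.
  - exact: measurable_cst.
  - by move=> t _; exact: sup.
have -> : \int[lam]_(x in E) cst (((1 - theta) / theta * e `^ (- theta))%:E * A) x =
      ((1 - theta) / theta * e `^ (- theta))%:E * A * lam E by exact: integral_cst.
rewrite eE [leLHS]muleAC [leRHS]muleAC -!EFinM.
have -> : (e `^ (1 - theta) = e `^ (- theta) * e)%R.
  by rewrite -(mulr_powRB1 (ltW e0) th1') addrAC subrr add0r mulrC.
by rewrite mulrA.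
Qed.

End convolution_estimates.

(** * Null sets and Borel versions *)

Section null_sets.
Context d (X : measurableType d) (R : realType) (m : {measure set X -> \bar R}).
Local Open Scope ereal_scope.
Import HBNNSimple.
Implicit Types (D N : set X) (f g : X -> \bar R).

(** The integral is a supremum over the simple functions below the integrand, hence
    monotone on arbitrary functions. *)
Lemma ge0_le_integral_any D f g : (forall x, D x -> 0 <= f x) ->
  (forall x, D x -> f x <= g x) ->
  \int[m]_(x in D) f x <= \int[m]_(x in D) g x.
Proof.
move=> f0 fg.
rewrite !ge0_integralE//; last by move=> x Dx; apply: le_trans (fg _ Dx); exact: f0.
apply: ereal_sup_le => _ [h hf <-]; exists h => // x.
apply: (le_trans (hf x)); rewrite !patchE; case: ifPn => //; rewrite inE; exact: fg.
Qed.

(** A simple function below [f] becomes one below [g] of the same integral when it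
    is set to 0 on [N]. *)
Lemma ge0_le_integral_off_null D N f g : measurable N -> m N = 0 ->
  (forall x, D x -> 0 <= f x) -> (forall x, D x -> 0 <= g x) ->
  (forall x, D x -> ~ N x -> f x = g x) ->
  \int[m]_(x in D) f x <= \int[m]_(x in D) g x.
Proof.
move=> mN N0 f0 g0 fg; rewrite !ge0_integralE//; apply: ge_ereal_sup => _ [h hf <-].
apply: ereal_sup_ubound; exists (proj_nnsfun h (measurableC mN)).
  move=> x; have -> : proj_nnsfun h (measurableC mN) x = (h x * \1_(~` N) x)%R by [].
  rewrite indicE in_setC; case: (boolP (x \in N)) => xN /=.
    by rewrite mulr0 patchE; case: ifPn => // /set_mem /g0.
  rewrite mulr1; apply: (le_trans (hf x)); rewrite !patchE; case: ifPn => //.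
  by rewrite inE => Dx; rewrite fg//; rewrite notin_setE in xN.
rewrite -!integralT_nnsfun; apply: ge0_ae_eq_integral.
- exact: measurableT.
- exact/measurable_EFinP.
- exact/measurable_EFinP.
- by move=> x _; rewrite lee_fin.
- by move=> x _; rewrite lee_fin.
- exists N; split => // x /=; apply: contra_notP => xN _.
  have -> : mindic R (measurableC mN) x = \1_(~` N) x by [].
  by rewrite indicE in_setC memNset//= mulr1.
Qed.

(** The integrands of [bilinear_op] are only Lebesgue measurable, so this is needed
    for arbitrary functions. *)
Lemma integral_off_null D f g : m.-negligible (D `&` [set x | f x <> g x]) ->
  \int[m]_(x in D) f x = \int[m]_(x in D) g x.
Proof.
move=> [N [mN N0 fgN]].
have fg x : D x -> ~ N x -> f x = g x.
  by move=> Dx; apply: contra_notP => fg; apply: fgN; split.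
rewrite integralE [RHS]integralE; congr (_ - _); apply/eqP; rewrite eq_le;
  apply/andP; split; apply: (ge0_le_integral_off_null mN N0) => // x Dx xN;
  by rewrite ?funeposE ?funenegE fg.
Qed.

Lemma le_mu_ext_off_null (A B : set X) : measurable A -> m.-negligible (A `\` B) ->
  m A <= (m^*)%mu B.
Proof.
move=> mA [N [mN N0 ABN]]; apply: le_ereal_inf_tmp => _ [F [mF BF] <-].
have mU : measurable (\bigcup_k F k) by exact: bigcup_measurable.
apply: (@le_trans _ _ (m (\bigcup_k F k `|` N))).
  apply: le_measure; rewrite ?inE//; first exact: measurableU.
  move=> x Ax; have [Bx|Bx] := pselect (B x); first by left; exact: BF.
  by right; apply: ABN.
apply: (@le_trans _ _ (m (\bigcup_k F k) + m N)); first exact: measureU2.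
rewrite N0 adde0.
exact: generalized_Boole_inequality.
Qed.

Lemma measurable_hull (A : set X) :
  exists H, [/\ measurable H, A `<=` H & m H <= (m^*)%mu A].
Proof.
have [->|] := eqVneq ((m^*)%mu A) +oo.
  by exists setT; split => //; rewrite leey.
rewrite -ltey => Aoo.
have Afin : (m^*)%mu A \is a fin_num by rewrite ge0_fin_numE// mu_ext_ge0.
have /choice[U hU] : forall k : nat, exists U,
    [/\ measurable U, A `<=` U & m U <= (m^*)%mu A + (k.+1%:R^-1)%:E].
  move=> k; have k0 : (0 < k.+1%:R^-1 :> R)%R by rewrite invr_gt0.
  have [_ [F [mF AF] <-] /ltW hF] := lb_ereal_inf_adherent k0 Afin.
  exists (\bigcup_k F k); split => //; first exact: bigcup_measurable.
  apply: le_trans hF; apply: generalized_Boole_inequality => //.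
  exact: bigcup_measurable.
exists (\bigcap_k U k); split.
- by apply: bigcapT_measurable => k; have [] := hU k.
- by move=> x Ax k _; have [_ + _] := hU k; apply.
apply/lee_addgt0Pr => e e0.
have [k ke] : exists k : nat, (k.+1%:R^-1 <= e)%R.
  exists (Num.trunc e^-1); rewrite invf_ple ?posrE//.
  exact/ltW/truncnS_gt.
have [mU AU hk] := hU k.
apply: (@le_trans _ _ (m (U k))).
  apply: le_measure; rewrite ?inE//.
    by apply: bigcapT_measurable => j; have [] := hU j.
  by move=> x /(_ k); apply.
by apply: (le_trans hk); rewrite leeD2l// lee_fin.
Qed.

(** Each set [{q < f}] with [q] rational contains a Borel set from which it differs
    by a null set. Off these countably many null sets, [f x] is the supremum of the
    [q] whose Borel set contains [x]. *)
Lemma Borel_version1 D (f : X -> R) : lebesgue_measurable_fun m D f ->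
  exists2 g : X -> R, measurable_fun setT g & m.-negligible (D `&` [set x | f x <> g x]).
Proof.
move=> mf.
pose q (k : nat) : R := ratr (odflt 0%R (unpickle k : option rat)).
have /choice[A hA] : forall k, exists A : set X, [/\ measurable A,
    A `<=` D `&` [set x | q k < f x]%R &
    m.-negligible ((D `&` [set x | q k < f x]%R) `\` A)].
  move=> k; have [A mA [N hN AN]] := mf `]q k, +oo[%classic (measurable_itv _).
  have E x : (A `|` N) x = (D x /\ (q k < f x)%R).
    by rewrite AN /= in_itv/= andbT.
  exists A; split => //.
  - by move=> x Ax; rewrite /= -E; left.
  - apply: negligibleS hN => x [/=]; rewrite -E; case=> // Ax nAx.
pose u (k : nat) x : \bar R := if x \in A k then (q k)%:E else -oo.
exists (fun x => fine (esups (u ^~ x) 0%N)).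
  apply: (measurableT_comp (@fine_measurable R setT measurableT)).
  apply: measurable_fun_esups => k; apply: measurable_fun_if => //.
    by apply: (measurable_fun_bool true); rewrite setTI preimage_mem_true; have [] := hA k.
have : m.-negligible (\bigcup_k ((D `&` [set x | q k < f x]%R) `\` A k)).
  by apply: negligible_bigcup => k; have [] := hA k.
apply: negligibleS => x [Dx]; apply: contra_notP => hx.
have {}hx k : (q k < f x)%R -> x \in A k.
  move=> qf; apply/mem_set; apply: contra_notP hx => Ax; exists k => //.
pose s := esups (u ^~ x) 0%N.
have uS k : u k x <= s by apply: ereal_sup_ubound; exists k.
have sf : s <= (f x)%:E.
  apply: ge_ereal_sup => _ [k _ <-]; rewrite /u; case: ifPn => [/set_mem Ax|]; last by rewrite leNye.
  by have [_ /(_ _ Ax)[_ /= /ltW]] := hA k.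
have qs (a : rat) : (ratr a < f x)%R -> (ratr a)%:E <= s.
  move=> af; have := uS (pickle a); rewrite /u ifT; first by rewrite /q pickleK.
  by apply: hx; rewrite /q pickleK.
have sfin : s \is a fin_num.
  have /rat_in_itvoo[a] : (f x - 1 < f x)%R by rewrite ltrBlDr ltrDl.
  rewrite in_itv/= => /andP[_ /qs as_]; rewrite fin_numElt; apply/andP; split.
    by apply: lt_le_trans as_; rewrite ltNyr.
  by apply: le_lt_trans sf _; rewrite ltry.
rewrite -/s; apply/eqP; rewrite eq_le andbC -lee_fin (fineK sfin) sf/=.
rewrite leNgt; apply/negP => /rat_in_itvoo[a]; rewrite in_itv/= => /andP[sa /qs].
by rewrite -(fineK sfin) lee_fin leNgt sa.
Qed.

Lemma Borel_version n D (f : X -> 'rV[R]_n) : lebesgue_measurable_fun m D f ->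
  exists2 g : X -> 'rV[R]_n, measurable_fun setT g &
    m.-negligible (D `&` [set x | f x <> g x]).
Proof.
move=> mf.
have /choice[g hg] : forall i : 'I_n, exists g : X -> R, measurable_fun setT g /\
    m.-negligible (D `&` [set x | f x ord0 i <> g x]).
  move=> i; have [|g mg gN] := @Borel_version1 D (fun x => f x ord0 i).
    move=> B mB; rewrite (_ : _ @^-1` B = f @^-1` ((fun v : 'rV_n => v ord0 i) @^-1` B))//.
    apply: mf; rewrite -[X in measurable X]setTI.
    exact: (@measurable_coord R n i measurableT).
  by exists g.
exists (fun x => \row_i g i x).
  apply: measurable_fun_rV => i; rewrite (_ : (fun _ => _) = g i); first by have [] := hg i.
  by apply/funext => x; rewrite mxE.
have : m.-negligible (\bigcup_k
    oapp (fun i : 'I_n => D `&` [set x | f x ord0 i <> g i x]) set0 (insub k)).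
  apply: negligible_bigcup => k; case: insubP => [i _ _|_] /=.
    by have [] := hg i.
  exact: negligible_set0.
apply: negligibleS => x [Dx]; apply: contra_notP => hx.
apply/rowP => i; rewrite mxE; apply: contra_notP hx => fg.
by exists i => //; rewrite valK.
Qed.

End null_sets.

(** * Weak-type bounds from Lorentz norms *)

Section lorentz_weak.
Context {R : realType} {n : nat}.
Notation V := 'rV[R]_n.
Notation mu := (@lebesgue_rV R n).
Local Open Scope ereal_scope.

Lemma rearrangement_ge0 d (X : measurableType d) (m : set X -> \bar R) g (t : R) :
  0 <= rearrangement m g t.
Proof. by rewrite le_max lexx. Qed.

Lemma rearrangement_ge d (X : measurableType d) (m : set X -> \bar R) g (y t : R) :
  (0 < y)%R -> t%:E < distr_fun m g y -> y%:E <= rearrangement m g t.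
Proof.
move=> y0 ty; rewrite le_max; apply/orP; right.
by apply: ereal_sup_ubound; exists y.
Qed.

(** One inequality for the three kinds of exponents: both suprema have
    [lexp_inv = 0]. *)
Lemma Lnorm_rV_weak r (f : V -> V) (H y t : R) : Lnorm_rV r linfty f <= H%:E ->
  (0 < y)%R -> (0 < t)%R -> t%:E < (mu^*)%mu [set x | y < enorm (f x)]%R ->
  (y * t `^ lexp_inv r <= H)%R.
Proof.
move=> hH y0 t0 ty; rewrite -lee_fin; apply: le_trans hH.
have weak p : (y * t `^ lexp_inv p)%:E <= ereal_sup
    [set (t `^ lexp_inv p)%:E * rearrangement mu (fun x => (enorm (f x))%:E) t | t in [set t : R | (0 < t)%R]].
  apply: le_ereal_sup_tmp; eexists; first by exists t.
  rewrite mulrC EFinM lee_wpmul2l ?lee_fin ?powR_ge0//.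
  exact: rearrangement_ge.
case: r weak => [a||] weak; rewrite /Lnorm_rV/=.
- exact: (weak (lfin a)).
- exact: (weak linfty).
- rewrite powRr0 mulr1.
  have [x /= yx] : exists x, (y < enorm (f x))%R.
    apply: contrapT => /forallNP h; move: ty; rewrite (_ : [set _ | _] = set0).
      by rewrite mu_ext0// ltNge lee_fin ltW.
    by apply/seteqP; split => x // /h.
  by apply: le_ereal_sup_tmp; exists (enorm (f x))%:E; [exists x|rewrite lee_fin ltW].
Qed.

Lemma Lnorm_rV_ge0 r (f : V -> V) : 0 <= Lnorm_rV r linfty f.
Proof.
have weak p : 0 <= ereal_sup
    [set (t `^ lexp_inv p)%:E * rearrangement mu (fun x => (enorm (f x))%:E) t | t in [set t : R | (0 < t)%R]].
  apply: le_ereal_sup_tmp; eexists; first by exists 1%R => /=.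
  by rewrite mule_ge0 ?lee_fin ?powR_ge0// rearrangement_ge0.
case: r => [a||]; rewrite /Lnorm_rV/=.
- exact: (weak (lfin a)).
- exact: (weak linfty).
- by apply: le_ereal_sup_tmp; exists (enorm (f 0))%:E; [exists 0%R|rewrite lee_fin enorm_ge0].
Qed.

Lemma weak_le_version r (f g : V -> V) (H : R) : measurable_fun setT g ->
  mu.-negligible [set x | f x <> g x] -> Lnorm_rV r linfty f <= H%:E ->
  weak_le mu (lexp_inv r) (fun x => enorm (g x)) H.
Proof.
move=> mg fg hH y t y0 t0 ty; apply: (Lnorm_rV_weak hH) => //.
apply: (lt_le_trans ty); apply: le_mu_ext_off_null.
  by apply: measurable_superlevel; exact: measurable_enorm.
apply: negligibleS fg => x [/= gx]; apply: contra_not => ->; exact: gx.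
Qed.

End lorentz_weak.

(** * Tails of time profiles *)

Section time_profile.
Context {R : realType}.
Notation lam := (@lebesgue_measure R).
Local Open Scope ereal_scope.

(** [D y = o(y^(-alpha))] at infinity. The mere order [y^(-alpha)], i.e. membership
    in L^(alpha,oo), would not make a profile small on short intervals. *)
Definition vanishing_tail (alpha : R) (D : R -> \bar R) : Prop :=
  forall e : R, (0 < e)%R -> exists2 y0 : R, (0 < y0)%R &
    forall y : R, (y0 <= y)%R -> D y <= ((e / y) `^ alpha)%:E.

(** If the tail does not vanish, there are arbitrarily small [t] such that the
    rearrangement is at least [e t^(-1/alpha)] on [(0, t]]. On [(t/2, t]] the
    integrand of the Lorentz norm is then at least [c / t], which contributes
    [c / 2] to the integral; infinitely many such intervals are disjoint. The
    minorant [g] is the sum of [K] such steps. *)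
Lemma lorentz_tail (alpha beta : R) (N : R -> \bar R) : (0 < alpha)%R -> (0 < beta)%R ->
  lorentz_norm lam (lfin alpha) (lfin beta) N < +oo ->
  vanishing_tail alpha (distr_fun lam N).
Proof.
move=> al0 be0 hN e e0; apply: contrapT => htail.
have bad (tau : R) : (0 < tau)%R -> exists t : R, [/\ (0 < t)%R, (t <= tau)%R &
    forall s : R, (0 < s)%R -> (s <= t)%R -> (e * t `^ (- alpha^-1))%:E <= rearrangement lam N s].
  move=> tau0; pose y0 := (e * tau `^ (- alpha^-1))%R.
  have y00 : (0 < y0)%R by rewrite mulr_gt0// powR_gt0.
  have [y [yy0 hy]] : exists y : R, (y0 <= y)%R /\ ((e / y) `^ alpha)%:E < distr_fun lam N y.
    apply: contrapT => /forallNP h; apply: htail; exists y0 => // y yy0.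
    by rewrite leNgt; apply/negP => hy; apply: (h y).
  have y_0 : (0 < y)%R := lt_le_trans y00 yy0.
  have ey0 : (0 < e / y)%R by rewrite divr_gt0.
  exists ((e / y) `^ alpha)%R; split; first by rewrite powR_gt0.
    have -> : tau = ((e / y0) `^ alpha)%R.
      rewrite /y0 invfM mulrA divff ?gt_eqF// mul1r powRN invrK -powRrM mulVf ?gt_eqF//.
      by rewrite powRr1// ltW.
    rewrite ge0_ler_powR ?nnegrE ?(ltW al0) ?(ltW ey0) ?divr_ge0 ?(ltW e0) ?(ltW y00)//.
    by rewrite ler_pM2l// lef_pV2.
  move=> s s0 st; rewrite -powRrM mulrN mulfV ?gt_eqF// powR_inv1 ?(ltW ey0)//.
  rewrite invf_div mulrCA divff ?gt_eqF// mulr1.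
  by apply: rearrangement_ge; [exact: y_0|apply: le_lt_trans hy; rewrite lee_fin].
pose Phi t := (((t `^ alpha^-1)%:E * rearrangement lam N t) `^ beta * (t^-1)%:E).
pose c : R := (((2^-1) `^ alpha^-1 * e) `^ beta)%R.
have c0 : (0 < c)%R by rewrite powR_gt0// mulr_gt0// powR_gt0.
have poweR_mono (x y : \bar R) : 0 <= x -> x <= y -> x `^ beta <= y `^ beta.
  move=> x0 xy; apply: (@gt0_ler_poweR R beta (ltW be0) x y _ _ xy).
    by rewrite in_itv/= leey andbT.
  by rewrite in_itv/= leey andbT (le_trans x0).
have step (K : nat) : forall tau : R, (0 < tau)%R -> exists g : R -> R,
    [/\ measurable_fun setT g, forall s, (0 <= g s)%R,
     forall s : R, ~~ (0 < s <= tau)%R -> g s = 0%R,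
     forall s : R, (0 < s)%R -> (g s)%:E <= Phi s &
     (K%:R * (c / 2))%:E <= \int[lam]_s (g s)%:E].
  elim: K => [|K IH] tau tau0.
    exists (fun=> 0%R); split => //.
    - by move=> s s0; rewrite mule_ge0 ?poweR_ge0// lee_fin invr_ge0 ltW.
    - by rewrite mul0r integral_ge0.
  have [t [t0 tt ht]] := bad tau tau0.
  have t20 : (0 < t / 2)%R by rewrite divr_gt0.
  have t2t : (t / 2 < t)%R by lra.
  have [g [mg g0 gtau gPhi gint]] := IH _ t20.
  have mI : measurable_fun setT (\1_(`](t / 2)%R, t]%classic) : R -> R).
    exact: measurable_indic_itv.
  exists (fun s => g s + c / t * \1_(`](t / 2)%R, t]%classic) s)%R; split.
  - by apply: measurable_funD => //; exact: measurable_funM.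
  - by move=> s; rewrite addr_ge0// mulr_ge0// (divr_ge0 (ltW c0) (ltW t0)).
  - move=> s hs; rewrite gtau.
      rewrite indicE mem_setE in_itv/=; case: (boolP (t / 2 < s <= t)%R) => [/andP[h1 h2]|_].
        by move: hs; rewrite (lt_trans t20 h1) (le_trans h2 tt).
      by rewrite mulr0 addr0.
    by apply: contra hs => /andP[-> h2]; rewrite (le_trans h2)// (le_trans (ltW t2t)).
  - move=> s s0; rewrite indicE mem_setE in_itv/=; case: (boolP (t / 2 < s <= t)%R) => [/andP[h1 h2]|_]; last first.
      by rewrite mulr0 addr0 gPhi.
    rewrite gtau ?mulr1 ?add0r; last by rewrite negb_and -leNgt -ltNge h1 orbT.
    rewrite /Phi EFinM; apply: lee_pmul.
    + by rewrite lee_fin ltW.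
    + by rewrite lee_fin invr_ge0 ltW.
    + rewrite /c -[leLHS]poweR_EFin; apply: poweR_mono.
        by rewrite lee_fin mulr_ge0 ?powR_ge0 ?ltW.
      apply: (@le_trans _ _ ((s `^ alpha^-1)%:E * (e * t `^ (- alpha^-1))%:E)); last first.
        by rewrite lee_wpmul2l ?lee_fin ?powR_ge0//; exact: ht.
      rewrite -EFinM lee_fin mulrCA mulrC ler_pM2l//.
      rewrite powRN ler_pdivlMr ?powR_gt0// -powRM ?(ltW t0)//.
      by rewrite ge0_ler_powR ?nnegrE ?ltW ?invr_gt0 ?mulr_gt0// mulrC.
    + by rewrite lee_fin lef_pV2.
  under eq_integral do rewrite EFinD.
  rewrite ge0_integralD//; last 4 first.
  - by move=> s _; rewrite lee_fin.
  - exact/measurable_EFinP.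
  - by move=> s _; rewrite lee_fin mulr_ge0// (divr_ge0 (ltW c0) (ltW t0)).
  - by apply/measurable_EFinP; exact: measurable_funM.
  rewrite -natr1 mulrDl mul1r EFinD leeD//.
  under eq_integral do rewrite EFinM.
  rewrite ge0_integralZl_EFin//; last 2 first.
  - exact/measurable_EFinP.
  - exact: (divr_ge0 (ltW c0) (ltW t0)).
  rewrite integral_indic//.
  have lamI : lam `](t / 2)%R, t]%classic = (t / 2)%:E.
    by rewrite lebesgue_measure_itv/= lte_fin t2t -EFinB; congr EFin; field.
  rewrite setIT [X in _ <= _ * X](_ : _ = (t / 2)%:E); last exact: lamI.
  rewrite -EFinM lee_fin; apply: le_of_eq.
  by field; rewrite gt_eqF.
have Phi0 s : `]0%R, +oo[%classic s -> 0 <= Phi s.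
  by rewrite /= in_itv/= andbT => s0; rewrite mule_ge0 ?poweR_ge0// lee_fin invr_ge0 ltW.
have : \int[lam]_(t in `]0%R, +oo[) Phi t = +oo.
  apply/eqyP => A A0.
  have [g [mg g0 gtau gPhi gint]] := step (Num.bound (A / (c / 2))) 1%R ltr01.
  apply: (@le_trans _ _ (\int[lam]_s (g s)%:E)).
    apply: le_trans gint; rewrite lee_fin -ler_pdivrMr ?divr_gt0//.
    by apply/ltW/archi_boundP; rewrite divr_ge0 ?divr_ge0 ?ltW.
  apply: (@le_trans _ _ (\int[lam]_(s in `]0%R, +oo[) (g s)%:E)).
    rewrite [leRHS]integral_mul_indic; apply/le_of_eq/eq_integral => s _.
    rewrite indicE mem_setE in_itv/= andbT; case: (boolP (0 < s)%R) => s0; first by rewrite mule1.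
    by rewrite mule0 gtau// negb_and s0.
  apply: ge0_le_integral_any => s /=; first by rewrite lee_fin.
  by rewrite in_itv/= andbT; exact: gPhi.
move=> PhiE; move: hN; rewrite /lorentz_norm -/(Phi _) PhiE gt0_muley; last first.
  by rewrite lte_fin divr_gt0.
by rewrite poweRyr ?ltxx// gt_eqF// invr_gt0.
Qed.

Lemma dyadic_floor (y : R) : (1 <= y)%R -> exists j : nat, (2 ^+ j <= y < 2 ^+ j.+1)%R.
Proof.
move=> y1.
have ex : exists j : nat, (y < 2 ^+ j)%R.
  exists (Num.bound y); apply: (lt_trans (archi_boundP _)); first exact: le_trans y1.
  by rewrite -natrX ltr_nat ltn_expl.
case: (ex_minnP ex) => -[|j] yj hj.
  by move: yj; rewrite expr0 ltNge y1.
by exists j; rewrite yj andbT leNgt; apply/negP => /hj; rewrite ltnn.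
Qed.

(** Applied to the set where the profile is infinite. *)
Lemma vanishing_tail_lim0 (alpha : R) (D : R -> \bar R) (x : \bar R) : (0 < alpha)%R ->
  vanishing_tail alpha D -> (forall k : nat, x <= D (2 ^+ k)%R) -> x <= 0.
Proof.
move=> al0 hD hx; apply/lee_addgt0Pr => e e0; rewrite add0e.
have [y0 y00 hy] := hD _ (ltr01 : (0 < 1 :> R)%R).
pose Y := (Num.max (Num.max 1 y0) (e `^ (- alpha^-1)))%R.
have [|j /andP[_ hj]] := @dyadic_floor Y; first by rewrite !le_max lexx.
have Yj := ltW hj.
apply: (le_trans (hx j.+1)); apply: (le_trans (hy _ _)).
  by apply: le_trans Yj; rewrite !le_max lexx orbT.
have eE : e = ((e `^ alpha^-1) `^ alpha)%R by rewrite -powRrM mulVf ?gt_eqF// powRr1// ltW.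
rewrite lee_fin [leRHS]eE ge0_ler_powR ?nnegrE ?powR_ge0 ?(ltW al0) ?divr_ge0 ?exprn_ge0//.
rewrite div1r -[leRHS]invrK lef_pV2 ?posrE ?exprn_gt0 ?invr_gt0 ?powR_gt0//.
by rewrite -powRN; apply: le_trans Yj; rewrite !le_max lexx orbT.
Qed.

(** The superlevel sets of [N] at the levels [2^k] have measurable hulls of the same
    outer measure, which intersections make decreasing. The majorant takes the
    value [2^(k+2)] on the k-th hull, large enough to dominate [N] up to the next
    dyadic level; the factor 4 lost in this way is absorbed by the [e] of
    [vanishing_tail]. *)
Lemma Borel_majorant (alpha : R) (N : R -> \bar R) : (0 < alpha)%R ->
  (forall t, 0 <= N t) -> vanishing_tail alpha (distr_fun lam N) ->
  exists h : R -> R, [/\ measurable_fun setT h, forall t, (0 < h t)%R,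
    vanishing_tail alpha (fun y => lam [set t | y < h t]%R) &
    lam.-negligible [set t | ~ (N t <= (h t)%:E)]].
Proof.
move=> al0 N0 htail.
have /choice[H hH] : forall k : nat, exists H : set R,
    [/\ measurable H, [set t | (2 ^+ k)%:E < N t] `<=` H & lam H <= distr_fun lam N (2 ^+ k)%R].
  by move=> k; exact: (@measurable_hull _ _ R lam [set t | (2 ^+ k)%:E < N t]).
pose A k := \bigcap_(i in [set i | (i <= k)%N]) H i.
have mA k : measurable (A k).
  by apply: bigcap_measurable => [|i _]; [exists 0%N|have [] := hH i].
have AD k : lam (A k) <= distr_fun lam N (2 ^+ k)%R.
  have [mHk _ hk] := hH k; apply: le_trans hk; apply: le_measure; rewrite ?inE.
  - exact: mA.
  - exact: mHk.
  - by move=> t; apply => /=.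
have NA k t : (2 ^+ k)%:E < N t -> A k t.
  move=> Nt i /= ik; have [_ + _] := hH i; apply => /=; apply: le_lt_trans Nt.
  by rewrite lee_fin ler_eXn2l ?ltr1n.
have AS k j t : (j <= k)%N -> A k t -> A j t.
  by move=> jk Akt i /= ij; apply: Akt => /=; exact: leq_trans jk.
pose u k t : \bar R := if t \in A k then (2 ^+ k.+2)%:E else 2%:E.
pose h' t := esups (u ^~ t) 0%N.
have mh' : measurable_fun setT h'.
  apply: measurable_fun_esups => k; apply: measurable_fun_if => //.
  by apply: (measurable_fun_bool true); rewrite setTI preimage_mem_true.
have uh k t : u k t <= h' t by apply: ereal_sup_ubound; exists k.
have h'2 t : 2%:E <= h' t.
  apply: le_trans (uh 0%N t); rewrite /u; case: ifPn => // _.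
  by rewrite lee_fin -natrX ler_nat.
have Nh' t : N t <= h' t.
  have big k : (2 ^+ k)%:E < N t -> (2 ^+ k.+2)%:E <= h' t.
    by move=> /NA At; apply: le_trans (uh k t); rewrite /u mem_set.
  case E : (N t) big => [y| |] big.
  - have [y2|y2] := leP y 2%R; first by apply: le_trans (h'2 t); rewrite lee_fin.
    have [|j /andP[yj jy]] := @dyadic_floor y; first by apply: le_trans (ltW y2); rewrite ler1n.
    case: j yj jy => [|j] yj jy.
      by apply: le_trans (h'2 t); rewrite lee_fin ltW.
    apply: (le_trans _ (big j _)); first by rewrite lee_fin ltW.
    by rewrite lte_fin (lt_le_trans _ yj)// ltr_eXn2l ?ltr1n.
  - suff -> : h' t = +oo by [].
    apply/eqyP => y y0; have [k hk] : exists k : nat, (y <= 2 ^+ k.+2)%R.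
      have [|j /andP[_ hj]] := @dyadic_floor (Num.max 1 y)%R; first by rewrite le_max lexx.
      exists j; apply: (@le_trans _ _ (2 ^+ j.+1)%R).
        by apply: le_trans (ltW hj); rewrite le_max lexx orbT.
      by rewrite ler_eXn2l ?ltr1n.
    apply: (le_trans _ (big k _)); first by rewrite lee_fin.
    exact: ltry.
  - by move: (N0 t); rewrite E.
have h'A j t : (2 ^+ j.+1)%:E < h' t -> A j t.
  move=> /ereal_sup_gt[_ [k _ <-]]; rewrite /u; case: ifPn => [/set_mem Akt|_].
    by rewrite lte_fin ltr_eXn2l ?ltr1n// !ltnS => jk; exact: AS Akt.
  by rewrite lte_fin ltNge -natrX ler_nat expnS leq_pmulr ?expn_gt0.
pose h t := Num.max 2%R (fine (h' t)).
have mh : measurable_fun setT h.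
  apply: measurable_maxr => //.
  exact: (measurableT_comp (@fine_measurable R setT measurableT)).
exists h; split => //.
- by move=> t; rewrite lt_max ltr0n.
- move=> e e0; have [y0 y00 hy] := htail (e / 4)%R (divr_gt0 e0 (ltr0n _ 4)).
  exists (Num.max 4 (4 * y0))%R; first by rewrite lt_max ltr0n.
  move=> y; rewrite ge_max => /andP[y4 yy0].
  have [|j /andP[yj jy]] := @dyadic_floor y; first by apply: le_trans y4; rewrite ler1n.
  case: j yj jy => [|j] yj jy.
    by move: jy; rewrite expr1 ltNge (le_trans _ y4)// ler_nat.
  have y40 : (0 < y / 4)%R by rewrite divr_gt0// (lt_le_trans _ y4).
  have yj4 : (y / 4 <= 2 ^+ j)%R.
    by rewrite ler_pdivrMr// (le_trans (ltW jy))// !exprS; lra.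
  apply: (@le_trans _ _ (lam (A j))).
    apply: le_measure; rewrite ?inE; last first.
    - move=> t /= yt; apply: h'A; apply: (@le_lt_trans _ _ y%:E); first by rewrite lee_fin.
      have y2 : (2 <= y)%R by apply: le_trans y4; rewrite ler_nat.
      move: yt; rewrite /h lt_max ltNge y2/=; case: (h' t) => [r| |] //=; first by rewrite ltry.
      by rewrite ltNge (le_trans _ y4).
    - exact: mA.
    - exact: measurable_superlevel.
  apply: (le_trans (AD j)); apply: (le_trans (hy _ _)).
    by apply: le_trans yj4; rewrite ler_pdivlMr// mulrC.
  rewrite lee_fin ge0_ler_powR ?nnegrE ?divr_ge0 ?exprn_ge0 ?(ltW e0) ?(ltW al0)//.
    by rewrite (le_trans _ y4).
  have -> : (e / y = e / 4 / (y / 4))%R by field; rewrite gt_eqF// (lt_le_trans _ y4).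
  by rewrite ler_pM2l ?divr_gt0// lef_pV2 ?posrE// exprn_gt0.
- exists (\bigcap_k A k); split.
  + by apply: bigcapT_measurable.
  + apply/eqP; rewrite eq_le measure_ge0 andbT.
    apply: (vanishing_tail_lim0 al0 htail) => k; apply: le_trans (AD k).
    apply: le_measure; rewrite ?inE.
    * exact: bigcapT_measurable.
    * exact: mA.
    * by move=> t; apply.
  move=> t /=; apply: contra_notP => hA.
  suff hfin : h' t \is a fin_num.
    by apply: (le_trans (Nh' t)); rewrite -(fineK hfin) lee_fin le_max lexx orbT.
  rewrite ge0_fin_numE ?(le_trans _ (h'2 t))// ltNge leye_eq.
  apply: contra_notN hA => /eqP hoo j _; apply: h'A; rewrite hoo; exact: ltry.
Qed.

End time_profile.

(** * Borel versions of paths *)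

Section Borel_path.
Context {R : realType} {n : nat}.
Notation V := 'rV[R]_n.
Notation mu := (@lebesgue_rV R n).
Notation lam := (@lebesgue_measure R).
Local Open Scope ereal_scope.

Lemma negligible_slices d1 d2 (X : measurableType d1) (Y : measurableType d2)
    (m1 : {sigma_finite_measure set X -> \bar R})
    (m2 : {sigma_finite_measure set Y -> \bar R}) (N : set (X * Y)) :
  (m1 \x m2).-negligible N ->
  m1.-negligible [set x | ~ m2.-negligible [set y | N (x, y)]].
Proof.
move=> [Z [mZ Z0 NZ]].
have mphi : measurable_fun setT (m2 \o xsection Z) by exact: measurable_fun_xsection.
have : \int[m1]_x `|(m2 \o xsection Z) x| = 0.
  by rewrite -[RHS]Z0; apply: eq_integral => x _; rewrite gee0_abs.
move=> /(ae_eq_integral_abs m1 measurableT mphi); apply: negligibleS => x /= hN h0.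
apply: hN; exists (xsection Z x); split; first exact: measurable_xsection.
  exact: h0.
by move=> y /NZ Zxy; rewrite /xsection/= inE.
Qed.

(** From here on the path and its profile can be treated as Borel functions, to
    which Tonelli's theorem applies. *)
Lemma path_space_Borel (alpha beta T : R) r (u : R -> V -> V) : (0 < alpha)%R -> (0 < beta)%R ->
  path_space (lfin alpha) (lfin beta) r linfty T%:E u ->
  exists (g : R * V -> V) (h : R -> R), [/\ measurable_fun setT g,
    measurable_fun setT h, forall t, (0 < h t)%R,
    vanishing_tail alpha (fun y => lam [set t | y < h t]%R) &
    lam.-negligible [set t | (0 < t < T)%R /\
      ~ (mu.-negligible [set x | u t x <> g (t, x)] /\
         weak_le mu (lexp_inv r) (fun x => enorm (g (t, x))) (h t))]].
Proof.
move=> al0 be0 [mu_ hN].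
have [g mg gN] := Borel_version mu_.
set N := (fun t => _) in hN.
have tail := lorentz_tail al0 be0 hN.
have N0 t : 0 <= N t by rewrite /N; case: ifP => // _; exact: Lnorm_rV_ge0.
have [h [mh h0 htail hneg]] := Borel_majorant al0 N0 tail.
exists g, h; split => //.
have := negligibleU (negligible_slices gN) hneg.
apply: negligibleS => t /= [/andP[t0 tT]] hn.
have tI : time_interval T%:E t by split => //; rewrite lte_fin.
apply: contrapT => /not_orP[/contrapT h1 /contrapT h2]; apply: hn.
have gt : mu.-negligible [set x | u t x <> g (t, x)].
  by apply: negligibleS h1 => x /= ug.
split => //; apply: weak_le_version gt _.
  exact: (measurableT_comp mg (measurable_pair1 t)).
by apply: le_trans h2; rewrite /N mem_set.
Qed.

End Borel_path.

(** * Further properties of mean bounds *)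

Section mean_le_facts.
Context d (X : measurableType d) {R : realType}
  (m : {sigma_finite_measure set X -> \bar R}).
Local Open Scope ereal_scope.
Implicit Types (F G : X -> \bar R) (A B : \bar R) (kappa : R).

Lemma mean_le_weaken kappa F A B : A <= B -> mean_le m kappa F A -> mean_le m kappa F B.
Proof.
move=> AB h E mE fE; apply: (le_trans (h E mE fE)).
by rewrite lee_wpmul2r// lee_fin powR_ge0.
Qed.

Lemma mean_leD kappa F G A B : measurable_fun setT F -> (forall x, 0 <= F x) ->
  measurable_fun setT G -> (forall x, 0 <= G x) -> 0 <= A -> 0 <= B ->
  mean_le m kappa F A -> mean_le m kappa G B ->
  mean_le m kappa (fun x => F x + G x) (A + B).
Proof.
move=> mF F0 mG G0 A0 B0 hF hG E mE fE.
rewrite ge0_integralD//; last 2 first.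
- exact: measurable_funTS.
- exact: measurable_funTS.
by rewrite ge0_muleDl// leeD// ?hF ?hG.
Qed.

Lemma mean_le_off_null kappa F G A : measurable_fun setT F -> (forall x, 0 <= F x) ->
  measurable_fun setT G -> (forall x, 0 <= G x) ->
  m.-negligible [set x | ~ F x <= G x] -> mean_le m kappa G A -> mean_le m kappa F A.
Proof.
move=> mF F0 mG G0 FG hG E mE fE; apply: le_trans (hG E mE fE).
apply: ae_ge0_le_integral => //; [exact: measurable_funTS|exact: measurable_funTS|].
by apply: negligibleS FG => x /= h; apply: contra_not h.
Qed.

Lemma mean_le_fun kappa F G A : measurable_fun setT F -> (forall x, 0 <= F x) ->
  measurable_fun setT G -> (forall x, F x <= G x) ->
  mean_le m kappa G A -> mean_le m kappa F A.
Proof.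
move=> mF F0 mG FG hG E mE fE; apply: le_trans (hG E mE fE).
apply: ge0_le_integral => //; exact: measurable_funTS.
Qed.

Lemma mean_leZ kappa F A (c : R) : (0 <= c)%R -> measurable_fun setT F ->
  (forall x, 0 <= F x) ->
  mean_le m kappa F A -> mean_le m kappa (fun x => c%:E * F x) (c%:E * A).
Proof.
move=> c0 mF F0 hF E mE fE; rewrite ge0_integralZl_EFin//; last exact: measurable_funTS.
by rewrite -muleA lee_wpmul2l// ?lee_fin// hF.
Qed.

(** The product bound for the constant function 1, whose mean bound has exponent 1. *)
Lemma weak_le_mean (rho : R) : (0 <= rho < 1)%R ->
  exists2 C : R, (0 < C)%R & forall (k : X -> R) (H : R),
  measurable_fun setT k -> (forall x, 0 <= k x)%R -> (0 < H)%R -> weak_le m rho k H ->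
  mean_le m (1 - rho) (fun x => (k x)%:E) (C * H)%:E.
Proof.
move=> /andP[r0 r1]; have [C C0 hC] := mean_le_mul m r0 r1.
exists C => // k H mk k0 H0 hk.
have one : mean_le m 1 (cst 1) 1.
  move=> E mE fE; rewrite (_ : \int[m]_(x in E) _ = 1 * m E); last exact: integral_cst.
  by rewrite powRr1 ?fine_ge0// fineK// ge0_fin_numE.
have := hC (cst 1) k 1 H (measurable_cst 1) (fun=> lee01) mk k0 lee01 H0 one hk.
by rewrite mule1; under eq_fun do rewrite mul1e.
Qed.

Lemma mean_le_ae_fin kappa F (A : R) : measurable_fun setT F -> (forall x, 0 <= F x) ->
  mean_le m kappa F A%:E -> m.-negligible [set x | ~ F x < +oo].
Proof.
move=> mF F0 hF; have [E TE mE] := sigma_finiteT m.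
have : m.-negligible (\bigcup_i [set x | ~ (E i x -> F x \is a fin_num)]).
  apply: negligible_bigcup => i; have [mEi fEi] := mE i.
  apply: (@integrable_ae _ _ _ m (E i) mEi F); apply/integrableP; split.
    exact: measurable_funTS.
  under eq_integral do rewrite gee0_abs//.
  by apply: le_lt_trans (hF _ mEi fEi) _; rewrite -EFinM ltry.
apply: negligibleS => x /= Fx; have : setT x by []; rewrite TE => -[i _ Eix].
by exists i => //= h; apply: Fx; rewrite -ge0_fin_numE// h.
Qed.

Lemma mean_le0_ae kappa F : measurable_fun setT F -> (forall x, 0 <= F x) ->
  mean_le m kappa F 0 -> m.-negligible [set x | F x <> 0].
Proof.
move=> mF F0 hF; have [E TE mE] := sigma_finiteT m.
have : m.-negligible (\bigcup_i [set x | ~ (E i x -> F x = 0)]).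
  apply: negligible_bigcup => i; have [mEi fEi] := mE i.
  apply: (ae_eq_integral_abs m mEi (f := F) _).1; first exact: measurable_funTS.
  under eq_integral do rewrite gee0_abs//.
  apply/eqP; rewrite eq_le integral_ge0// andbT.
  by apply: (le_trans (hF _ mEi fEi)); rewrite mul0e.
apply: negligibleS => x /= Fx; have : setT x by []; rewrite TE => -[i _ Eix].
by exists i => //= h; apply: Fx; rewrite h.
Qed.

End mean_le_facts.

(** * Properties at almost every time *)

Section ae_time.
Context {R : realType}.
Notation lam := (@lebesgue_measure R).
Local Open Scope ereal_scope.

Definition ae_time (b : R) (P : R -> Prop) : Prop :=
  lam.-negligible [set s | (0 < s < b)%R /\ ~ P s].

Lemma ae_time_imp b (P Q : R -> Prop) : (forall s, (0 < s < b)%R -> P s -> Q s) ->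
  ae_time b P -> ae_time b Q.
Proof.
by move=> PQ; apply: negligibleS => s /= [sb hs]; split => // /(PQ _ sb).
Qed.

Lemma ae_timeI b (P Q : R -> Prop) : ae_time b P -> ae_time b Q ->
  ae_time b (fun s => P s /\ Q s).
Proof.
move=> hP hQ; apply: negligibleS (negligibleU hP hQ) => s /= [sb /not_andP[]]; by [left|right].
Qed.

Lemma ae_time_le b b' (P : R -> Prop) : (b' <= b)%R -> ae_time b P -> ae_time b' P.
Proof.
move=> bb; apply: negligibleS => s /= [/andP[s0 sb] hs]; split => //.
by rewrite s0 (lt_le_trans sb).
Qed.

(** Levels above [y0] are controlled by the tail and levels below [y0] by the length
    of the interval, so that the weak size is at most [e] on short intervals. *)
Lemma vanishing_tail_weak (alpha : R) (h : R -> R) : (0 < alpha)%R ->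
  measurable_fun setT h -> (forall s, 0 < h s)%R ->
  vanishing_tail alpha (fun y => lam [set t | y < h t]%R) ->
  forall e, (0 < e)%R -> exists2 y0 : R, (0 < y0)%R & forall a b : R, (a <= b)%R ->
  weak_le lam alpha^-1 (fun s => h s * \1_(`]a, b[%classic) s)%R
    (Num.max e (y0 * (b - a) `^ alpha^-1))%R.
Proof.
move=> al0 mh h0 tail e e0; have [y0 y00 hy] := tail e e0.
exists y0 => // a b ab y t y_0 t0 ty.
have sub : [set s | (y < h s * \1_(`]a, b[%classic) s)%R] `<=` [set s | (y < h s)%R] `&` `]a, b[%classic.
  move=> s /=; rewrite indicE; case: (boolP (s \in _)) => [/set_mem ?|_]; first by rewrite mulr1.
  by rewrite mulr0 => /(lt_trans y_0); rewrite ltxx.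
have mI : measurable_fun setT (\1_(`]a, b[%classic) : R -> R).
  exact: measurable_indic_itv.
have mS : measurable [set s | (y < h s * \1_(`]a, b[%classic) s)%R].
  by apply: measurable_superlevel; exact: measurable_funM.
have ia0 : (0 <= alpha^-1)%R by rewrite invr_ge0 ltW.
rewrite le_max; have [yy0|yy0] := leP y0 y; apply/orP; [left|right].
  have : t%:E < ((e / y) `^ alpha)%:E.
    apply: (lt_le_trans ty); apply: le_trans (hy _ yy0); apply: le_measure; rewrite ?inE.
    - exact: mS.
    - exact: measurable_superlevel.
    - by move=> s /sub[].
  rewrite lte_fin => /ltW te.
  rewrite mulrC -ler_pdivlMr//.
  have -> : (e / y = ((e / y) `^ alpha) `^ alpha^-1)%R.
    by rewrite -powRrM mulfV ?gt_eqF// powRr1// divr_ge0// ltW.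
  by rewrite ge0_ler_powR ?nnegrE ?powR_ge0// ltW.
have : t%:E < (b - a)%:E.
  apply: (lt_le_trans ty); apply: (@le_trans _ _ (lam `]a, b[%classic)).
    apply: le_measure; rewrite ?inE.
    - exact: mS.
    - exact: measurable_itv.
    - by move=> s /sub[].
  by rewrite lebesgue_measure_itv/= lte_fin; case: ltP => // _; rewrite lee_fin subr_ge0.
rewrite lte_fin => /ltW tb; apply: ler_pM; [exact: ltW|exact: powR_ge0|exact: ltW|].
by rewrite ge0_ler_powR ?nnegrE ?subr_ge0// ltW.
Qed.

End ae_time.

(** * The Duhamel integral *)

Section duhamel.
Context {R : realType} {n : nat}.
Notation V := 'rV[R]_n.
Notation mu := (@lebesgue_rV R n).
Notation lam := (@lebesgue_measure R).
Local Open Scope ereal_scope.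

(** The bilinear operator with its kernel replaced by the majorant and the product
    of its arguments by [F]. *)
Definition duhamel (F : R * V -> \bar R) (t : R) (x : V) : \bar R :=
  \int[lam]_(s in `]0%R, t[) \int[mu]_y (F (s, y) * oseen_majorant (t - s)%R (x - y)%R).

Lemma measurable_duhamel_integrand (F : R * V -> \bar R) t : measurable_fun setT F ->
  measurable_fun setT (fun p : (V * R) * V =>
    F (p.1.2, p.2) * oseen_majorant (t - p.1.2)%R (p.1.1 - p.2)%R).
Proof.
move=> mF; apply: emeasurable_funM.
  apply: (measurableT_comp mF); apply/measurable_fun_pairP; split; last exact: measurable_snd.
  exact: (measurableT_comp measurable_snd measurable_fst).
apply: (measurableT_comp measurable_oseen_majorant
  (g := fun p : (V * R) * V => ((t - p.1.2)%R, (p.1.1 - p.2)%R))).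
apply/measurable_fun_pairP; split.
  apply: measurable_funB => //; exact: (measurableT_comp measurable_snd measurable_fst).
by apply: measurable_rVB => //; exact: (measurableT_comp measurable_fst measurable_fst).
Qed.

Lemma duhamel_ge0 F t x : (forall z, 0 <= F z) -> 0 <= duhamel F t x.
Proof.
move=> F0; apply: integral_ge0 => s _; apply: integral_ge0 => y _.
by rewrite mule_ge0// oseen_majorant_ge0.
Qed.

Lemma measurable_conv (F : R * V -> \bar R) t : measurable_fun setT F -> (forall z, 0 <= F z) ->
  measurable_fun setT (fun p : V * R =>
    \int[mu]_y (F (p.2, y) * oseen_majorant (t - p.2)%R (p.1 - y)%R)).
Proof.
move=> mF F0; apply: (@measurable_fun_fubini_tonelli_F _ _ _ _ _ mu _
  (measurable_duhamel_integrand t mF)) => p.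
by rewrite mule_ge0// oseen_majorant_ge0.
Qed.

Lemma measurable_duhamel (F : R * V -> \bar R) t : measurable_fun setT F -> (forall z, 0 <= F z) ->
  measurable_fun setT (duhamel F t).
Proof.
move=> mF F0.
have mI : measurable_fun setT (\1_(`]0%R, t[%classic) : R -> R).
  exact: measurable_indic_itv.
rewrite (_ : duhamel F t = fun x => \int[lam]_s
  (\int[mu]_y (F (s, y) * oseen_majorant (t - s)%R (x - y)%R) * (\1_(`]0%R, t[%classic) s)%:E)).
  apply: (@measurable_fun_fubini_tonelli_F _ _ _ _ _ lam (fun p : V * R =>
    \int[mu]_y (F (p.2, y) * oseen_majorant (t - p.2)%R (p.1 - y)%R) * (\1_(`]0%R, t[%classic) p.2)%:E)).
    apply: emeasurable_funM; first exact: measurable_conv.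
    by apply/measurable_EFinP; exact: (measurableT_comp mI).
  move=> p; rewrite mule_ge0 ?lee_fin// integral_ge0// => y _.
  by rewrite mule_ge0// oseen_majorant_ge0.
by apply/funext => x; rewrite /duhamel integral_mul_indic.
Qed.

(** [oseen_conv_mean] at each time [s] gives the factor [(t - s)^(-(1 + n rho)/2)].
    Because [2 theta + n rho <= 1], it exceeds [(t - s)^(theta - 1)] at most by a
    nonnegative power of [t - s < T]; equality in the index condition is the
    scaling-critical case. *)
Lemma duhamel_mean (rho theta T : R) : (0 <= rho < 2^-1)%R ->
  (2 * theta + n%:R * rho <= 1)%R -> (0 < T)%R ->
  exists2 C : R, (0 < C)%R & forall (F : R * V -> \bar R) (q : R -> \bar R) t,
  measurable_fun setT F -> (forall z, 0 <= F z) ->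
  measurable_fun setT q -> (forall s, 0 <= q s) -> (0 < t < T)%R ->
  ae_time t (fun s => mean_le mu (1 - 2 * rho) (fun y => F (s, y)) (q s)) ->
  mean_le mu (1 - rho) (duhamel F t)
    (C%:E * \int[lam]_s (q s * (time_kernel theta (t - s))%:E)).
Proof.
move=> hr hidx T0; have [C C0 hC] := @oseen_conv_mean R n rho hr.
pose L : R := (T `^ (1 - theta - (1 + n%:R * rho) / 2))%R.
have L0 : (0 < L)%R by rewrite powR_gt0.
exists (C * L)%R; first by rewrite mulr_gt0.
move=> F q t mF F0 mq q0 /andP[t0 tT] hF E mE fE.
set e := fine (mu E).
have e0 : (0 <= e `^ (1 - rho))%R by rewrite powR_ge0.
pose conv s x := \int[mu]_y (F (s, y) * oseen_majorant (t - s)%R (x - y)%R).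
have conv0 s x : 0 <= conv s x.
  by apply: integral_ge0 => y _; rewrite mule_ge0// oseen_majorant_ge0.
have mconv := measurable_conv t mF F0.
pose I : set R := `]0%R, t[%classic.
have mII : measurable I by exact: measurable_itv.
have mI : measurable_fun setT (\1_I : R -> R) by exact: measurable_indic.
have mIE : measurable_fun setT (\1_E : V -> R) by exact: measurable_indic.
have mconvs s : measurable_fun setT (conv s).
  exact: (measurableT_comp mconv (measurable_pair2 s)).
have mconvx x : measurable_fun setT (conv ^~ x).
  exact: (measurableT_comp mconv (measurable_pair1 x)).
have swap : \int[mu]_(x in E) duhamel F t x = \int[lam]_(s in I) \int[mu]_(x in E) conv s x.
  exact: (@ge0_integral_exchange _ _ _ mu _ _ lam (fun z : V * R => conv z.2 z.1)).
rewrite swap.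
pose B s := (C * L * e `^ (1 - rho))%:E * (q s * (time_kernel theta (t - s))%:E).
have mK : measurable_fun setT (fun s => q s * (time_kernel theta (t - s))%:E).
  apply: emeasurable_funM => //; apply/measurable_EFinP.
  apply: (measurableT_comp (measurable_time_kernel theta)); exact: measurable_funB.
have K0 s : 0 <= q s * (time_kernel theta (t - s))%:E.
  by rewrite mule_ge0// lee_fin time_kernel_ge0.
have CLe0 : (0 <= C * L * e `^ (1 - rho))%R by rewrite !mulr_ge0// ltW.
apply: (@le_trans _ _ (\int[lam]_(s in I) B s)).
  apply: ae_ge0_le_integral.
  - exact: mII.
  - by move=> s _; apply: integral_ge0.
  - apply: measurable_funTS.
    rewrite (_ : (fun s => _) = (fun s => \int[mu]_x (conv s x * (\1_E x)%:E))); last first.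
      by apply/funext => s; rewrite integral_mul_indic.
    apply: (@measurable_fun_fubini_tonelli_G _ _ _ _ _ mu (fun z : V * R => conv z.2 z.1 * (\1_E z.1)%:E)).
      by apply: emeasurable_funM => //; apply/measurable_EFinP; exact: (measurableT_comp mIE).
    by move=> z; rewrite mule_ge0// lee_fin.
  - by move=> s _; rewrite mule_ge0// lee_fin.
  - by apply: measurable_funTS; exact: emeasurable_funM.
  - apply: negligibleS hF => s /= /not_implyP[]; rewrite /I/= in_itv/= => /andP[s0 st] hs.
    split; first by rewrite s0 st.
    apply: contra_not hs => hs.
    have ts : (0 < t - s)%R by rewrite subr_gt0.
    have mFs : measurable_fun setT (fun y => F (s, y)) by exact: (measurableT_comp mF (measurable_pair1 s)).
    apply: (le_trans (hC _ (q s) _ mFs (fun y => F0 (s, y)) (q0 s) ts hs E mE fE)).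
    rewrite -/e /B muleAC [leRHS]muleCA muleC; apply: lee_wpmul2l => //.
    rewrite -!EFinM lee_fin mulrC [leRHS]mulrAC mulrC; apply: ler_wpM2r => //.
    rewrite -mulrA; apply: ler_wpM2l; first exact: ltW.
    rewrite /time_kernel indicE mem_set ?mulr1; last by rewrite /= in_itv/= ts.
    have -> : (- ((1 + n%:R * rho) / 2) = (1 - theta - (1 + n%:R * rho) / 2) + (theta - 1))%R by ring.
    rewrite [leLHS]powRD ?(gt_eqF ts) ?implybT//; apply: ler_wpM2r; first exact: powR_ge0.
    rewrite ge0_ler_powR ?nnegrE ?(ltW ts) ?(ltW T0)//; first by lra.
    by rewrite lerBlDr (le_trans (ltW tT))// lerDl ltW.
rewrite ge0_integralZl_EFin//; last exact: measurable_funTS.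
rewrite muleAC -EFinM lee_wpmul2l ?lee_fin//.
apply: ge0_subset_integral => //; exact: measurableT.
Qed.

End duhamel.

(** * The bilinear operator *)

Section bilinear.
Context {R : realType} {n : nat}.
Notation V := 'rV[R]_n.
Notation mu := (@lebesgue_rV R n).
Notation lam := (@lebesgue_measure R).
Local Open Scope ereal_scope.

Lemma enorm_coord (x : V) i : (`|x ord0 i| <= enorm x)%R.
Proof.
rewrite -(@ler_pXn2r _ 2) ?nnegrE ?enorm_ge0// enorm_sqr real_normK ?num_real//.
rewrite /dotp (bigD1 i)//= -expr2 lerDl sumr_ge0// => k _.
by rewrite -expr2 sqr_ge0.
Qed.

Lemma enorm_le_sum (x : V) : (enorm x <= \sum_i `|x ord0 i|)%R.
Proof.
have S0 : (0 <= \sum_i `|x ord0 i|)%R by rewrite sumr_ge0.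
rewrite -(@ler_pXn2r _ 2) ?nnegrE ?enorm_ge0// enorm_sqr expr2 mulr_suml.
apply: ler_sum => k _; rewrite -expr2 -[leLHS]real_normK ?num_real// expr2.
by rewrite ler_wpM2l// (bigD1 k)//= lerDl sumr_ge0.
Qed.

Lemma enorm_sub_le (x y : V) : (enorm (x - y) <= n%:R * (enorm x + enorm y))%R.
Proof.
apply: (le_trans (enorm_le_sum _)).
apply: (@le_trans _ _ (\sum_(i < n) (enorm x + enorm y))%R).
  apply: ler_sum => i _; rewrite !mxE.
  by apply: (le_trans (ler_normB _ _)); rewrite lerD// enorm_coord.
by rewrite sumr_const card_ord mulr_natl.
Qed.

(** Equality holds at every [x], which is what the true supremum norm requires. *)
Lemma bilinear_op_off_null (u u' : R -> V -> V) t x :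
  ae_time t (fun s => mu.-negligible [set y | u s y <> u' s y]) ->
  bilinear_op u u t x = bilinear_op u' u' t x.
Proof.
move=> uu'; apply/rowP => i; rewrite mxE [RHS]mxE /Rintegral; congr fine.
apply: integral_off_null; apply: negligibleS uu' => s [/=]; rewrite in_itv/= => s0t hs.
split => //; apply: contra_not hs => hs; congr (fine _)%:E.
apply: integral_off_null; apply: negligibleS hs => y [_ /=]; apply: contra_not => uu.
by under eq_bigr do under eq_bigr do rewrite uu.
Qed.

(** The space-time integrand of the [i]-th component of the bilinear operator,
    with a general [p] in place of the tensor [u_j v_k], to allow for differences of
    such tensors. *)
Definition duhamel_form (i : 'I_n) t x (p : 'I_n -> 'I_n -> R * V -> R) (z : R * V) : R :=
  (\1_(`]0%R, t[%classic) z.1 *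
   \sum_(j < n) \sum_(k < n) grad_oseen_int k i j (t - z.1) (x - z.2) * p j k z)%R.

Lemma measurable_duhamel_form i t x p : (forall j k, measurable_fun setT (p j k)) ->
  measurable_fun setT (duhamel_form i t x p).
Proof.
move=> mp.
have mI : measurable_fun setT (\1_(`]0%R, t[%classic) : R -> R).
  exact: measurable_indic_itv.
apply: measurable_funM.
  exact: (measurableT_comp mI measurable_fst).
apply: measurable_sum => j; apply: measurable_sum => k; apply: measurable_funM => //.
apply: (measurableT_comp (@measurable_grad_oseen_int R n k i j)
  (g := fun z : R * V => (t - z.1, x - z.2)%R)).
apply/measurable_fun_pairP; split; first exact: measurable_funB.
exact: (measurable_rVB (measurable_cst x) measurable_snd).
Qed.

Lemma duhamel_formB i t x p p' z :
  (duhamel_form i t x p z - duhamel_form i t x p' z =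
   duhamel_form i t x (fun j k z => p j k z - p' j k z) z)%R.
Proof.
rewrite /duhamel_form -mulrBr -sumrB; congr (_ * _)%R; apply: eq_bigr => j _.
by rewrite -sumrB; apply: eq_bigr => k _; rewrite mulrBr.
Qed.

Lemma grad_oseen_sum_bound : exists2 C : R, (0 < C)%R & forall i t (x : V), (0 < t)%R ->
  (\sum_(j < n) \sum_(k < n) `|grad_oseen_int k i j t x|)%:E <= C%:E * oseen_majorant t x.
Proof.
have /choice[c hc] : forall a : 'I_n * 'I_n * 'I_n, exists C : R, (0 < C)%R /\
    forall t (x : V), (0 < t)%R ->
    (`|grad_oseen_int a.2 a.1.1 a.1.2 t x|)%:E <= C%:E * oseen_majorant t x.
  move=> a; have [C C0 hC] := @grad_oseen_bound R n a.2 a.1.1 a.1.2.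
  by exists C; split => // t x t0; rewrite -grad_oseenE// hC.
have c0 a : (0 < c a)%R by have [] := hc a.
pose S := (\sum_a c a)%R.
have S0 : (0 <= S)%R by rewrite sumr_ge0// => a _; exact: ltW.
have cS a : (c a <= S)%R by rewrite /S (bigD1 a)//= lerDl sumr_ge0// => b _; exact: ltW.
exists (n%:R * (n%:R * S) + 1)%R; first by rewrite ltr_wpDl// !mulr_ge0.
move=> i t x t0; have m0 := oseen_majorant_ge0 t x.
have [moo|] := eqVneq (oseen_majorant t x) +oo.
  by rewrite moo gt0_muley ?leey// lte_fin ltr_wpDl// !mulr_ge0.
rewrite -ltey -ge0_fin_numE// => mfin.
move: m0; rewrite -(fineK mfin) -EFinM !lee_fin; set M := fine _ => M0.
have bound j k : (`|grad_oseen_int k i j t x| <= S * M)%R.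
  have [_ h] := hc (i, j, k); rewrite -lee_fin; apply: (le_trans (h t x t0)).
  by rewrite -(fineK mfin) -EFinM lee_fin ler_wpM2r.
apply: (@le_trans _ _ (\sum_(j < n) \sum_(k < n) (S * M))%R).
  by apply: ler_sum => j _; apply: ler_sum => k _.
under eq_bigr do rewrite sumr_const card_ord -(mulr_natl (S * M)).
rewrite sumr_const card_ord -(mulr_natl (n%:R * (S * M))).
by rewrite mulrDl mul1r -!mulrA lerDl.
Qed.

Lemma duhamel_form_bound : exists2 C : R, (0 < C)%R &
  forall i t (x : V) p (D : R * V -> R), measurable_fun setT D -> (forall z, 0 <= D z)%R ->
  (forall j k z, `|p j k z| <= D z)%R ->
  \int[lam]_s \int[mu]_y `|(duhamel_form i t x p (s, y))%:E| <= C%:E * duhamel (EFin \o D) t x.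
Proof.
have [C C0 hC] := grad_oseen_sum_bound.
exists C => // i t x p D mD D0 pD.
have mDE : measurable_fun setT (EFin \o D) by exact/measurable_EFinP.
have mI : measurable_fun setT (\1_(`]0%R, t[%classic) : R -> R).
  exact: measurable_indic_itv.
pose g s y := (D (s, y))%:E * oseen_majorant (t - s)%R (x - y)%R.
have g0 s y : 0 <= g s y by rewrite mule_ge0 ?lee_fin// oseen_majorant_ge0.
pose I : R -> R := \1_(`]0%R, t[%classic).
apply: (@le_trans _ _ (\int[lam]_s \int[mu]_y ((C * I s)%:E * g s y))).
  apply: ge0_le_integral_any => s _; first exact: integral_ge0.
  apply: ge0_le_integral_any => y _; first exact: abse_ge0.
  rewrite /duhamel_form/= /I indicE; case: (boolP (s \in _)) => [/set_mem/=|_]; last first.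
    by rewrite mul0r normr0 mulr0 mul0e.
  rewrite in_itv/= => /andP[s0 st]; rewrite mul1r mulr1.
  have ts : (0 < t - s)%R by rewrite subr_gt0.
  apply: (@le_trans _ _ ((D (s, y))%:E * (\sum_(j < n) \sum_(k < n) `|grad_oseen_int k i j (t - s) (x - y)|)%:E)).
    rewrite -EFinM lee_fin mulr_sumr; apply: (le_trans (ler_norm_sum _ _ _)); apply: ler_sum => j _.
    rewrite mulr_sumr; apply: (le_trans (ler_norm_sum _ _ _)); apply: ler_sum => k _.
    by rewrite normrM mulrC ler_wpM2r.
  by rewrite /g muleCA lee_wpmul2l ?lee_fin// hC.
have mg2 := measurable_duhamel_integrand t mDE.
have mgs s : measurable_fun setT (g s).
  exact: (measurableT_comp mg2 (measurable_pair1 (x, s))).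
have mxz : measurable_fun setT (fun z : R * V => (x, z.1)).
  by apply/measurable_fun_pairP; split; [exact: measurable_cst|exact: measurable_fst].
have I0 s : (0 <= I s)%R by rewrite /I indicE.
have CI0 s : (0 <= C * I s)%R by rewrite mulr_ge0// ltW.
have E1 s : \int[mu]_y ((C * I s)%:E * g s y) = C%:E * (\int[mu]_y g s y * (I s)%:E).
  by rewrite ge0_integralZl_EFin// EFinM -muleA (muleC (I s)%:E).
under eq_integral do rewrite E1.
rewrite ge0_integralZl_EFin; last 4 first.
- exact: measurableT.
- by move=> s _; rewrite mule_ge0 ?lee_fin// integral_ge0.
- apply: emeasurable_funM; last by apply/measurable_EFinP; exact: mI.
  apply: (@measurable_fun_fubini_tonelli_F _ _ _ _ _ mu (fun z : R * V => g z.1 z.2)).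
    apply: (measurableT_comp mg2 (g := fun z : R * V => ((x, z.1), z.2))).
    apply/measurable_fun_pairP; split; last exact: measurable_snd.
    exact: mxz.
  by move=> z; exact: g0.
- exact: ltW.
by rewrite /duhamel [in leRHS]integral_mul_indic.
Qed.

(** Two iterated integrals can be subtracted once they are absolutely convergent
    integrals over space-time. *)
Lemma bilinear_opE (U : R * V -> V) i t x :
  let p := fun (j k : 'I_n) z => (U z ord0 j * U z ord0 k)%R in
  (lam \x mu).-integrable setT (EFin \o duhamel_form i t x p) ->
  (bilinear_op (fun s y => U (s, y)) (fun s y => U (s, y)) t x) ord0 i =
  (\int[lam \x mu]_z duhamel_form i t x p z)%R.
Proof.
move=> p hint; rewrite mxE /Rintegral; congr fine.
rewrite -(integral12_prod_meas1 hint) /fubini_F integral_mkcond.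
have := ae_integrable1 hint; rewrite /almost_everywhere => hae.
apply: integral_off_null; apply: negligibleS hae => s [_ /=]; apply: contra_not => hs.
have fin := integrable_fin_num measurableT hs.
rewrite patchE; case: ifPn => [/set_mem/=|sI].
  rewrite in_itv/= => /andP[s0 st]; rewrite -(fineK fin); congr (fine _)%:E.
  apply: eq_integral => y _; rewrite /duhamel_form/= indicE mem_set/= ?in_itv/= ?s0// mul1r.
  congr EFin; apply: eq_bigr => j _; apply: eq_bigr => k _.
  by rewrite grad_oseenE ?subr_gt0// mulrA.
rewrite integral0_eq// => y _; rewrite /duhamel_form/= indicE (negbTE sI).
by rewrite mul0r.
Qed.

(** [U_j U_k - W_j W_k = (U - W)_j U_k + (U - W)_k W_j]. *)
Lemma bilinear_op_diff : exists2 C : R, (0 < C)%R & forall (U W : R * V -> V) t x,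
  measurable_fun setT U -> measurable_fun setT W ->
  duhamel (fun z => (enorm (U z) * enorm (U z))%:E) t x < +oo ->
  duhamel (fun z => (enorm (W z) * enorm (W z))%:E) t x < +oo ->
  (enorm (bilinear_op (fun s y => U (s, y)) (fun s y => U (s, y)) t x -
          bilinear_op (fun s y => W (s, y)) (fun s y => W (s, y)) t x))%:E <=
  C%:E * duhamel (fun z => (enorm (U z - W z) * (enorm (U z) + enorm (W z)))%:E) t x.
Proof.
have [C C0 hC] := duhamel_form_bound.
have nC0 : (0 < n%:R * C + 1)%R by rewrite ltr_wpDl// mulr_ge0// ltW.
exists (n%:R * C + 1)%R => // U W t x mU mW fU fW.
pose pU (j k : 'I_n) z := (U z ord0 j * U z ord0 k)%R.
pose pW (j k : 'I_n) z := (W z ord0 j * W z ord0 k)%R.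
pose D z := (enorm (U z - W z) * (enorm (U z) + enorm (W z)))%R.
have mE (G : R * V -> V) : measurable_fun setT G -> measurable_fun setT (fun z => enorm (G z)).
  exact: measurable_enorm.
have mp (G : R * V -> V) : measurable_fun setT G ->
    forall j k : 'I_n, measurable_fun setT (fun z => G z ord0 j * G z ord0 k)%R.
  by move=> mG j k; apply: measurable_funM; exact: measurable_coordT.
have formint (G : R * V -> V) i : measurable_fun setT G ->
    duhamel (fun z => (enorm (G z) * enorm (G z))%:E) t x < +oo ->
    (lam \x mu).-integrable setT
      (EFin \o duhamel_form i t x (fun (j k : 'I_n) z => G z ord0 j * G z ord0 k)%R).
  move=> mG fG; apply/integrable12ltyP.
    by apply/measurable_EFinP; apply: measurable_duhamel_form; exact: mp.
  apply: (le_lt_trans (hC i t x _ (fun z => enorm (G z) * enorm (G z))%R _ _ _)).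
  - by apply: measurable_funM; exact: mE.
  - by move=> z; rewrite mulr_ge0// enorm_ge0.
  - by move=> j k z; rewrite normrM ler_pM// enorm_coord.
  - by rewrite lte_mul_pinfty// ?lee_fin ltW.
have D0 z : (0 <= D z)%R by rewrite mulr_ge0 ?addr_ge0 ?enorm_ge0.
have mD : measurable_fun setT D.
  apply: measurable_funM; first by apply: mE; exact: measurable_rVB.
  by apply: measurable_funD; exact: mE.
have pD j k z : (`|pU j k z - pW j k z| <= D z)%R.
  have -> : (pU j k z - pW j k z = (U z - W z) ord0 j * U z ord0 k +
      (U z - W z) ord0 k * W z ord0 j)%R by rewrite /pU /pW !mxE; ring.
  apply: (le_trans (ler_normD _ _)); rewrite /D mulrDr !normrM.
  by apply: lerD; apply: ler_pM => //; exact: enorm_coord.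
have comp i : (`|(bilinear_op (fun s y => U (s, y)) (fun s y => U (s, y)) t x) ord0 i -
    (bilinear_op (fun s y => W (s, y)) (fun s y => W (s, y)) t x) ord0 i|)%:E <=
    C%:E * duhamel (EFin \o D) t x.
  have iU := formint U i mU fU; have iW := formint W i mW fW.
  rewrite (bilinear_opE iU) (bilinear_opE iW) -RintegralB//.
  have iB : (lam \x mu).-integrable setT (EFin \o (fun z => duhamel_form i t x pU z - duhamel_form i t x pW z)%R).
    rewrite (_ : EFin \o _ = (EFin \o duhamel_form i t x pU) \- (EFin \o duhamel_form i t x pW)).
      exact: integrableB.
    by apply/funext => z.
  apply: (@le_trans _ _ (\int[lam \x mu]_z `|(duhamel_form i t x (fun j k z => pU j k z - pW j k z)%R z)%:E|)).
    rewrite -[X in X <= _]/(`|(fine _)%:E|) fineK; last exact: integrable_fin_num.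
    apply: (le_trans (le_abse_integral _ measurableT _)).
      exact: measurable_int iB.
    by under eq_integral do rewrite duhamel_formB.
  have mF : measurable_fun setT (EFin \o duhamel_form i t x (fun j k z => pU j k z - pW j k z)%R).
    apply/measurable_EFinP; apply: measurable_duhamel_form => j k.
    by apply: measurable_funB; exact: mp.
  pose G z := `|(duhamel_form i t x (fun j k z => pU j k z - pW j k z)%R z)%:E|.
  apply: (@le_trans _ _ (\int[lam]_s \int[mu]_y G (s, y))); last exact: hC.
  apply: le_of_eq.
  have mG : measurable_fun setT G by exact: measurableT_comp.
  exact: (@fubini_tonelli1 _ _ _ _ _ lam mu G mG (fun z => abse_ge0 _)).
have d0 : 0 <= duhamel (EFin \o D) t x by apply: duhamel_ge0 => z; rewrite lee_fin.
have [doo|] := eqVneq (duhamel (EFin \o D) t x) +oo.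
  by rewrite [X in _ * X]doo gt0_muley ?leey// lte_fin.
rewrite -ltey -ge0_fin_numE// => dfin.
rewrite -[X in _ * X](fineK dfin) -EFinM lee_fin.
apply: (le_trans (enorm_le_sum _)).
apply: (@le_trans _ _ (\sum_(i < n) (C * fine (duhamel (EFin \o D) t x)))%R).
  apply: ler_sum => i _; rewrite -lee_fin EFinM (fineK dfin) !mxE.
  by have := comp i; rewrite !mxE.
rewrite sumr_const card_ord -(mulr_natl (_ * _)) mulrDl mul1r mulrA lerDl.
exact: fine_ge0.
Qed.

End bilinear.

(** * Uniqueness for Borel paths *)

Section uniqueness.
Context {R : realType} {n : nat}.
Notation V := 'rV[R]_n.
Notation mu := (@lebesgue_rV R n).
Notation lam := (@lebesgue_measure R).
Local Open Scope ereal_scope.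

Lemma le0_halving (x : \bar R) (c : R) : (0 <= c)%R ->
  (forall k : nat, x <= (c / 2 ^+ k)%:E) -> x <= 0.
Proof.
move=> c0 hx; apply/lee_addgt0Pr => e e0; rewrite add0e.
have [|j /andP[_ hj]] := @dyadic_floor R (Num.max 1 (c / e))%R; first by rewrite le_max lexx.
apply: (le_trans (hx j.+1)); rewrite lee_fin ler_pdivrMr ?exprn_gt0// mulrC -ler_pdivrMr//.
by apply: le_trans (ltW hj); rewrite le_max lexx orbT.
Qed.

Lemma ae_time_after (b a : R) (P : R -> Prop) : ae_time a P ->
  ae_time b (fun s => (s <= a)%R -> P s).
Proof.
move=> hP; have ha : lam.-negligible [set a].
  by exists [set a]; split => //; exact: lebesgue_measure_set1.
apply: negligibleS (negligibleU hP ha) => s /= [/andP[s0 sb]] /not_implyP[].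
by rewrite le_eqVlt => /orP[/eqP -> _|sa hs]; [right|left; rewrite s0 sa].
Qed.

Context (rho theta alpha T : R) (U W : R * V -> V) (h : R -> R).
Context (rho_itv : (0 <= rho < 2^-1)%R) (theta_itv : (0 < theta < 2^-1)%R)
  (thetaE : theta = (alpha^-1)%R)
  (index_le1 : (2 * theta + n%:R * rho <= 1)%R) (T0 : (0 < T)%R)
  (mU : measurable_fun setT U) (mW : measurable_fun setT W)
  (mh : measurable_fun setT h) (h0 : forall s, (0 < h s)%R)
  (htail : vanishing_tail alpha (fun y => lam [set t | y < h t]%R))
  (weakU : ae_time T (fun s => weak_le mu rho (fun x => enorm (U (s, x))) (h s)))
  (weakW : ae_time T (fun s => weak_le mu rho (fun x => enorm (W (s, x))) (h s))).

Let alpha0 : (0 < alpha)%R.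
Proof. by case/andP : theta_itv => + _; rewrite thetaE invr_gt0. Qed.

Let rho1 : (0 <= rho < 1)%R.
Proof. by case/andP : rho_itv => -> r1 /=; lra. Qed.

Let theta1 : (0 <= theta < 1)%R.
Proof. by case/andP : theta_itv => /ltW -> r1 /=; lra. Qed.

Let mE (G : R * V -> V) : measurable_fun setT G -> measurable_fun setT (fun z => enorm (G z)).
Proof. exact: measurable_enorm. Qed.

Let mEs (G : R * V -> V) s : measurable_fun setT G ->
  measurable_fun setT (fun x : V => enorm (G (s, x))).
Proof. by move=> mG; exact: (measurableT_comp (mE mG) (measurable_pair1 s)). Qed.

Let mI (a b : R) : measurable_fun setT (\1_(`]a, b[%classic) : R -> R).
Proof. exact: measurable_indic_itv. Qed.

Let hI (a b : R) (s : R) : R := (h s * \1_(`]a, b[%classic) s)%R.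

Let mhI a b : measurable_fun setT (hI a b).
Proof. exact: measurable_funM. Qed.

Let hI0 a b s : (0 <= hI a b s)%R.
Proof. by rewrite mulr_ge0// ltW. Qed.

Let space_product : exists2 C : R, (0 < C)%R & forall (f k : V -> R) A (H : R),
  measurable_fun setT f -> (forall x, 0 <= f x)%R ->
  measurable_fun setT k -> (forall x, 0 <= k x)%R -> 0 <= A -> (0 < H)%R ->
  mean_le mu (1 - rho) (EFin \o f) A -> weak_le mu rho k H ->
  mean_le mu (1 - 2 * rho) (fun x => (f x * k x)%:E) ((C * H)%:E * A).
Proof.
case/andP : rho_itv => r0 r1; have rr : (rho < 1 - rho)%R by lra.
have [C C0 hC] := mean_le_mul mu r0 rr.
exists C => // f k A H mf f0 mk k0 A0 H0 hf hk.
have mfE : measurable_fun setT (EFin \o f) by exact/measurable_EFinP.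
have := hC (EFin \o f) k A H mfE (fun x => f0 x) mk k0 A0 H0 hf hk.
by rewrite (_ : (1 - rho - rho = 1 - 2 * rho)%R); last by ring.
Qed.

Let time_product : exists2 C : R, (0 < C)%R & forall (g : R -> \bar R) (k : R -> R) A (H : R),
  measurable_fun setT g -> (forall s, 0 <= g s) ->
  measurable_fun setT k -> (forall s, 0 <= k s)%R -> 0 <= A -> (0 < H)%R ->
  mean_le lam (1 - theta) g A -> weak_le lam theta k H ->
  mean_le lam (1 - 2 * theta) (fun s => g s * (k s)%:E) ((C * H)%:E * A).
Proof.
case/andP : theta_itv => r0 r1; have rr : (theta < 1 - theta)%R by lra.
have [C C0 hC] := mean_le_mul lam (ltW r0) rr.
exists C => // g k A H mg g0 mk k0 A0 H0 hg hk.
have := hC g k A H mg g0 mk k0 A0 H0 hg hk.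
by rewrite (_ : (1 - theta - theta = 1 - 2 * theta)%R); last by ring.
Qed.

Let weak_hI : exists2 H : R, (0 < H)%R & weak_le lam theta (hI 0 T) H.
Proof.
have [y0 y00 hy] := vanishing_tail_weak alpha0 mh h0 htail ltr01.
exists (Num.max 1 (y0 * (T - 0) `^ alpha^-1))%R; first by rewrite lt_max ltr01.
by rewrite thetaE; apply: hy; exact: ltW.
Qed.

Let short_hI e : (0 < e)%R -> exists2 dlt : R, (0 < dlt)%R &
  forall a b : R, (a <= b)%R -> (b - a <= dlt)%R -> weak_le lam theta (hI a b) e.
Proof.
move=> e0; have [y0 y00 hy] := vanishing_tail_weak alpha0 mh h0 htail e0.
exists ((e / y0) `^ alpha)%R; first by rewrite powR_gt0// divr_gt0.
move=> a b ab bad; have := hy a b ab; rewrite -thetaE max_l//.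
rewrite mulrC -ler_pdivlMr// (_ : (e / y0 = ((e / y0) `^ alpha) `^ theta)%R).
  by case/andP : theta1 => th0 _; rewrite ge0_ler_powR ?nnegrE ?powR_ge0 ?subr_ge0.
by rewrite -powRrM thetaE mulfV ?gt_eqF// powRr1// ltW// divr_gt0.
Qed.

(** The chain of estimates of the contraction (product in space, smoothing in space,
    product in time, smoothing in time) applied to [|G|^2] makes the nonlinear
    terms absolutely convergent almost everywhere. *)
Lemma duhamel_square_fin (G : R * V -> V) : measurable_fun setT G ->
  ae_time T (fun s => weak_le mu rho (fun x => enorm (G (s, x))) (h s)) ->
  ae_time T (fun t => mu.-negligible
    [set x | ~ duhamel (fun z => (enorm (G z) * enorm (G z))%:E) t x < +oo]).
Proof.
move=> mG weakG.
have [H H0 hH] := weak_hI.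
have [C1 C10 hC1] := weak_le_mean mu rho1.
have [C2 C20 hC2] := weak_le_mean lam theta1.
have [C3 C30 hC3] := space_product.
have [C4 C40 hC4] := time_product.
have [C5 C50 hC5] := duhamel_mean rho_itv index_le1 T0.
have [C6 C60 hC6] := time_conv_mean theta_itv.
pose F z := (enorm (G z) * enorm (G z))%:E : \bar R.
have mF : measurable_fun setT F.
  by apply/measurable_EFinP; apply: measurable_funM; exact: mE.
have F0 z : 0 <= F z by rewrite lee_fin mulr_ge0// enorm_ge0.
pose q s := (C3 * C1)%:E * ((hI 0 T s)%:E * (hI 0 T s)%:E).
have mhE : measurable_fun setT (fun s => (hI 0 T s)%:E) by exact/measurable_EFinP.
have mhh : measurable_fun setT (fun s => (hI 0 T s)%:E * (hI 0 T s)%:E) by exact: emeasurable_funM.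
have hh0 s : 0 <= (hI 0 T s)%:E * (hI 0 T s)%:E by rewrite mule_ge0// lee_fin.
have C310 : (0 <= C3 * C1)%R by rewrite mulr_ge0// ltW.
have mq : measurable_fun setT q by exact: emeasurable_funM.
have q0 s : 0 <= q s by rewrite mule_ge0// lee_fin.
have meanF : ae_time T (fun s => mean_le mu (1 - 2 * rho) (fun x => F (s, x)) (q s)).
  apply: ae_time_imp weakG => s sT hs.
  have mGs := mEs s mG.
  have E0 x : (0 <= enorm (G (s, x)))%R by exact: enorm_ge0.
  have := hC3 _ _ _ (h s) mGs E0 mGs E0 _ (h0 s) (hC1 _ _ mGs E0 (h0 s) hs) hs.
  rewrite lee_fin mulr_ge0 ?(ltW (h0 s)) ?(ltW C10)// => /(_ isT).
  apply: mean_le_weaken; rewrite /q /hI indicE mem_set ?mulr1; last by rewrite /= in_itv.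
  by rewrite -!EFinM lee_fin; apply: le_of_eq; ring.
have meanh : mean_le lam (1 - theta) (EFin \o hI 0 T) (C2 * H)%:E.
  exact: (hC2 _ _ (mhI 0 T) (hI0 0 T) H0 hH).
have A0 : 0 <= (C2 * H)%:E :> \bar R by rewrite lee_fin mulr_ge0// ltW.
have meanq : mean_le lam (1 - 2 * theta) q ((C3 * C1)%:E * ((C4 * H)%:E * (C2 * H)%:E)).
  apply: mean_leZ => //.
  exact: (hC4 (EFin \o hI 0 T) _ _ H mhE (fun s => hI0 0 T s) (mhI 0 T) (hI0 0 T) A0 H0 meanh hH).
have A1 : 0 <= (C3 * C1)%:E * ((C4 * H)%:E * (C2 * H)%:E) :> \bar R.
  by rewrite -!EFinM lee_fin !mulr_ge0// ltW.
have := hC6 q _ mq q0 A1 meanq.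
set g := fun t => _; rewrite -!EFinM => meang.
have mg : measurable_fun setT g.
  apply: measurable_time_conv => //; first exact: measurable_time_kernel.
  exact: time_kernel_ge0.
have g0 t : 0 <= g t.
  by apply: integral_ge0 => s _; rewrite mule_ge0// lee_fin time_kernel_ge0.
have gfin : ae_time T (fun t => g t < +oo).
  apply: negligibleS (mean_le_ae_fin mg g0 meang) => t /= [_]; exact.
apply: ae_time_imp gfin => t /andP[t0 tT] gt.
have := hC5 F q t mF F0 mq q0 _ (ae_time_le (ltW tT) meanF).
rewrite t0 tT => /(_ isT); rewrite -/(g t).
have gtf : g t \is a fin_num by rewrite ge0_fin_numE.
rewrite -(fineK gtf) -EFinM; apply: mean_le_ae_fin.
  exact: measurable_duhamel.
by move=> x; exact: duhamel_ge0.
Qed.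

Context (equation : ae_time T (fun t => mu.-negligible [set x | ~
  (U (t, x) + bilinear_op (fun s y => U (s, y)) (fun s y => U (s, y)) t x =
   W (t, x) + bilinear_op (fun s y => W (s, y)) (fun s y => W (s, y)) t x)%R])).

Let w z : R := enorm (U z - W z).
Let D z : \bar R := (w z * (enorm (U z) + enorm (W z)))%:E.

Let mw : measurable_fun setT w.
Proof. by apply: mE; exact: measurable_rVB. Qed.

Let mws s : measurable_fun setT (fun x : V => w (s, x)).
Proof. exact: (measurableT_comp mw (measurable_pair1 s)). Qed.

Let w0 z : (0 <= w z)%R. Proof. exact: enorm_ge0. Qed.

Let mD : measurable_fun setT D.
Proof.
apply/measurable_EFinP; apply: measurable_funM => //.
by apply: measurable_funD; exact: mE.
Qed.

Let D0 z : 0 <= D z.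
Proof. by rewrite lee_fin mulr_ge0// addr_ge0// enorm_ge0. Qed.

Lemma difference_duhamel : exists2 C : R, (0 < C)%R & ae_time T (fun t => mu.-negligible
  [set x | ~ (w (t, x))%:E <= C%:E * duhamel D t x]).
Proof.
have [C C0 hC] := @bilinear_op_diff R n.
exists C => //.
have finU := duhamel_square_fin mU weakU.
have finW := duhamel_square_fin mW weakW.
apply: ae_time_imp (ae_timeI equation (ae_timeI finU finW)) => t tT [eqt [fU fW]].
apply: negligibleS (negligibleU eqt (negligibleU fU fW)) => x /=; apply: contra_notP.
move=> /not_orP[/contrapT hx] /not_orP[/contrapT hU /contrapT hW].
have -> : w (t, x) = enorm (bilinear_op (fun s y => W (s, y)) (fun s y => W (s, y)) t x -
    bilinear_op (fun s y => U (s, y)) (fun s y => U (s, y)) t x).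
  rewrite /w; congr enorm; move: hx; set b := bilinear_op _ _ _ _; set d := bilinear_op _ _ _ _.
  move=> hx; have -> : (U (t, x) = W (t, x) + d - b)%R by rewrite -hx addrK.
  by rewrite (addrC (W _)) [(d + _ - b)%R]addrAC addrK.
have -> : D = fun z => (enorm (W z - U z) * (enorm (W z) + enorm (U z)))%:E.
  apply/funext => z; rewrite /D /w; congr EFin.
  rewrite (addrC (enorm (W z))); congr (_ * _)%R.
  rewrite -(opprB (W z)) /enorm; congr (Num.sqrt _); rewrite /dotp; apply: eq_bigr => k _.
  by rewrite mxE mulrNN.
exact: (hC W U t x mW mU hW hU).
Qed.

(** The state of the iteration. The profile [g] of the difference is supported in
    [(a, b)] because the difference already vanishes before [a]; hence only the
    size of [h] on [(a, b)] enters the next step. *)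
Let bounded_by (a b G : R) : Prop := exists g : R -> \bar R,
  [/\ measurable_fun setT g, forall s, 0 <= g s,
      forall s, ~~ (a < s < b)%R -> g s = 0,
      mean_le lam (1 - theta) g G%:E &
      ae_time b (fun s => mean_le mu (1 - rho) (fun x => (w (s, x))%:E) (g s))].

Let vanishes_before (a : R) : Prop :=
  ae_time a (fun t => mu.-negligible [set x | U (t, x) <> W (t, x)]).

Let mean_vanish s (A : \bar R) : 0 <= A -> mu.-negligible [set x | U (s, x) <> W (s, x)] ->
  mean_le mu (1 - rho) (fun x => (w (s, x))%:E) A.
Proof.
move=> A0 hs.
have z : mean_le mu (1 - rho) (fun _ : V => 0 : \bar R) A.
  by move=> E mE' fE; rewrite integral0 mule_ge0// lee_fin powR_ge0.
apply: mean_le_off_null z.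
- exact/measurable_EFinP.
- by move=> x; rewrite lee_fin.
- exact: measurable_cst.
- by move=> x.
apply: negligibleS hs => x /=; apply: contra_not => UW.
rewrite /w UW subrr /enorm /dotp big1 ?sqrtr0// => k _.
by rewrite !mxE mul0r.
Qed.

(** The a priori bound [|U - W| <= n (|U| + |W|)], in which both terms have the
    spatial size [h]. *)
Lemma bounded_start a b : (0 <= a)%R -> (a <= b)%R -> (b <= T)%R -> vanishes_before a ->
  weak_le lam theta (hI a b) 1 -> exists2 G : R, (0 <= G)%R & bounded_by a b G.
Proof.
move=> a0 ab bT hva hH.
have [C1 C10 hC1] := weak_le_mean mu rho1.
have [C2 C20 hC2] := weak_le_mean lam theta1.
pose c := (n%:R * (C1 + C1))%R.
have c0 : (0 <= c)%R by rewrite mulr_ge0// addr_ge0// ltW.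
exists (c * (C2 * 1))%R; first exact: (mulr_ge0 c0 (mulr_ge0 (ltW C20) ler01)).
have mhE : measurable_fun setT (EFin \o hI a b) by exact/measurable_EFinP.
exists (fun s => c%:E * (hI a b s)%:E); split.
- exact: emeasurable_funM.
- by move=> s; rewrite mule_ge0// lee_fin.
- move=> s hs; rewrite /hI indicE memNset ?mulr0 ?mule0//=.
  by rewrite in_itv/=; exact/negP.
- have := @mean_leZ _ _ _ lam _ _ _ _ c0 mhE (fun s => hI0 a b s) (hC2 _ _ (mhI a b) (hI0 a b) ltr01 hH).
  by rewrite -EFinM.
have wk := ae_timeI (ae_time_le bT weakU) (ae_time_le bT weakW).
apply: ae_time_imp (ae_timeI wk (ae_time_after b hva)) => s /andP[s0 sb] [[hU hW] hz].
have [sa|sa] := leP s a.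
  by apply: mean_vanish; [rewrite mule_ge0// lee_fin|exact: hz].
have mUs := mEs s mU; have mWs := mEs s mW.
have U0 x : (0 <= enorm (U (s, x)))%R by exact: enorm_ge0.
have W0 x : (0 <= enorm (W (s, x)))%R by exact: enorm_ge0.
have A0 : 0 <= (C1 * h s)%:E :> \bar R by rewrite lee_fin mulr_ge0// ltW.
have mUsE : measurable_fun setT (fun x : V => (enorm (U (s, x)))%:E) by exact/measurable_EFinP.
have mWsE : measurable_fun setT (fun x : V => (enorm (W (s, x)))%:E) by exact/measurable_EFinP.
have sum := mean_leD mUsE (fun x => U0 x) mWsE (fun x => W0 x) A0 A0
  (hC1 _ _ mUs U0 (h0 s) hU) (hC1 _ _ mWs W0 (h0 s) hW).
have sum0 x : 0 <= (enorm (U (s, x)))%:E + (enorm (W (s, x)))%:E by rewrite adde_ge0// lee_fin.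
have msum : measurable_fun setT (fun x : V => (enorm (U (s, x)))%:E + (enorm (W (s, x)))%:E).
  exact: emeasurable_funD.
have scaled := mean_leZ (ler0n R n) msum sum0 sum.
apply: (@mean_le_weaken _ _ _ mu _ _ (n%:R%:E * ((C1 * h s)%:E + (C1 * h s)%:E))).
  rewrite /hI indicE mem_set ?mulr1; last by rewrite /= in_itv/= sa sb.
  by rewrite -EFinD -!EFinM lee_fin; apply: le_of_eq; rewrite /c; ring.
apply: mean_le_fun scaled.
- exact/measurable_EFinP.
- by move=> x; rewrite lee_fin.
- exact: emeasurable_funM.
- by move=> x; rewrite -EFinD -EFinM lee_fin; exact: enorm_sub_le.
Qed.

(** One application of [difference_duhamel] multiplies the size by [K] times the weak
    size of [h] on [(a, b)], where [K] is a product of the constants of the four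
    estimates and does not depend on the interval. *)
Lemma bounded_halve : exists2 e : R, (0 < e)%R & forall a b G : R,
  (0 <= a)%R -> (a <= b)%R -> (b <= T)%R -> (0 <= G)%R -> vanishes_before a ->
  weak_le lam theta (hI a b) e -> bounded_by a b G -> bounded_by a b (G / 2).
Proof.
have [C0 C00 hC0] := difference_duhamel.
have [C3 C30 hC3] := space_product.
have [C4 C40 hC4] := time_product.
have [C5 C50 hC5] := duhamel_mean rho_itv index_le1 T0.
have [C6 C60 hC6] := time_conv_mean theta_itv.
pose K := (C0 * C5 * C6 * (C3 + C3) * C4)%R.
have K0 : (0 < K)%R by rewrite !mulr_gt0// addr_gt0.
exists ((2 * K)^-1)%R; first by rewrite invr_gt0 mulr_gt0.
set e := ((2 * K)^-1)%R.
have e0 : (0 < e)%R by rewrite invr_gt0 mulr_gt0.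
move=> a b G a0 ab bT G0 hva hH [g [mg g0 gab meang gw]].
have mhE : measurable_fun setT (EFin \o hI a b) by exact/measurable_EFinP.
pose q s := (C3 + C3)%:E * (g s * (hI a b s)%:E).
have C330 : (0 <= C3 + C3)%R by rewrite addr_ge0// ltW.
have mgh : measurable_fun setT (fun s => g s * (hI a b s)%:E) by exact: emeasurable_funM.
have gh0 s : 0 <= g s * (hI a b s)%:E by rewrite mule_ge0// lee_fin.
have mq : measurable_fun setT q by exact: emeasurable_funM.
have q0 s : 0 <= q s by rewrite mule_ge0// lee_fin.
have wk := ae_timeI (ae_time_le bT weakU) (ae_time_le bT weakW).
have meanD : ae_time b (fun s => mean_le mu (1 - 2 * rho) (fun x => D (s, x)) (q s)).
  apply: ae_time_imp (ae_timeI wk gw) => s /andP[s0 sb] [[hU hW] hg].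
  have mUs := mEs s mU; have mWs := mEs s mW.
  have U0 x : (0 <= enorm (U (s, x)))%R by exact: enorm_ge0.
  have W0 x : (0 <= enorm (W (s, x)))%R by exact: enorm_ge0.
  have A0 : 0 <= (C3 * h s)%:E * g s by rewrite mule_ge0// lee_fin mulr_ge0// ltW.
  have pU := hC3 _ _ _ (h s) (mws s) (fun x => w0 (s, x)) mUs U0 (g0 s) (h0 s) hg hU.
  have pW := hC3 _ _ _ (h s) (mws s) (fun x => w0 (s, x)) mWs W0 (g0 s) (h0 s) hg hW.
  have mp (k : V -> R) : measurable_fun setT k ->
      measurable_fun setT (fun x : V => (w (s, x) * k x)%:E).
    by move=> mk; apply/measurable_EFinP; exact: measurable_funM.
  have p0 (k : V -> R) : (forall x, 0 <= k x)%R -> forall x, 0 <= (w (s, x) * k x)%:E.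
    by move=> k0 x; rewrite lee_fin mulr_ge0.
  have := mean_leD (mp _ mUs) (p0 _ U0) (mp _ mWs) (p0 _ W0) A0 A0 pU pW.
  rewrite (_ : (fun x => _) = fun x => D (s, x)); last first.
    by apply/funext => x; rewrite -EFinD -mulrDr.
  apply: mean_le_weaken; rewrite /q.
  have [sab|sab] := boolP (a < s < b)%R; last by rewrite gab// !(mul0e, mule0) adde0.
  rewrite /hI indicE mem_set ?mulr1; last by rewrite /= in_itv.
  have hs0 := ltW (h0 s).
  rewrite -ge0_muleDl ?lee_fin ?mulr_ge0 ?(ltW C30)// -EFinD -mulrDl (muleC (g s)) muleA -EFinM.
  exact: lexx.
have meanq : mean_le lam (1 - 2 * theta) q ((C3 + C3)%:E * ((C4 * e)%:E * G%:E)).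
  apply: mean_leZ => //.
  exact: (hC4 g _ _ e mg g0 (mhI a b) (hI0 a b) (_ : 0 <= G%:E) e0 meang hH).
have A1 : 0 <= (C3 + C3)%:E * ((C4 * e)%:E * G%:E).
  by rewrite -!EFinM lee_fin !mulr_ge0// ltW.
have := hC6 q _ mq q0 A1 meanq.
set conv := fun t => _; move=> meanconv.
have mconv : measurable_fun setT conv.
  apply: measurable_time_conv => //; first exact: measurable_time_kernel.
  exact: time_kernel_ge0.
have conv0 t : 0 <= conv t.
  by apply: integral_ge0 => s _; rewrite mule_ge0// lee_fin time_kernel_ge0.
have C050 : (0 <= C0 * C5)%R by rewrite mulr_ge0// ltW.
pose g' t := (C0 * C5)%:E * conv t.
have mg' : measurable_fun setT g' by exact: emeasurable_funM.
have g'0 t : 0 <= g' t by rewrite mule_ge0// lee_fin.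
have mIE : measurable_fun setT (EFin \o (\1_(`]a, b[%classic) : R -> R)) by exact/measurable_EFinP.
exists (fun t => g' t * (\1_(`]a, b[%classic) t)%:E); split.
- exact: emeasurable_funM.
- by move=> t; rewrite mule_ge0// lee_fin.
- move=> s hs; rewrite indicE memNset ?mule0//=.
  by rewrite in_itv/=; exact/negP.
- have meang' : mean_le lam (1 - theta) g' (G / 2)%:E.
    have := mean_leZ C050 mconv conv0 meanconv; apply: mean_le_weaken.
    rewrite -!EFinM lee_fin; apply: le_of_eq.
    by rewrite /e /K; field; rewrite !gt_eqF// addr_gt0.
  apply: mean_le_fun meang'.
  + exact: emeasurable_funM.
  + by move=> t; rewrite mule_ge0// lee_fin.
  + exact: mg'.
  + by move=> t; rewrite indicE; case: (t \in _); rewrite ?mule1// mule0.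
apply: ae_time_imp (ae_timeI (ae_time_le bT hC0) (ae_time_after b hva)) => t /andP[t0 tb] [hw hz].
have [ta|ta] := leP t a.
  by apply: mean_vanish; [rewrite mule_ge0// lee_fin|exact: hz].
rewrite indicE mem_set ?mule1; last by rewrite /= in_itv/= ta tb.
have tT : (0 < t < T)%R by rewrite t0 (lt_le_trans tb).
have hduh := hC5 D q t mD D0 mq q0 tT (ae_time_le (ltW tb) meanD).
have mduh : measurable_fun setT (duhamel D t) by exact: measurable_duhamel.
have duh0 x : 0 <= duhamel D t x by exact: duhamel_ge0.
have := mean_leZ (ltW C00) mduh duh0 hduh; rewrite muleA -EFinM; apply: mean_le_off_null => //.
- exact/measurable_EFinP.
- by move=> x; rewrite lee_fin.
- exact: emeasurable_funM.
- by move=> x; rewrite mule_ge0// lee_fin ltW.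
Qed.

(** The integral of [w] over a product of sets of finite measure is at most a fixed
    multiple of [G / 2^k] for every [k]. *)
Lemma bounded_vanish a b (G : R) : (0 <= G)%R ->
  (forall k : nat, bounded_by a b (G / 2 ^+ k)) -> vanishes_before b.
Proof.
move=> G0 hG; have [E TE mE'] := sigma_finiteT mu.
have mwE : measurable_fun setT (EFin \o w) by exact/measurable_EFinP.
pose phi i s := \int[mu]_(x in E i) (w (s, x))%:E.
have phi0 i s : 0 <= phi i s by apply: integral_ge0 => x _; rewrite lee_fin.
have mIE i : measurable_fun setT (\1_(E i) : V -> R).
  by apply: measurable_indic; have [] := mE' i.
have mphi i : measurable_fun setT (phi i).
  rewrite (_ : phi i = fun s => \int[mu]_x ((w (s, x))%:E * (\1_(E i) x)%:E)); last first.
    by apply/funext => s; rewrite /phi integral_mul_indic.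
  apply: (@measurable_fun_fubini_tonelli_F _ _ _ _ _ mu
    (fun z : R * V => (w z)%:E * (\1_(E i) z.2)%:E)).
    apply: emeasurable_funM => //; apply/measurable_EFinP.
    exact: (measurableT_comp (mIE i) measurable_snd).
  by move=> z; rewrite mule_ge0// lee_fin.
have mIb : measurable_fun setT (EFin \o (\1_(`]0%R, b[%classic) : R -> R)) by exact/measurable_EFinP.
pose phib i s := phi i s * (\1_(`]0%R, b[%classic) s)%:E.
have mphib i : measurable_fun setT (phib i) by exact: emeasurable_funM.
have phib0 i s : 0 <= phib i s by rewrite mule_ge0// lee_fin.
have phi_mean i : mean_le lam (1 - theta) (phib i) 0.
  have [mEi fEi] := mE' i.
  pose e := ((fine (mu (E i))) `^ (1 - rho))%R.
  have e0 : (0 <= e)%R by rewrite powR_ge0.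
  move=> F mF fF; rewrite mul0e.
  pose c := (e * (G * (fine (lam F)) `^ (1 - theta)))%R.
  have c0 : (0 <= c)%R by rewrite !mulr_ge0// powR_ge0.
  apply: (le0_halving c0) => k; have [g [mg g0 gab meang gw]] := hG k.
  apply: (@le_trans _ _ (\int[lam]_(s in F) (e%:E * g s))).
    apply: ae_ge0_le_integral.
    - exact: mF.
    - by move=> s _; exact: phib0.
    - by apply: measurable_funTS; exact: mphib.
    - by move=> s _; rewrite mule_ge0// lee_fin.
    - by apply: measurable_funTS; exact: emeasurable_funM.
    apply: negligibleS gw => s /= /not_implyP[_].
    rewrite /phib indicE; case: (boolP (s \in _)) => [/set_mem/=|_]; last first.
      by rewrite mule0 => hs; exfalso; apply: hs; rewrite mule_ge0// lee_fin.
    rewrite in_itv/= mule1 => sb hs; split => //; apply: contra_not hs => hs.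
    by rewrite muleC; exact: hs.
  rewrite ge0_integralZl_EFin//; last exact: measurable_funTS.
  apply: (@le_trans _ _ (e%:E * ((G / 2 ^+ k)%:E * ((fine (lam F)) `^ (1 - theta))%:E))).
    by rewrite lee_wpmul2l ?lee_fin//; exact: meang.
  by rewrite -!EFinM lee_fin; apply: le_of_eq; rewrite /c; ring.
have : lam.-negligible (\bigcup_i [set s | phib i s <> 0]).
  have phi_null i : lam.-negligible [set s | phib i s <> 0].
    exact: (@mean_le0_ae _ _ _ lam _ _ (mphib i) (phib0 i) (phi_mean i)).
  by apply: negligible_bigcup => i; exact: phi_null.
apply: negligibleS => s /= [sb]; apply: contra_notP => hs.
have {}hs i : phi i s = 0.
  apply: contra_notP hs => hs; exists i => //=; apply: contra_not hs.
  by rewrite /phib indicE mem_set ?mule1//= in_itv.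
have : mu.-negligible (\bigcup_i [set x | ~ (E i x -> (w (s, x))%:E = 0)]).
  apply: negligible_bigcup => i; have [mEi fEi] := mE' i.
  have mwsE : measurable_fun (E i) (fun x => (w (s, x))%:E).
    by apply: measurable_funTS; exact/measurable_EFinP.
  apply: (ae_eq_integral_abs mu mEi mwsE).1.
  under eq_integral do rewrite gee0_abs ?lee_fin//.
  exact: hs.
apply: negligibleS => x /= UW; have : setT x by []; rewrite TE => -[i _ Eix].
exists i => //= hx; have := hx Eix; case => /eqP wz; apply: UW.
apply/eqP; rewrite -subr_eq0; apply/eqP/rowP => k; rewrite [RHS]mxE.
apply/eqP; rewrite -normr_eq0 eq_le normr_ge0 andbT.
by apply: (le_trans (enorm_coord _ k)); rewrite -/(w (s, x)) (eqP wz).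
Qed.

(** The length [dlt] of the intervals on which [h] is small is uniform, so finitely
    many steps lead from 0 to [T]. *)
Lemma mild_solution_unique : vanishes_before T.
Proof.
have [e e0 hhalve] := bounded_halve.
have m0 : (0 < Num.min 1%R e)%R by rewrite lt_min ltr01.
have [dlt dlt0 hdlt] := short_hI m0.
have step a b : (0 <= a)%R -> (a <= b)%R -> (b <= T)%R -> (b - a <= dlt)%R ->
    vanishes_before a -> vanishes_before b.
  move=> a0 ab bT bad hva; have hw := hdlt _ _ ab bad.
  have hw1 : weak_le lam theta (hI a b) 1 by apply: weak_le_mono hw; rewrite ge_min lexx.
  have hwe : weak_le lam theta (hI a b) e by apply: weak_le_mono hw; rewrite ge_min lexx orbT.
  have [G G0 hG] := bounded_start a0 ab bT hva hw1.
  apply: (bounded_vanish (a := a) G0) => k.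
  elim: k => [|k IH]; first by rewrite expr0 divr1.
  rewrite exprSr invfM mulrA; apply: hhalve => //.
  by rewrite divr_ge0// exprn_ge0.
have march (k : nat) : vanishes_before (Num.min T (k%:R * dlt)%R).
  elim: k => [|k IH].
    rewrite mul0r min_r; last exact: ltW.
    apply: negligibleS (negligible_set0 _) => s /= [/andP[s0 /(lt_trans s0)]].
    by rewrite ltxx.
  have kS : (k%:R * dlt <= k.+1%:R * dlt)%R by rewrite ler_wpM2r ?ler_nat// ltW.
  apply: step IH.
  - by rewrite le_min (ltW T0) mulr_ge0// ltW.
  - by rewrite le_min !ge_min lexx kS orbT.
  - by rewrite ge_min lexx.
  - rewrite lerBlDr -natr1 mulrDl mul1r; have [Tk|kT] := leP T (k%:R * dlt)%R.
      apply: (@le_trans _ _ T); first by rewrite ge_min lexx.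
      by rewrite lerDr ltW.
    by rewrite ge_min addrC lexx orbT.
have := march (Num.bound (T / dlt)); rewrite min_l//.
rewrite -ler_pdivrMr//; apply/ltW/archi_boundP.
by rewrite divr_ge0// ltW.
Qed.

End uniqueness.

(** * Dimension one *)

Section one_dimension.
Context {R : realType}.
Notation V := 'rV[R]_1.
Local Open Scope ring_scope.

(** On the line the Leray symbol [1 - xi^2/xi^2] vanishes. This case is separate
    because the contraction needs [1/r < 1/2], which [r > n] implies for [n >= 2]
    only. *)
Lemma grad_oseen_int_dim1 (k i j : 'I_1) t (x : V) : grad_oseen_int k i j t x = 0.
Proof.
rewrite /grad_oseen_int /Rintegral integral0_eq// => xi _; congr EFin.
rewrite (ord1 k) (ord1 i) (ord1 j) /leray eqxx /dotp !big_ord1.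
have [->|xi0] := eqVneq (xi ord0 ord0) 0; first by rewrite !mul0r !mulr0.
by rewrite divff ?mulf_neq0// subrr !mulr0.
Qed.

Lemma bilinear_op_dim1 (u v : R -> V -> V) t x : bilinear_op u v t x = 0.
Proof.
apply/rowP => i; rewrite mxE [RHS]mxE /Rintegral integral0_eq// => s /=.
rewrite in_itv/= => /andP[_ st]; rewrite integral0_eq// => y _.
rewrite !big_ord1 grad_oseenE ?subr_gt0//.
by rewrite grad_oseen_int_dim1 !mul0r.
Qed.

End one_dimension.

(** * Uniqueness in path spaces *)

Section path_uniqueness.
Context {R : realType} {n : nat}.
Notation V := 'rV[R]_n.
Notation mu := (@lebesgue_rV R n).
Notation lam := (@lebesgue_measure R).
Local Open Scope ereal_scope.

Lemma vanishing_tail_add (alpha : R) (D D1 D2 : R -> \bar R) : (1 <= alpha)%R ->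
  (forall y, D y <= D1 y + D2 y) ->
  vanishing_tail alpha D1 -> vanishing_tail alpha D2 -> vanishing_tail alpha D.
Proof.
move=> al1 DD h1 h2 e e0; have e20 : (0 < e / 2)%R by rewrite divr_gt0.
have [y1 y10 hy1] := h1 _ e20; have [y2 y20 hy2] := h2 _ e20.
exists (Num.max y1 y2)%R; first by rewrite lt_max y10.
move=> y; rewrite ge_max => /andP[yy1 yy2]; have y0 := lt_le_trans y10 yy1.
apply: (le_trans (DD y)); apply: (le_trans (leeD (hy1 _ yy1) (hy2 _ yy2))).
rewrite -EFinD lee_fin (_ : (e / y = 2 * (e / 2 / y))%R); last by field; rewrite gt_eqF.
rewrite [leRHS]powRM ?divr_ge0 ?(ltW e0) ?(ltW y0)// -mulr2n -(mulr_natl (_ `^ _)) ler_wpM2r ?powR_ge0//.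
by rewrite -[leLHS]powRr1// ler_powR// ler1n.
Qed.

(** Borel versions satisfy the same equations almost everywhere, since the bilinear
    operator does not see null sets. *)
Lemma path_space_unique (alpha beta T : R) (r : lexp R) (u v : R -> V -> V) :
  (2 < alpha)%R -> (0 < beta)%R -> (0 <= lexp_inv r < 2^-1)%R ->
  (2 / alpha + n%:R * lexp_inv r <= 1)%R -> (0 < T)%R ->
  path_space (lfin alpha) (lfin beta) r linfty T%:E u ->
  path_space (lfin alpha) (lfin beta) r linfty T%:E v ->
  ae_time T (fun t => mu.-negligible [set x |
    (u t x + bilinear_op u u t x)%R <> (v t x + bilinear_op v v t x)%R]) ->
  ae_time T (fun t => mu.-negligible [set x | u t x <> v t x]).
Proof.
move=> al2 be0 rho_itv index T0 hu hv equv.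
have al0 : (0 < alpha)%R by apply: lt_trans al2.
have [U [hU [mU mhU hU0 tailU verU]]] := path_space_Borel al0 be0 hu.
have [W [hW [mW mhW hW0 tailW verW]]] := path_space_Borel al0 be0 hv.
have verUW := ae_timeI (verU : ae_time T _) (verW : ae_time T _).
pose h s := Num.max (hU s) (hW s).
have mh : measurable_fun setT h by exact: measurable_maxr.
have h0 s : (0 < h s)%R by rewrite lt_max hU0.
have tail : vanishing_tail alpha (fun y => lam [set t | y < h t]%R).
  apply: vanishing_tail_add tailU tailW; first by apply: ltW; apply: lt_trans al2; rewrite ltr1n.
  move=> y; have mSU := measurable_superlevel y mhU; have mSW := measurable_superlevel y mhW.
  apply: (le_trans _ (measureU2 lam mSU mSW)); apply: le_measure; rewrite ?inE.
  - exact: measurable_superlevel.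
  - exact: measurableU.
  - by move=> s /=; rewrite lt_max => /orP[]; [left|right].
have weakU : ae_time T (fun s => weak_le mu (lexp_inv r) (fun x => enorm (U (s, x))) (h s)).
  by apply: ae_time_imp verUW => s _ [[_ hs] _]; apply: weak_le_mono hs; rewrite le_max lexx.
have weakW : ae_time T (fun s => weak_le mu (lexp_inv r) (fun x => enorm (W (s, x))) (h s)).
  by apply: ae_time_imp verUW => s _ [_ [_ hs]]; apply: weak_le_mono hs; rewrite le_max lexx orbT.
have eqUW : ae_time T (fun t => mu.-negligible [set x | ~
    (U (t, x) + bilinear_op (fun s y => U (s, y)) (fun s y => U (s, y)) t x =
     W (t, x) + bilinear_op (fun s y => W (s, y)) (fun s y => W (s, y)) t x)%R]).
  apply: ae_time_imp (ae_timeI verUW equv) => t /andP[t0 tT] [[[uU _] [vW _]] eqt].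
  apply: negligibleS (negligibleU eqt (negligibleU uU vW)) => x /=; apply: contra_notP.
  move=> /not_orP[/contrapT hx] /not_orP[/contrapT hu' /contrapT hv'].
  rewrite -hu' -hv'.
  have verU' := ae_time_le (ltW tT) verUW.
  rewrite -(@bilinear_op_off_null R n u (fun s y => U (s, y))); last first.
    by apply: ae_time_imp verU' => s _ [[]].
  rewrite -(@bilinear_op_off_null R n v (fun s y => W (s, y))); last first.
    by apply: ae_time_imp verU' => s _ [_ []].
  exact: hx.
have theta_itv : (0 < alpha^-1 < 2^-1)%R.
  by rewrite invr_gt0 al0 ltf_pV2 ?posrE.
have := mild_solution_unique rho_itv theta_itv erefl index T0 mU mW mh h0 tail weakU weakW eqUW.
move=> /(ae_timeI verUW); apply: ae_time_imp => s _ [[[uU _] [vW _]] UW].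
apply: negligibleS (negligibleU UW (negligibleU uU vW)) => x /=; apply: contra_notP.
by move=> /not_orP[/contrapT hx] /not_orP[/contrapT -> /contrapT ->].
Qed.

Lemma eq_lexp_negligible (r : lexp R) (f g : V -> V) :
  eq_lexp r f g -> mu.-negligible [set x | f x <> g x].
Proof.
case: r => [a||] //= fg; apply: negligibleS (negligible_set0 _) => x /=; exact.
Qed.

(** Equality almost everywhere comes first. For the true supremum norm it makes the
    bilinear terms equal at every point, and subtracting them from the equations
    gives equality everywhere. *)
Lemma mild_path_unique (alpha beta T : R) (r : lexp R) (F u v : R -> V -> V) : (1 <= n)%N ->
  lexp_gt n%:R r -> (2 < alpha)%R -> (0 < beta)%R ->
  (2 / alpha + n%:R * lexp_inv r <= 1)%R -> (0 < T)%R ->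
  path_space (lfin alpha) (lfin beta) r linfty T%:E u ->
  path_space (lfin alpha) (lfin beta) r linfty T%:E v ->
  ae_time T (fun t => eq_lexp r (F t) (fun x => u t x + bilinear_op u u t x)%R) ->
  ae_time T (fun t => eq_lexp r (F t) (fun x => v t x + bilinear_op v v t x)%R) ->
  ae_time T (fun t => eq_lexp r (u t) (v t)).
Proof.
move=> n1 rn al2 be0 index T0 hu hv equ eqv.
have equv : ae_time T (fun t => mu.-negligible [set x |
    (u t x + bilinear_op u u t x)%R <> (v t x + bilinear_op v v t x)%R]).
  apply: ae_time_imp (ae_timeI equ eqv) => t _ [/eq_lexp_negligible e1 /eq_lexp_negligible e2].
  apply: negligibleS (negligibleU e1 e2) => x /=; apply: contra_notP.
  by move=> /not_orP[/contrapT <- /contrapT <-].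
have uv : ae_time T (fun t => mu.-negligible [set x | u t x <> v t x]).
  move: n1; rewrite leq_eqVlt => /orP[/eqP n1|n2].
    apply: ae_time_imp equv => t _; apply: negligibleS => x /=; apply: contra_not.
    by case: _ / n1 u v {hu hv equ eqv} x => u v x; rewrite !bilinear_op_dim1 !addr0.
  apply: (path_space_unique al2 be0 _ index T0 hu hv equv).
  case: (r) rn => [a||] /= an; rewrite ?lexx ?invr_gt0 ?ltr0n//.
  have a2 : (2 < a)%R by apply: le_lt_trans an; rewrite ler_nat.
  have a0 : (0 < a)%R by apply: lt_trans a2.
  by rewrite invr_ge0 ltW//= ltf_pV2 ?posrE.
case: r rn index hu hv equ eqv => [a||] rn index hu hv equ eqv.
- by apply: ae_time_imp uv => t _; exact: negligibleS.
- by apply: ae_time_imp uv => t _; exact: negligibleS.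
apply: ae_time_imp (ae_timeI equ eqv) => t /andP[_ tT] [/= eu ev] x.
have := eu x; rewrite ev (bilinear_op_off_null x (ae_time_le (ltW tT) uv)).
by move/addIr => ->.
Qed.

End path_uniqueness.

Theorem theorem2p2 (R : realType) (n : nat) (hn : (1 <= n)%N)
    (p r : lexp R) (alpha beta : R)
    (hp : lexp_gt 1 p) (hp_sup : p <> lsup)
    (hr : lexp_gt n%:R r)
    (halpha : 2 < alpha) (hbeta : 1 <= beta)
    (hindex : 2 / alpha + n%:R * lexp_inv r <= 1)
    (T : \bar R) (hT : (0 < T)%E)
    (f : 'rV[R]_n -> 'rV[R]_n) (hf : lorentz_space p linfty f)
    (u v : R -> 'rV[R]_n -> 'rV[R]_n)
    (hu : path_space_minus (lfin alpha) (lfin beta) r linfty T u)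
    (hv : path_space_minus (lfin alpha) (lfin beta) r linfty T v)
    (equ : eq_lexp_ae r T (heat_op f)
             (fun t x => u t x + bilinear_op u u t x))
    (eqv : eq_lexp_ae r T (heat_op f)
             (fun t x => v t x + bilinear_op v v t x)) :
  eq_lexp_ae r T u v.
Proof.
have restrict (q : R) (g1 g2 : R -> 'rV[R]_n -> 'rV[R]_n) : time_interval T q ->
    eq_lexp_ae r T g1 g2 -> ae_time q (fun t => eq_lexp r (g1 t) (g2 t)).
  move=> [_ qT]; apply: negligibleS => t /= [/andP[t0 tq]]; apply: contra_not; apply.
  by split => //; apply: lt_trans qT; rewrite lte_fin.
have local (q : R) : time_interval T q -> ae_time q (fun t => eq_lexp r (u t) (v t)).
  move=> qT; have [q0 _] := qT.
  apply: (mild_path_unique hn hr halpha _ hindex q0 (hu q qT) (hv q qT)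
    (restrict _ _ _ qT equ) (restrict _ _ _ qT eqv)).
  by apply: lt_le_trans hbeta.
(* rational times below [T] give countably many exceptional null sets *)
pose q (k : nat) : R := ratr (odflt 0 (unpickle k : option rat)).
have : (@lebesgue_measure R).-negligible (\bigcup_k
    [set t | time_interval T (q k) /\ 0 < t < q k /\ ~ eq_lexp r (u t) (v t)]).
  apply: negligible_bigcup => k; have [qT|qT] := pselect (time_interval T (q k)).
    by apply: negligibleS (local _ qT) => t /= [].
  by apply: negligibleS (negligible_set0 _) => t /= [].
apply: negligibleS => t /= /not_implyP[[t0 tT] huv].
have [a [ta aT]] : exists a : rat, t < ratr a /\ ((ratr a : R)%:E < T)%E.
  case: T tT {hT hu hv equ eqv restrict local} => [b| |//] tT.
    have /rat_in_itvoo[a] : t < b by rewrite -lte_fin.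
    by rewrite in_itv/= => /andP[ta ab]; exists a; rewrite lte_fin.
  have /rat_in_itvoo[a] : t < t + 1 by rewrite ltrDl.
  by rewrite in_itv/= => /andP[ta _]; exists a; rewrite ltry.
exists (pickle a) => //=; rewrite /q pickleK/=; split; last by rewrite t0 ta.
by split => //; exact: lt_trans ta.
Qed.
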